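(* Assume (a) (A1)–(A3) and (A5) hold and (A6) holds for each $l=0,\dots,p$; and (b) with $\lambda_n$ the minimum eigenvalue of $\Sigma_n$: $\liminf_{n\to\infty}\lambda_n/n>0$, $\xi_n(2)=O(n)$ and $\tilde r_n:=\max_{j\le n}|\mathbf x_j|=O[n^{1/2}(\log n)^{-2}]$. Let $\iota>0$, $b_n=n^{-1/2}(\log n)^{3/2}(\log\log n)^{1/2+\iota}$, $\bar n=2^{\lceil\log n/\log 2\rceil}$, $q>3/2$, $B_n=b_n\sqrt{\xi_n(4)}(\log n)^{3/2}(\log\log n)^{(1+\iota)/2}$, $L_n=\sqrt{\tilde\tau_n(2b_n)}(\log n)^q$, where $\tilde\tau_n(\delta)=\sum_{i=1}^n|\mathbf x_i|^2[m^2(|\mathbf x_i|\delta)+m^2(-|\mathbf x_i|\delta)]$. Then (i) $\sup_{|\beta|\le b_n}|\tilde K_n(\beta)-\tilde K_n(0)|=O_{a.s.}(L_{\bar n}+B_{\bar n})$. If in addition $\varphi(t)=t\varphi'(0)+O(t^2)$ and $m(t)=O(\sqrt{t})$ as $t\to0$, and $\tilde\Omega_n(\hat\beta_n)=O_{a.s.}(\tilde r_n)$, then (ii) $\hat\beta_n=O_{a.s.}(b_n)$, and (iii) $\varphi'(0)\Sigma_n\hat\beta_n-\sum_{i=1}^n\psi(e_i)\mathbf x_i=O_{a.s.}\big(L_{\bar n}+B_{\bar n}+\xi_n(3)b_n^2+\tilde r_n\big)$.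
   Context: Setup: $(\varepsilon_k)_{k\in\mathbb Z}$ i.i.d., $\mathcal F_k=(\dots,\varepsilon_{k-1},\varepsilon_k)$, $e_i=G(\mathcal F_i)$ ($G$ measurable). $(\varepsilon_k')$ an independent i.i.d. copy; $\mathcal F_k^*=(\dots,\varepsilon_{-1},\varepsilon_0',\varepsilon_1,\dots,\varepsilon_k)$ for $k\ge0$, $\mathcal F_k^*=\mathcal F_k$ for $k<0$. $\|V\|=(E|V|^2)^{1/2}$, $|\cdot|$ Euclidean norm. Linear model $y_i=\mathbf x_i'\beta+e_i$, nonstochastic $\mathbf x_i\in\mathbb R^p$, true $\beta_0=0$, $\Sigma_n=\sum_{i\le n}\mathbf x_i\mathbf x_i'$, $\xi_n(q)=\sum_{i=1}^n|\mathbf x_i|^q$. $\rho$ convex with nondecreasing derivative $\psi$; $\hat\beta_n$ any minimizer of $\sum_{i=1}^n\rho(y_i-\mathbf x_i'\beta)$. $\varphi(t)=E\psi(e_1+t)$, $m(t)=\|\psi(e_1+t)-\psi(e_1)\|$. $\tilde\Omega_n(\beta)=\sum_{i=1}^n\psi(e_i-\mathbf x_i'\beta)\mathbf x_i$, $\tilde K_n(\beta)=\tilde\Omega_n(\beta)-E\tilde\Omega_n(\beta)$. $\psi_1(s;\cdot)$ is the measurable function with $\psi_1(s;\mathcal F_i)=E[\psi(e_{i+1}+s)\mid\mathcal F_i]$; $\psi_1(s;\mathcal F_i^* )$ is it evaluated at $\mathcal F_i^*$; $\psi_1^{(l)}$ its $l$-th $s$-derivative. (A1) $\rho$ convex, $E\psi(e_1)=0$,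 $0<\|\psi(e_1)\|<\infty$. (A2) $\varphi'(0)>0$ exists. (A3) $m$ continuous at $0$. (A5) for some $\epsilon_0>0$, $\sup_{|s|,|t|\le\epsilon_0,s\ne t}|\psi_1(s;\mathcal F_i)-\psi_1(t;\mathcal F_i)|/|s-t|$ is integrable. (A6) (for given $l$): $\psi_1(\cdot;\mathcal F_i)\in C^l$, and for some $\epsilon_0>0$, $\sup_{|\epsilon|\le\epsilon_0}\|\psi_1^{(l)}(\epsilon;\mathcal F_i)\|<\infty$ and $\sum_{i=0}^\infty\sup_{|\epsilon|\le\epsilon_0}\|E[\psi_1^{(l)}(\epsilon;\mathcal F_i)\mid\mathcal F_0]-E[\psi_1^{(l)}(\epsilon;\mathcal F_i^* )\mid\mathcal F_0^*]\|<\infty$. $\eta_n=O_{a.s.}(d_n)$ means $\eta_n/d_n$ is a.s. bounded. *)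

(* Defs.v *)
From HB Require Import structures.
From mathcomp Require Import all_boot all_order all_algebra.
From mathcomp Require Import all_classical all_reals all_analysis.
Set Implicit Arguments. Unset Strict Implicit. Unset Printing Implicit Defensive.
Import Order.TTheory GRing.Theory Num.Theory.
Import numFieldNormedType.Exports.
Local Open Scope classical_set_scope.
Local Open Scope ring_scope.

Definition gen_sigma {dT dS} {T : measurableType dT} {S : measurableType dS}
  {I : Type} (J : set I) (X : I -> T -> S) : set (set T) :=
  <<s \bigcup_(j in J) preimage_set_system setT (X j) measurable >>.

Definition G_measurable {T : Type} {R : realType} (G : set (set T)) (Y : T -> R) :=
  forall B : set R, measurable B -> G (Y @^-1` B).

Definition is_condexp {dT} {T : measurableType dT} {R : realType}
  (P : probability T R) (G : set (set T)) (X Y : T -> R) : Prop :=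
  [/\ G_measurable G Y,
      P.-integrable setT (EFin \o X),
      P.-integrable setT (EFin \o Y) &
      forall A, G A ->
        (\int[P]_(w in A) (X w)%:E = \int[P]_(w in A) (Y w)%:E)%E].

Definition mutually_independent {dT dS} {T : measurableType dT}
  {S : measurableType dS} {R : realType} {I : eqType}
  (P : probability T R) (X : I -> T -> S) : Prop :=
  (forall i, measurable_fun setT (X i)) /\
  forall (J : seq I) (B : I -> set S), uniq J -> (forall j, measurable (B j)) ->
    P (\big[setI/setT]_(j <- J) (X j @^-1` B j)) =
    (\prod_(j <- J) P (X j @^-1` B j))%E.

Definition iid {dT dS} {T : measurableType dT} {S : measurableType dS}
  {R : realType} {I : eqType} (P : probability T R) (X : I -> T -> S) : Prop :=
  mutually_independent P X /\
  forall i j (B : set S), measurable B -> P (X i @^-1` B) = P (X j @^-1` B).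

Definition seq_sigma {dS} {S : measurableType dS} : set (set (nat -> S)) :=
  <<s \bigcup_(k in [set: nat]) preimage_set_system setT (fun f : nat -> S => f k)
        measurable >>.

Definition seq_measurable_fun {dS} {S : measurableType dS} {R : realType}
  (G : (nat -> S) -> R) : Prop :=
  forall B : set R, measurable B -> seq_sigma (G @^-1` B).

Definition Oas {dT} {T : measurableType dT} {R : realType} (P : probability T R)
  (eta : nat -> T -> \bar R) (d : nat -> \bar R) : Prop :=
  {ae P, forall w, exists2 C : R, 0 < C &
     \forall n \near \oo, (`|eta n w| <= C%:E * d n)%E}.

Definition Ck {R : realType} (l : nat) (f : R -> R) : Prop :=
  (forall k, (k < l)%N -> forall s, derivable (derive1n k f) s 1) /\
  continuous (derive1n l f).

(* F_i = (..., eps_{i-1}, eps_i), encoded by lags: F_i j = eps_{i-j} *)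
Definition Fpast {T S : Type} (eps : int -> T -> S) (i : int) (w : T) : nat -> S :=
  fun j => eps (i - j%:Z) w.

(* F_i^* : eps_0 replaced by eps'_0 (equals F_i when i < 0) *)
Definition Fstar {T S : Type} (eps eps' : int -> T -> S) (i : int) (w : T)
  : nat -> S :=
  fun j => if i - j%:Z == 0 then eps' 0 w else eps (i - j%:Z) w.

Definition joint {T S : Type} (eps eps' : int -> T -> S) (k : int + int) : T -> S :=
  match k with inl k => eps k | inr k => eps' k end.

Definition sigmaF {dT dS} {T : measurableType dT} {S : measurableType dS}
  (eps : int -> T -> S) (i : int) : set (set T) :=
  gen_sigma [set k : int | k <= i] eps.

Definition sigmaF0star {dT dS} {T : measurableType dT} {S : measurableType dS}
  (eps eps' : int -> T -> S) : set (set T) :=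
  gen_sigma [set k : int + int | match k with inl k => k < 0 | inr k => k == 0 end]
    (joint eps eps').

Definition err {T S : Type} {R : realType} (G : (nat -> S) -> R)
  (eps : int -> T -> S) (i : int) (w : T) : R := G (Fpast eps i w).

Definition dotv {R : realType} {p : nat} (u v : 'cV[R]_p) : R :=
  \sum_(k < p) u k 0 * v k 0.

Definition normv {R : realType} {p : nat} (v : 'cV[R]_p) : R :=
  Num.sqrt (dotv v v).

Definition Sigma {R : realType} {p : nat} (x : nat -> 'cV[R]_p) (n : nat)
  : 'M[R]_p := \sum_(1 <= i < n.+1) (x i *m (x i)^T).

Definition xin {R : realType} {p : nat} (x : nat -> 'cV[R]_p) (n q : nat) : R :=
  \sum_(1 <= i < n.+1) normv (x i) ^+ q.

Definition rtilde {R : realType} {p : nat} (x : nat -> 'cV[R]_p) (n : nat) : R :=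
  \big[Num.max/0]_(1 <= j < n.+1) normv (x j).

(* minimum eigenvalue (as an extended real; +oo if no eigenvalue) *)
Definition lambda_min {R : realType} {p : nat} (A : 'M[R]_p) : \bar R :=
  ereal_inf [set a%:E | a in [set a : R | eigenvalue A a]].

Definition Omegat {T : Type} {R : realType} {p : nat} (psi : R -> R)
  (x : nat -> 'cV[R]_p) (e : int -> T -> R) (n : nat) (beta : 'cV[R]_p) (w : T)
  : 'cV[R]_p :=
  \sum_(1 <= i < n.+1) (psi (e i%:Z w - dotv (x i) beta) *: x i).

Definition EOmegat {dT} {T : measurableType dT} {R : realType} {p : nat}
  (P : probability T R) (psi : R -> R) (x : nat -> 'cV[R]_p) (e : int -> T -> R)
  (n : nat) (beta : 'cV[R]_p) : 'cV[R]_p :=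
  \col_k fine ('E_P[fun w => Omegat psi x e n beta w k 0]).

Definition Kt {dT} {T : measurableType dT} {R : realType} {p : nat}
  (P : probability T R) (psi : R -> R) (x : nat -> 'cV[R]_p) (e : int -> T -> R)
  (n : nat) (beta : 'cV[R]_p) (w : T) : 'cV[R]_p :=
  Omegat psi x e n beta w - EOmegat P psi x e n beta.

Definition phi {dT} {T : measurableType dT} {R : realType} (P : probability T R)
  (psi : R -> R) (e : int -> T -> R) (t : R) : R :=
  fine ('E_P[fun w => psi (e 1 w + t)]).

Definition mnorm {dT} {T : measurableType dT} {R : realType} (P : probability T R)
  (psi : R -> R) (e : int -> T -> R) (t : R) : \bar R :=
  Lnorm P 2%:E (fun w => (psi (e 1 w + t) - psi (e 1 w))%:E).

Definition taut {dT} {T : measurableType dT} {R : realType} {p : nat}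
  (P : probability T R) (psi : R -> R) (e : int -> T -> R)
  (x : nat -> 'cV[R]_p) (n : nat) (delta : R) : \bar R :=
  (\sum_(1 <= i < n.+1)
     ((normv (x i) ^+ 2)%:E *
      (mnorm P psi e (normv (x i) * delta) * mnorm P psi e (normv (x i) * delta) +
       mnorm P psi e (- (normv (x i) * delta)) * mnorm P psi e (- (normv (x i) * delta)))))%E.

Definition bn {R : realType} (iota : R) (n : nat) : R :=
  n%:R `^ (- (1/2)) * ln (n%:R) `^ (3/2) * ln (ln (n%:R)) `^ (1/2 + iota).

Definition nbar (n : nat) : nat := (2 ^ up_log 2 n)%N.

Definition Bn {R : realType} {p : nat} (x : nat -> 'cV[R]_p) (iota : R) (n : nat)
  : R :=
  bn iota n * Num.sqrt (xin x n 4) * ln (n%:R) `^ (3/2)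
  * ln (ln (n%:R)) `^ ((1 + iota) / 2).

Definition Ln {dT} {T : measurableType dT} {R : realType} {p : nat}
  (P : probability T R) (psi : R -> R) (e : int -> T -> R)
  (x : nat -> 'cV[R]_p) (iota q : R) (n : nat) : \bar R :=
  (sqrte (taut P psi e x n (2 * bn iota n)) * (ln (n%:R) `^ q)%:E)%E.

(* Main.v *)
(** Everything is read on the law [mu] of the past F_0 on sequences of letters,
    where conditioning on the previous time is the operator Q = [trans] that
    integrates the newest letter out, and u(F_i) - E[u(F_i) | F_{i-1}] is [mdiff u].

    K_n(beta) - K_n(0) splits into a martingale with increments
    psi(e_i - x_i' beta) - psi(e_i), centred given F_{i-1}, and a smooth part in
    psi_1. In the first, monotonicity of psi brackets the increment at beta by
    those at the corners of a grid cell; a truncated exponential martingale bounds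
    all corners at once and (A5) bounds the compensator inside a cell. In the
    second, the increment over a box of R^p is integrated out one coordinate at a
    time into mixed partial derivatives, of order at most p; for each of them (A6)
    and orthogonality of projections give an L2 bound, and a Rademacher-Menshov
    argument makes it uniform in n. Both bounds are taken along n = 2^k as
    nonnegative variables whose means are summable in k, hence a.s. eventually at
    most 1.

    For (ii), (i) and coercivity of Sigma_n show that the radial component of the
    score on the sphere |beta| = b_n is at most -c n b_n; it is nonincreasing along
    rays, so a score of order r~_n is impossible outside the ball. (iii) is the
    expansion of the mean score at the estimator. *)
From HB Require Import structures.
From mathcomp Require Import all_boot all_order all_algebra.
From mathcomp Require Import all_classical all_reals all_analysis.
From mathcomp Require Import measurable_realfun.
From mathcomp Require Import ring lra zify.
Import Order.TTheory GRing.Theory Num.Theory.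
Import numFieldNormedType.Exports.
Require Import Defs.
Set Implicit Arguments. Unset Strict Implicit. Unset Printing Implicit Defensive.
Set SsrOldRewriteGoalsOrder.
Local Open Scope classical_set_scope.
Local Open Scope ring_scope.

(** * The path space *)

(** The exponents come from series indexed by k = log2 n. Rademacher-Menshov costs (k + 1)^2. A sum
    of variance of order n, measured against (n b_n)^2 with b_n^2 n = (log n)^3 (log log n)^(1 + 2
    iota), then leaves a Bertrand term 1/(k (log k)^(1 + 2 iota)); the same count with variance
    b_n^2 xi_n(4) gives B_n. In the martingale part, truncation at sqrt(tau) (log n)^(q - 1) + 1
    costs a mean of order k^(-2 (q - 1)), summable since q > 3/2; one more logarithm, from the
    number of grid corners, completes L_n, and the + 1 leaves a term log n that B_n absorbs. Two
    obstacles shape the rest. Suprema over beta are not known to be measurable, so each is dominated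
    by a measurable variable of controlled mean. The smooth part subtracts means, which would have
    to be differentiated too; it is symmetrised by an independent copy, so that only pathwise
    derivatives occur, and the copy is integrated out at the end. *)

Definition coord_sets dS (S : measurableType dS) : set (set (nat -> S)) :=
  \bigcup_(k in [set: nat]) preimage_set_system setT (fun f : nat -> S => f k)
    measurable.

Arguments coord_sets {dS} S.

(** A type alias, so that sequences carry the product sigma-algebra as canonical structure. Its
    measurable sets unfold to [seq_sigma], hence the measurability hypotheses transfer by
    conversion. *)
Definition seqT dS (S : measurableType dS) := g_sigma_algebraType (coord_sets S).

HB.instance Definition _ dS (S : measurableType dS) :=
  Measurable.on (seqT S).

Section sequences.
Context dS (S : measurableType dS).

(** Index 0 is the newest letter: [scons] moves one step forward in time, [shift] one step back. *)
Definition scons (s : S) (F : nat -> S) : nat -> S :=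
  fun j => if j is j'.+1 then F j' else s.
Definition shift (F : nat -> S) : nat -> S := fun j => F j.+1.
Definition sconsp (z : seqT S * S) : seqT S := scons z.2 z.1.

Lemma shift_scons s F : shift (scons s F) = F. Proof. by []. Qed.

Lemma measurable_coord k : measurable_fun setT (fun F : seqT S => F k).
Proof.
move=> _ B mB; apply: sub_sigma_algebra; exists k => //.
by exists B => //; rewrite setTI.
Qed.

Lemma measurable_fun_seqT d (T : measurableType d) (f : T -> seqT S) :
  (forall k, measurable_fun setT (fun t => f t k)) -> measurable_fun setT f.
Proof.
move=> mf; refine (@measurability _ _ T (seqT S) setT f (coord_sets S) erefl _).
move=> _ [_ [k _ [B mB <-]] <-]; rewrite !setTI.
by have := mf k measurableT B mB; rewrite setTI.
Qed.

Lemma measurable_shift : measurable_fun setT (shift : seqT S -> seqT S).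
Proof. by apply: measurable_fun_seqT => k; exact: measurable_coord. Qed.

Lemma measurable_sconsp : measurable_fun setT sconsp.
Proof.
apply: measurable_fun_seqT => -[|k]; first exact: measurable_snd.
exact: measurableT_comp (measurable_coord k) measurable_fst.
Qed.

Definition cyl (n : nat) (B : nat -> set S) : set (seqT S) :=
  [set F | forall j, (j < n)%N -> B j (F j)].

Definition cyls : set (set (seqT S)) :=
  [set A | exists n B, (forall j, measurable (B j)) /\ A = cyl n B].

Lemma measurable_cyl n B : (forall j, measurable (B j)) -> measurable (cyl n B).
Proof.
move=> mB.
have -> : cyl n B =
    \bigcap_(j in [set j | (j < n)%N]) ((fun F : seqT S => F j) @^-1` B j) by [].
apply: bigcap_measurableType => j _.
by rewrite -[X in measurable X]setTI; exact: measurable_coord.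
Qed.

Lemma setI_closed_cyls : setI_closed cyls.
Proof.
move=> _ _ [n [B [mB ->]]] [m [C [mC ->]]].
exists (maxn n m), (fun j => (if (j < n)%N then B j else setT) `&`
                         (if (j < m)%N then C j else setT)); split.
  by move=> j; apply: measurableI; case: ifP.
apply/seteqP; split => [F [FB FC] j _|F FBC].
  by split; case: ifP => // jn; [exact: FB|exact: FC].
by split => j jn; have := FBC j; rewrite leq_max jn ?orbT => /(_ isT) [].
Qed.

Lemma seqT_cyls : @measurable _ (seqT S) = <<s cyls >>.
Proof.
apply/seteqP; split.
- apply: smallest_sub; first exact: smallest_sigma_algebra.
  move=> _ [k _ [B mB <-]]; apply: sub_sigma_algebra.
  exists k.+1, (fun j => if j == k then B else setT); split.
    by move=> j; case: ifP.
  rewrite setTI; apply/seteqP; split => F /=.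
    by move=> BF j _; case: eqP => // ->.
  by move=> /(_ k); rewrite ltnSn eqxx => /(_ isT).
- apply: smallest_sub; first exact: sigma_algebra_measurable.
  by move=> _ [n [B [mB ->]]]; exact: measurable_cyl.
Qed.

Lemma seqT_measure_unique (R : realType) (m1 m2 : {measure set (seqT S) -> \bar R}) :
  (m1 setT < +oo)%E ->
  (forall n B, (forall j, measurable (B j)) -> m1 (cyl n B) = m2 (cyl n B)) ->
  forall A, measurable A -> m1 A = m2 A.
Proof.
move=> m1oo m12 A mA.
have cT : cyls setT.
  exists 0%N, (fun=> setT); split => //.
  by apply/seteqP; split.
apply: (measure_unique cyls (fun=> setT)) => //.
- exact: seqT_cyls.
- exact: setI_closed_cyls.
- by apply/seteqP; split => // x _; exists 0%N.
- by move=> _ [n [B [mB ->]]]; exact: m12.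
Qed.

End sequences.

(** * Injective readings of an i.i.d. family *)

Section iid_law.
Context d (T : measurableType d) (R : realType) (P : probability T R)
  dS (S : measurableType dS) (I : eqType) (X : I -> T -> S).
Hypothesis iidX : iid P X.

(** [h] chooses the letters to be read, in order. The past at any time, the coupled past and a path
    holding both [eps_0] and [eps'_0] are all readings of the joint family. *)
Definition fam (h : nat -> I) (w : T) : seqT S := fun j => X (h j) w.

Lemma measurable_fam h : measurable_fun setT (fam h).
Proof. by apply: measurable_fun_seqT => k; exact: iidX.1.1. Qed.

Lemma fam_cyl i0 h n B : injective h -> (forall j, measurable (B j)) ->
  P (fam h @^-1` cyl n B) = (\prod_(j < n) P (X i0 @^-1` B j))%E.
Proof.
move=> injh mB.
(* Independence is stated with sets indexed by letters, so the constraint at position [j] is carried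
   to the letter [h j] through [index]; injectivity of [h] makes this consistent. *)
pose J := map h (iota 0 n); pose B' i := B (index i J).
have B'E j : (j < n)%N -> B' (h j) = B j.
  by move=> jn; rewrite /B' index_map// -{1}[j](nth_iota 0 0 jn) index_uniq ?size_iota// iota_uniq.
have := iidX.1.2 J B'.
rewrite map_inj_uniq// iota_uniq => /(_ isT (fun j => mB _)).
rewrite /J !big_map -{1}[n]subn0 -/(index_iota 0 n) big_mkord => PE.
transitivity (P (\big[setI/setT]_(i < n) (X (h i) @^-1` B' (h i)))).
  congr (P _); rewrite -(bigcap_mkord n (fun i => X (h i) @^-1` B' (h i))); apply/seteqP; split => w /= Fw j /= jn.
    by rewrite B'E//; exact: Fw.
  by have := Fw j jn; rewrite /= B'E.
rewrite PE -{1}[n]subn0 -/(index_iota 0 n) big_mkord.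
by apply: eq_bigr => i _; rewrite B'E// (iidX.2 (h i) i0).
Qed.

End iid_law.

Section canonical.
Context d (T : measurableType d) (R : realType) (P : probability T R)
  dS (S : measurableType dS) (I : eqType) (X : I -> T -> S).
Hypothesis iidX : iid P X.
Variable h0 : nat -> I.
Hypothesis injh0 : injective h0.

Let mX i : measurable_fun setT (X i) := iidX.1.1 i.

Definition seqlaw : {mfun T >-> seqT S} :=
  HB.pack (fam X h0) (isMeasurableFun.Build _ _ _ _ _ (measurable_fam iidX h0)).

Definition letterlaw : {mfun T >-> S} :=
  HB.pack (X (h0 0%N)) (isMeasurableFun.Build _ _ _ _ _ (mX (h0 0%N))).

Let mu := distribution P seqlaw.
Let nu := distribution P letterlaw.

Definition scons_mfun : {mfun (seqT S * S)%type >-> seqT S} :=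
  HB.pack (@sconsp _ S) (isMeasurableFun.Build _ _ _ _ _ (@measurable_sconsp _ S)).

Lemma mu_cyl n B : (forall j, measurable (B j)) ->
  mu (cyl n B) = (\prod_(j < n) nu (B j))%E.
Proof. by move=> mB; exact: (fam_cyl iidX (h0 0%N) n injh0 mB). Qed.

(** Stationarity and the exchange of [eps_0] for [eps'_0] are both instances: every injective
    reading has the same cylinder probabilities, and cylinders determine the law. *)
Lemma fam_law h A : injective h -> measurable A -> P (fam X h @^-1` A) = mu A.
Proof.
move=> injh mA.
pose mh : {mfun T >-> seqT S} :=
  HB.pack (fam X h) (isMeasurableFun.Build _ _ _ _ _ (measurable_fam iidX h)).
apply: (@seqT_measure_unique _ S R (distribution P mh) mu) => //.
  by rewrite [X in (X < _)%E]probability_setT ltry.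
move=> n B mB; transitivity (\prod_(j < n) nu (B j))%E.
  exact: (fam_cyl iidX (h0 0%N) n injh mB).
exact/esym/mu_cyl.
Qed.

(** Prepending a fresh independent letter preserves the law. This is the only link between [mu] and
    [nu] assumed for the transition operator, the zero-one law and the exponential martingales. *)
Lemma mu_scons A : measurable A ->
  mu A = (mu \x nu)%E (@sconsp _ S @^-1` A).
Proof.
move=> mA.
apply: (@seqT_measure_unique _ S R mu (pushforward (mu \x nu)%E scons_mfun)) => //.
  by rewrite [X in (X < _)%E]probability_setT ltry.
move=> n B mB; transitivity (\prod_(j < n) nu (B j))%E; first exact: mu_cyl.
rewrite /pushforward /=; case: n => [|n].
  rewrite big_ord0; transitivity ((mu \x nu)%E (setT `*` setT)).
    rewrite product_measure1E// -[LHS]mule1.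
    by congr (_ * _)%E; apply/esym; exact: probability_setT.
  by congr (_ _); rewrite setXTT; apply/seteqP; split.
transitivity ((mu \x nu)%E (cyl n (fun j => B j.+1) `*` B 0%N)).
  rewrite product_measure1E//; last exact: measurable_cyl.
  rewrite big_ord_recl muleC; congr (_ * _)%E.
  by apply/esym; exact: mu_cyl.
congr (_ _); apply/seteqP; split => [[F s] /= [FB Bs] [|j]//= jn|[F s] /= Fs].
  exact: FB.
split; last exact: (Fs 0%N).
by move=> j jn; exact: (Fs j.+1).
Qed.

End canonical.

(** * Square integrals *)

(** The squared L2 norm, extended-real valued so that comparisons need no prior finiteness. *)
Definition sqI d (T : measurableType d) (R : realType)
  (m : {measure set T -> \bar R}) (f : T -> R) : \bar R :=
  (\int[m]_x ((f x) ^+ 2)%:E)%E.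

Section square_integrals.
Context d (T : measurableType d) (R : realType) (m : probability T R).
Implicit Types (f g : T -> R).

Lemma measurable_sqE f : measurable_fun setT f ->
  measurable_fun setT (fun x => (f x ^+ 2)%:E).
Proof. by move=> mf; apply/measurable_EFinP; exact: measurable_funX. Qed.

Lemma sqI_ge0 f : (0 <= sqI m f)%E.
Proof. by apply: integral_ge0 => x _; rewrite lee_fin sqr_ge0. Qed.

Lemma le_sqI f g : measurable_fun setT f -> measurable_fun setT g ->
  (forall x, `|f x| <= `|g x|) -> (sqI m f <= sqI m g)%E.
Proof.
move=> mf mg fg; apply: ge0_le_integral => //.
- by move=> x _; rewrite lee_fin sqr_ge0.
- exact: measurable_sqE.
- exact: measurable_sqE.
- move=> x _; rewrite lee_fin -(real_normK (num_real (f x))).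
  rewrite -(real_normK (num_real (g x))).
  by rewrite ler_sqr ?nnegrE ?normr_ge0.
Qed.

Lemma sqIZ a f : measurable_fun setT f ->
  sqI m (fun x => a * f x) = ((a ^+ 2)%:E * sqI m f)%E.
Proof.
move=> mf; rewrite /sqI -ge0_integralZl//.
- by apply: eq_integral => x _; rewrite exprMn EFinM.
- exact: measurable_sqE.
- by move=> x _; rewrite lee_fin sqr_ge0.
- by rewrite lee_fin sqr_ge0.
Qed.

Lemma integral1 (c : R) : (\int[m]_x c%:E = c%:E)%E.
Proof.
rewrite (integral_cst m measurableT c%:E).
by rewrite [X in (_ * X)%E](_ : _ = 1%E) ?mule1//; exact: probability_setT.
Qed.

Lemma sqI_cst a : sqI m (cst a) = (a ^+ 2)%:E.
Proof. exact: (integral1 (a ^+ 2)). Qed.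

Lemma sqI_integrable f : measurable_fun setT f -> (sqI m f < +oo)%E ->
  m.-integrable setT (EFin \o f).
Proof.
move=> mf foo.
have sqi : m.-integrable setT (fun x => ((f x) ^+ 2)%:E : \bar R).
  apply/integrableP; split; first exact: measurable_sqE.
  by under eq_integral do rewrite gee0_abs ?lee_fin ?sqr_ge0//.
apply: (@le_integrable _ _ _ m setT measurableT _ (fun x => (1 + (f x) ^+ 2)%:E)).
- exact/measurable_EFinP.
- move=> x _; rewrite lee_fin (ger0_norm (addr_ge0 ler01 (sqr_ge0 _))).
  have := sqr_ge0 (`|f x| - 1); rewrite sqrrB1 real_normK ?num_real// => h.
  by have := normr_ge0 (f x); lra.
- rewrite (_ : (fun x => _) = EFin \o cst 1 \+ (fun x => ((f x) ^+ 2)%:E : \bar R))//.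
  apply: integrableD => //; exact: finite_measure_integrable_cst.
Qed.

(** The variance inequalities below ([sqI_center_add], [sqI_mean_best], [mean_sq_le],
    [mean_shift_sq_le]) are all read off this polynomial in [k] and [a]. *)
Lemma integral_affine_sq f (k a : R) : measurable_fun setT f ->
  (sqI m f < +oo)%E ->
  let c := fine (\int[m]_x (f x)%:E)%E in
  sqI m (fun x => k * f x + a) =
    (k ^+ 2 * fine (sqI m f) + 2 * k * a * c + a ^+ 2)%:E.
Proof.
move=> mf foo c.
have fi := sqI_integrable mf foo.
have ffin : sqI m f \is a fin_num by rewrite ge0_fin_numE ?sqI_ge0.
have sqi : m.-integrable setT (EFin \o (fun x => (f x) ^+ 2)).
  apply/integrableP; split; first exact: measurable_sqE.
  by under eq_integral do rewrite gee0_abs ?lee_fin ?sqr_ge0//.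
have ci : (\int[m]_x (f x)%:E = c%:E)%E.
  by rewrite /c fineK//; exact: integrable_fin_num fi.
have i1 : m.-integrable setT (EFin \o (fun x => k ^+ 2 * (f x) ^+ 2)).
  by have := integrableZl measurableT (k ^+ 2) sqi.
have i2 : m.-integrable setT (EFin \o (fun x => (2 * k * a) * f x)).
  by have := integrableZl measurableT (2 * k * a) fi.
have i3 : m.-integrable setT (EFin \o cst (a ^+ 2)).
  exact: finite_measure_integrable_cst.
have i23 : m.-integrable setT (EFin \o (fun x => (2 * k * a) * f x + a ^+ 2)).
  by have := integrableD measurableT i2 i3.
transitivity (\int[m]_x ((EFin \o (fun x => k ^+ 2 * (f x) ^+ 2)%R) \+
    (EFin \o (fun x => (2 * k * a) * f x + a ^+ 2)%R)) x)%E.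
  by apply: eq_integral => x _ /=; rewrite -EFinD; congr (_%:E); ring.
rewrite integralD_EFin//.
have -> : (\int[m]_x (EFin \o (fun x => (2 * k * a) * f x + a ^+ 2)%R) x =
    ((2 * k * a) * c + a ^+ 2)%:E)%E.
  rewrite EFinD EFinM -ci -(integralZl measurableT fi) -(integral1 (a ^+ 2)).
  by rewrite -integralD_EFin.
have -> : (\int[m]_x (EFin \o (fun x => k ^+ 2 * (f x) ^+ 2)%R) x =
    (k ^+ 2 * fine (sqI m f))%:E)%E.
  by rewrite EFinM fineK// /sqI -(integralZl measurableT sqi).
by rewrite -EFinD addrA.
Qed.

Lemma sqI_shift_lty f (a : R) : measurable_fun setT f ->
  (sqI m (fun x => f x - a)%R < +oo)%E -> (sqI m f < +oo)%E.
Proof.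
move=> mf foo.
have mfa : measurable_fun setT (fun x => f x - a) by exact: measurable_funB.
have -> : f = (fun x => 1 * (f x - a) + a).
  by apply/funext => x; rewrite mul1r subrK.
by rewrite integral_affine_sq// ltry.
Qed.

Let mean f := fine (\int[m]_x (f x)%:E)%E.

Lemma sqI_center_add f (k a : R) : measurable_fun setT f ->
  (sqI m (fun x => a + k * (f x - mean f))%R <=
   (a ^+ 2)%:E + (k ^+ 2)%:E * sqI m (fun x => f x - mean f)%R)%E.
Proof.
move=> mf.
have mfc : measurable_fun setT (fun x => f x - mean f) by exact: measurable_funB.
(* Separated because an infinite variance makes the right-hand side infinite only when [k != 0]. *)
have [->|k0] := eqVneq k 0.
  rewrite expr0n mul0e adde0.
  under [X in sqI m X]eq_fun do rewrite mul0r addr0.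
  by rewrite (sqI_cst a).
have [foo|] := ltP (sqI m (fun x => f x - mean f)) +oo%E; last first.
  rewrite leye_eq => /eqP ->.
  by rewrite gt0_muley ?lte_fin ?exprn_even_gt0// addey// leey.
have f2 := sqI_shift_lty mf foo.
have fi := sqI_integrable mf f2.
have c0 : fine (\int[m]_x (f x - mean f)%:E)%E = 0.
  under eq_integral do rewrite EFinB.
  rewrite integralB_EFin//; last exact: finite_measure_integrable_cst.
  by rewrite (integral1 (mean f)) /mean fineK ?integrable_fin_num// subee// integrable_fin_num.
have -> : (fun x => a + k * (f x - mean f)) = (fun x => k * (f x - mean f) + a).
  by apply/funext => x; rewrite addrC.
rewrite integral_affine_sq// c0 mulr0 addr0 -[in leRHS](@fineK _ (sqI m _)).
  by rewrite -EFinM -EFinD addrC.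
by rewrite ge0_fin_numE// sqI_ge0.
Qed.

Lemma sqI_mean_best f (a : R) : measurable_fun setT f ->
  (sqI m (fun x => f x - mean f)%R <= sqI m (fun x => f x - a)%R)%E.
Proof.
move=> mf.
have [foo|] := ltP (sqI m (fun x => f x - a)) +oo%E; last first.
  by rewrite leye_eq => /eqP ->; rewrite leey.
have f2 := sqI_shift_lty mf foo.
have E c : (fun x => f x - c) = (fun x => 1 * f x + - c).
  by apply/funext => x; rewrite mul1r.
rewrite !E !integral_affine_sq// lee_fin -/(mean f).
have := sqr_ge0 (mean f - a); rewrite expr1n !mul1r !sqrrN; nra.
Qed.

Lemma mean_sq_le f : measurable_fun setT f ->
  (((mean f) ^+ 2)%:E <= sqI m f)%E.
Proof.
move=> mf.
have [foo|] := ltP (sqI m f) +oo%E; last by rewrite leye_eq => /eqP ->; rewrite leey.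
have := sqI_ge0 (fun x => 1 * f x + - mean f).
rewrite integral_affine_sq// lee_fin -/(mean f) expr1n => h.
rewrite -(@fineK _ (sqI m f)) ?ge0_fin_numE ?sqI_ge0// lee_fin.
nra.
Qed.

Lemma mean_shift_sq_le f (a : R) : measurable_fun setT f ->
  (((mean f - a) ^+ 2)%:E <= sqI m (fun x => f x - a)%R)%E.
Proof.
move=> mf.
have [foo|] := ltP (sqI m (fun x => f x - a)) +oo%E; last first.
  by rewrite leye_eq => /eqP ->; rewrite leey.
have f2 := sqI_shift_lty mf foo.
have E c : (fun x => f x - c) = (fun x => 1 * f x + - c).
  by apply/funext => x; rewrite mul1r.
have := sqI_ge0 (fun x => f x - mean f).
rewrite !E !integral_affine_sq// !lee_fin -/(mean f).
rewrite expr1n !mul1r !sqrrN; nra.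
Qed.

Definition nrm f : \bar R := Lnorm m 2%:E (EFin \o f).

Lemma nrm_ge0 f : (0 <= nrm f)%E. Proof. exact: Lnorm_ge0. Qed.

Lemma nrmM f : (nrm f * nrm f = sqI m f)%E.
Proof.
have := @powR_Lnorm _ _ _ m (EFin \o f) 2; rewrite pnatr_eq0 => /(_ isT).
have -> : (\int[m]_x (`|(EFin \o f) x| `^ 2) = sqI m f)%E.
  apply: eq_integral => x _ /=; rewrite powR_mulrn ?normr_ge0//.
  by rewrite -normrX ger0_norm ?sqr_ge0.
move=> <-; rewrite -/(nrm f); case: (nrm f) (nrm_ge0 f) => [r r0| _|//].
  by rewrite poweR_EFin -EFinM powR_mulrn ?expr2// -lee_fin.
by rewrite poweRyr ?mulyy ?pnatr_eq0.
Qed.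

Lemma nrm_le f (r : R) : 0 <= r -> (nrm f <= r%:E)%E = (sqI m f <= (r ^+ 2)%:E)%E.
Proof.
move=> r0; rewrite -nrmM; case: (nrm f) (nrm_ge0 f) => [s s0| _|//].
  by rewrite -EFinM !lee_fin -expr2 ler_sqr ?nnegrE// -lee_fin.
by rewrite mulyy !leye_eq.
Qed.

Lemma nrmD f g : measurable_fun setT f -> measurable_fun setT g ->
  (nrm (fun x => f x + g x)%R <= nrm f + nrm g)%E.
Proof. by move=> mf mg; apply: minkowski_EFin => //; rewrite ler1n. Qed.

Lemma nrm_sum (I : Type) (s : seq I) (F : I -> T -> R) :
  (forall i, measurable_fun setT (F i)) ->
  (nrm (fun x => \sum_(i <- s) F i x)%R <= \sum_(i <- s) nrm (F i))%E.
Proof.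
move=> mF; elim: s => [|i s ih].
  under [X in nrm X]eq_fun do rewrite big_nil.
  by rewrite big_nil nrm_le// (sqI_cst 0).
under [X in nrm X]eq_fun do rewrite big_cons.
rewrite big_cons (le_trans (nrmD _ _))//.
  exact: measurable_sum.
by rewrite leeD2l.
Qed.

Lemma sqID f g : measurable_fun setT f -> measurable_fun setT g ->
  (sqI m (fun x => f x + g x)%R <= 2%:E * sqI m f + 2%:E * sqI m g)%E.
Proof.
move=> mf mg; rewrite -!ge0_integralZl ?lee_fin//; last 4 first.
- exact: measurable_sqE.
- by move=> x _; rewrite lee_fin sqr_ge0.
- exact: measurable_sqE.
- by move=> x _; rewrite lee_fin sqr_ge0.
rewrite -ge0_integralD//; last 4 first.
- by move=> x _; rewrite -EFinM lee_fin mulr_ge0// sqr_ge0.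
- by apply: measurable_funeM; exact: measurable_sqE.
- by move=> x _; rewrite -EFinM lee_fin mulr_ge0// sqr_ge0.
- by apply: measurable_funeM; exact: measurable_sqE.
apply: ge0_le_integral => //.
- by move=> x _; rewrite lee_fin sqr_ge0.
- by apply: measurable_sqE; exact: measurable_funD.
- by apply: emeasurable_funD; apply: measurable_funeM; exact: measurable_sqE.
- by move=> x _; rewrite -!EFinM -EFinD lee_fin; have := sqr_ge0 (f x - g x); nra.
Qed.

Lemma sqI_ae_eq f g : measurable_fun setT f -> measurable_fun setT g ->
  {ae m, forall x, f x = g x} -> sqI m f = sqI m g.
Proof.
move=> mf mg fg; apply: ge0_ae_eq_integral => //.
- exact: measurable_sqE.
- exact: measurable_sqE.
- by move=> x _; rewrite lee_fin sqr_ge0.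
- by move=> x _; rewrite lee_fin sqr_ge0.
- by apply: filterS fg => x /= -> _.
Qed.

End square_integrals.

(** * The transition operator *)

Section transition.
Context dS (S : measurableType dS) (R : realType)
  (mu : probability (seqT S) R) (nu : probability S R).
Hypothesis mu_scons : forall A, measurable A ->
  mu A = (mu \x nu)%E (@sconsp _ S @^-1` A).
Implicit Types (u v : seqT S -> R) (F : seqT S).

(* For F distributed as F_i, [trans u F] is E[u(F_{i+1}) | F_i] and [mdiff u F]
   is u(F_i) - E[u(F_i) | F_{i-1}]. *)
Definition trans u F : R := fine (\int[nu]_s (u (scons s F))%:E)%E.
Definition mdiff u F : R := u F - trans u (shift F).

Lemma measurable_slice d (U : measurableType d) (f : seqT S -> U) F :
  measurable_fun setT f -> measurable_fun setT (fun s => f (scons s F)).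
Proof.
move=> mf; apply: (measurableT_comp mf).
exact: measurableT_comp (@measurable_sconsp _ S) (pair1_measurable F).
Qed.

Lemma tonelli_scons (f : seqT S -> \bar R) : measurable_fun setT f ->
  (forall F, (0 <= f F)%E) ->
  (\int[mu]_F f F = \int[mu]_F \int[nu]_s f (scons s F))%E.
Proof.
move=> mf f0.
transitivity (\int[pushforward (mu \x nu)%E (scons_mfun S)]_F f F)%E.
  by apply: eq_measure_integral => A mA _; exact: mu_scons.
rewrite ge0_integral_pushforward//.
rewrite (@fubini_tonelli1 _ _ _ _ _ mu nu (f \o @sconsp _ S))//.
  exact: measurableT_comp mf (@measurable_sconsp _ S).
by move=> z; exact: f0.
Qed.

Lemma measurable_tonelli_scons (f : seqT S -> \bar R) : measurable_fun setT f ->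
  (forall F, (0 <= f F)%E) ->
  measurable_fun setT (fun F => \int[nu]_s f (scons s F))%E.
Proof.
move=> mf f0.
apply: (@measurable_fun_fubini_tonelli_F _ _ _ _ _ nu (f \o @sconsp _ S)).
  exact: measurableT_comp mf (@measurable_sconsp _ S).
by move=> z; exact: f0.
Qed.

Lemma integral_shift (f : seqT S -> \bar R) : measurable_fun setT f ->
  (forall F, (0 <= f F)%E) ->
  (\int[mu]_F f (shift F) = \int[mu]_F f F)%E.
Proof.
move=> mf f0; rewrite tonelli_scons//; last first.
  exact: measurableT_comp mf (@measurable_shift _ S).
apply: eq_integral => F _.
rewrite (integral_cst nu measurableT (f F)).
by rewrite [X in (_ * X)%E](_ : _ = 1%E) ?mule1//; exact: probability_setT.
Qed.

Lemma measurable_trans u : measurable_fun setT u -> measurable_fun setT (trans u).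
Proof.
move=> mu'.
have mE : measurable_fun setT (EFin \o u) by exact/measurable_EFinP.
have -> : trans u = fine \o (fun F =>
    (\int[nu]_s (EFin \o u)^\+ (scons s F) -
     \int[nu]_s (EFin \o u)^\- (scons s F))%E).
  apply/funext => F; rewrite /trans integralE /=; congr (fine (_ - _)%E);
    by apply: eq_integral => s _; rewrite ?funeposE ?funenegE.
apply: measurableT_comp; first exact: fine_measurable.
apply: emeasurable_funB; apply: measurable_tonelli_scons => //.
  exact: measurable_funepos.
exact: measurable_funeneg.
Qed.

Lemma measurable_mdiff u : measurable_fun setT u -> measurable_fun setT (mdiff u).
Proof.
move=> mf; apply: measurable_funB => //.
exact: measurableT_comp (measurable_trans mf) (@measurable_shift _ S).
Qed.

Lemma sqI_scons u : measurable_fun setT u ->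
  sqI mu u = (\int[mu]_F sqI nu (fun s => u (scons s F)))%E.
Proof.
move=> mf; apply: (tonelli_scons (f := fun F => (u F ^+ 2)%:E)).
  exact: measurable_sqE.
by move=> F; rewrite lee_fin sqr_ge0.
Qed.

Lemma measurable_sqI_scons u : measurable_fun setT u ->
  measurable_fun setT (fun F => sqI nu (fun s => u (scons s F))).
Proof.
move=> mf; apply: (measurable_tonelli_scons (f := fun F => (u F ^+ 2)%:E)).
  exact: measurable_sqE.
by move=> F; rewrite lee_fin sqr_ge0.
Qed.

Lemma sqI_shift u : measurable_fun setT u -> sqI mu (u \o @shift _ S) = sqI mu u.
Proof.
move=> mf; apply: (integral_shift (f := fun F => (u F ^+ 2)%:E)).
  exact: measurable_sqE.
by move=> F; rewrite lee_fin sqr_ge0.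
Qed.

Lemma measurable_iter_shift k : measurable_fun setT (iter k (@shift _ S) : seqT S -> seqT S).
Proof.
elim: k => [|k ih]; first exact: measurable_id.
exact: measurableT_comp (@measurable_shift _ S) ih.
Qed.

Lemma sqI_iter_shift u k : measurable_fun setT u ->
  sqI mu (u \o iter k (@shift _ S)) = sqI mu u.
Proof.
move=> mf; elim: k => [//|k <-].
rewrite -[RHS]sqI_shift; last exact: measurableT_comp mf (measurable_iter_shift k).
by congr (sqI _ _); apply/funext => F /=; rewrite -iterS iterSr.
Qed.

Lemma sqI_trans_le u : measurable_fun setT u -> (sqI mu (trans u) <= sqI mu u)%E.
Proof.
move=> mf; rewrite [leRHS]sqI_scons//; apply: ge0_le_integral => //.
- by move=> F _; rewrite lee_fin sqr_ge0.
- by apply: measurable_sqE; exact: measurable_trans.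
- exact: measurable_sqI_scons.
- by move=> F _; apply: mean_sq_le; exact: measurable_slice.
Qed.

(** Orthogonality of a martingale increment to the past, fibre by fibre: over a fixed past, [A] is
    constant in the newest letter and [mdiff u] is centred. As an inequality it also covers fibres
    of infinite variance. *)
Lemma sqI_mdiff_step (A : seqT S -> R) u (k : R) :
  measurable_fun setT A -> measurable_fun setT u ->
  (sqI mu (fun F => A (shift F) + k * mdiff u F)%R <=
   sqI mu A + (k ^+ 2)%:E * sqI mu (mdiff u))%E.
Proof.
move=> mA mf.
have md := measurable_mdiff mf.
have md2 := measurable_sqI_scons md.
rewrite sqI_scons; last first.
  apply: measurable_funD; first exact: measurableT_comp mA (@measurable_shift _ S).
  exact: measurable_funM.
rewrite [X in (_ <= _ + _ * X)%E]sqI_scons//.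
rewrite -ge0_integralZl//; last 2 first.
- by move=> F _; exact: sqI_ge0.
- by rewrite lee_fin sqr_ge0.
rewrite [X in (_ <= X + _)%E]/sqI -ge0_integralD//; last 4 first.
- by move=> F _; rewrite lee_fin sqr_ge0.
- exact: measurable_sqE.
- by move=> F _; apply: mule_ge0; [rewrite lee_fin sqr_ge0|exact: sqI_ge0].
- exact: measurable_funeM.
apply: ge0_le_integral => //.
- by move=> F _; exact: sqI_ge0.
- apply: (measurable_sqI_scons (u := fun F => A (shift F) + k * mdiff u F)).
  apply: measurable_funD; first exact: measurableT_comp mA (@measurable_shift _ S).
  exact: measurable_funM.
- by apply: emeasurable_funD; [exact: measurable_sqE|exact: measurable_funeM].
- by move=> F _; exact: (sqI_center_add nu k (A F) (measurable_slice F mf)).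
Qed.

(** Over each [shift F] the conditional mean is the best constant in the newest letter. The
    competitor [c F] may look at all of [F], including the letter that [s] replaces; in
    [coupling_bound] that letter plays [eps'_0]. *)
Lemma sqI_mdiff_best u (c : seqT S -> R) :
  measurable_fun setT u -> measurable_fun setT c ->
  (sqI mu (mdiff u) <=
   \int[mu]_F \int[nu]_s ((u (scons s (shift F)) - c F) ^+ 2)%:E)%E.
Proof.
move=> mf mc.
have md := measurable_mdiff mf.
have md2 := measurable_sqI_scons md.
rewrite (sqI_scons md) -(integral_shift md2); last by move=> F; exact: sqI_ge0.
apply: ge0_le_integral; first exact: measurableT.
- by move=> F _; exact: sqI_ge0.
- exact: measurableT_comp md2 (@measurable_shift _ S).
- apply: (@measurable_fun_fubini_tonelli_F _ _ _ _ _ nu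
    (fun z : seqT S * S => ((u (scons z.2 (shift z.1)) - c z.1) ^+ 2)%:E)) => //.
    apply: measurable_sqE; apply: measurable_funB.
      apply: (measurableT_comp mf); apply: measurable_fun_seqT => -[|k] /=.
        exact: measurable_snd.
      exact: measurableT_comp (measurable_coord k.+1) measurable_fst.
    exact: measurableT_comp mc measurable_fst.
  by move=> z; rewrite lee_fin sqr_ge0.
- move=> F _; apply: (sqI_mean_best nu (c F)).
  exact: measurable_slice.
Qed.

Lemma measurable_iter_trans k u : measurable_fun setT u ->
  measurable_fun setT (iter k trans u).
Proof. by move=> mf; elim: k => // k ih; exact: measurable_trans. Qed.

Lemma sqI_iter_trans_le j k u : (j <= k)%N -> measurable_fun setT u ->
  (sqI mu (iter k trans u) <= sqI mu (iter j trans u))%E.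
Proof.
move=> jk mf; rewrite -(subnK jk) iterD; elim: (k - j)%N => //= i; apply: le_trans.
by apply: sqI_trans_le; do 2 apply: measurable_iter_trans.
Qed.

Lemma trans_telescope K u F :
  u F = \sum_(k < K) mdiff (iter k trans u) (iter k (@shift _ S) F)
      + iter K trans u (iter K (@shift _ S) F).
Proof.
elim: K => [|K ih]; first by rewrite big_ord0 add0r.
by rewrite ih big_ord_recr /= -addrA; congr (_ + _); rewrite /mdiff subrK.
Qed.

(** With [F] as the path at time [n], [iter (n - i) shift F] is the path at time [i]: this is the
    sum of [a_i D_i(F_i)] seen from its last time. *)
Definition lag_sum (a : nat -> R) (D : nat -> seqT S -> R) (n : nat) F : R :=
  \sum_(1 <= i < n.+1) a i * D i (iter (n - i) (@shift _ S) F).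

Lemma lag_sum0 a D F : lag_sum a D 0 F = 0.
Proof. by rewrite /lag_sum big_geq. Qed.

Lemma lag_sumS a D n F :
  lag_sum a D n.+1 F = lag_sum a D n (shift F) + a n.+1 * D n.+1 F.
Proof.
rewrite /lag_sum big_nat_recr//= subnn; congr (_ + _).
apply: eq_big_nat => i /andP[_]; rewrite ltnS => i_n.
by rewrite subSn// iterSr.
Qed.

Lemma measurable_lag_sum a D n : (forall i, measurable_fun setT (D i)) ->
  measurable_fun setT (lag_sum a D n).
Proof.
move=> mD; apply: measurable_sum => i; apply: measurable_funM => //.
exact: measurableT_comp (mD i) (measurable_iter_shift _).
Qed.

Lemma sqI_lag_sum_mdiff a (D : nat -> seqT S -> R) n :
  (forall i, measurable_fun setT (D i)) ->
  (sqI mu (lag_sum a (fun i => mdiff (D i)) n) <=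
   \sum_(1 <= i < n.+1) ((a i) ^+ 2)%:E * sqI mu (mdiff (D i)))%E.
Proof.
move=> mD; elim: n => [|n ih].
  rewrite (_ : lag_sum _ _ _ = cst 0); last by apply/funext => F; rewrite lag_sum0.
  by rewrite (sqI_cst mu 0) expr0n big_geq.
rewrite big_nat_recr//= (_ : lag_sum _ _ _ = fun F =>
    lag_sum a (fun i => mdiff (D i)) n (shift F) + a n.+1 * mdiff (D n.+1) F).
  apply: le_trans (sqI_mdiff_step _ _ (mD _)) _; last by rewrite leeD2r.
  by apply: measurable_lag_sum => i; exact: measurable_mdiff.
by apply/funext => F; rewrite lag_sumS.
Qed.

(* [trans_telescope] splits D_i into projections; those of a fixed lag k are
   orthogonal in i, hence a triangle inequality over k. The last hypothesis
   removes the remainder. *)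
Lemma sqI_lag_sum_le a (D : nat -> seqT S -> R) (delta : nat -> R) (Delta : R) n :
  (forall i, measurable_fun setT (D i)) ->
  (forall k, 0 <= delta k) ->
  (forall K, \sum_(k < K) delta k <= Delta) ->
  (forall i k, (1 <= i <= n)%N -> a i != 0 ->
     (sqI mu (mdiff (iter k trans (D i))) <= ((delta k) ^+ 2)%:E)%E) ->
  (forall i (e : R), (1 <= i <= n)%N -> a i != 0 -> 0 < e ->
     exists K, (sqI mu (iter K trans (D i)) <= e%:E)%E) ->
  (sqI mu (lag_sum a D n) <= (Delta ^+ 2 * \sum_(1 <= i < n.+1) (a i) ^+ 2)%:E)%E.
Proof.
move=> mD delta0 sdelta Ddelta Dtail.
set A2 := \sum_(1 <= i < n.+1) (a i) ^+ 2.
have A20 : 0 <= A2 by apply: sumr_ge0 => i _; exact: sqr_ge0.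
have Delta0 : 0 <= Delta by have := sdelta 0%N; rewrite big_ord0.
set A := Num.sqrt A2.
have -> : Delta ^+ 2 * A2 = (Delta * A) ^+ 2 by rewrite exprMn sqr_sqrtr.
have DA0 : 0 <= Delta * A by rewrite mulr_ge0 ?sqrtr_ge0.
rewrite -nrm_le//.
set B := \sum_(1 <= i < n.+1) `|a i|.
have B0 : 0 <= B by apply: sumr_ge0 => i _; exact: normr_ge0.
apply/lee_addgt0Pr => e e0.
(* The remainder after [K] lags then has norm at most [B * (e / (B + 1)) <= e]; the [+ 1] covers
   [B = 0]. *)
pose e' := (e / (B + 1)) ^+ 2.
have Bp : 0 < B + 1 by rewrite ltr_wpDl.
have e'0 : 0 < e' by rewrite exprn_gt0// divr_gt0.
have [K HK] : exists K, forall i, (1 <= i <= n)%N -> a i != 0 ->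
    (sqI mu (iter K trans (D i)) <= e'%:E)%E.
  (* One [K] serves all [i <= n]: the norm of [iter K trans (D i)] does not increase with [K], so a
     maximum of finitely many will do. *)
  have : forall N, exists K, forall i, (1 <= i <= n)%N -> (i < N)%N -> a i != 0 ->
    (sqI mu (iter K trans (D i)) <= e'%:E)%E.
    elim=> [|N [K1 HK1]]; first by exists 0%N => i _; rewrite ltn0.
    have [[nN aN]|H] := pselect ((1 <= N <= n)%N /\ a N != 0).
      have [K2 HK2] := Dtail _ _ nN aN e'0.
      exists (maxn K1 K2) => i i1n; rewrite ltnS leq_eqVlt => /predU1P[->|iN] ai.
        exact: le_trans (sqI_iter_trans_le (leq_maxr _ _) (mD _)) HK2.
      exact: le_trans (sqI_iter_trans_le (leq_maxl _ _) (mD _)) (HK1 _ i1n iN ai).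
    exists K1 => i i1n; rewrite ltnS leq_eqVlt => /predU1P[E|iN] ai.
      by exfalso; apply: H; rewrite -E.
    exact: HK1.
  move=> /(_ n.+1) [K HK]; exists K => i i1n; apply: HK => //.
  by case/andP: i1n.
have mT k i : measurable_fun setT (iter k trans (D i)) by exact: measurable_iter_trans.
have mM k i : measurable_fun setT (mdiff (iter k trans (D i))).
  by apply: measurable_mdiff.
pose G k F := lag_sum a (fun i => mdiff (iter k trans (D i))) n (iter k (@shift _ S) F).
pose H F := lag_sum a (fun i => iter K trans (D i)) n (iter K (@shift _ S) F).
have mG k : measurable_fun setT (G k).
  exact: measurableT_comp (measurable_lag_sum _ _ (mM k)) (measurable_iter_shift _).
have mH : measurable_fun setT H.
  exact: measurableT_comp (measurable_lag_sum _ _ (mT K)) (measurable_iter_shift _).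
have -> : lag_sum a D n = fun F => (\sum_(k <- index_enum 'I_K) G k F) + H F.
  apply/funext => F; rewrite /G /H /lag_sum exchange_big -big_split/=.
  apply: eq_bigr => i _; rewrite {1}(trans_telescope K) mulrDr mulr_sumr.
  by congr (_ + _); [apply: eq_bigr => k _|]; rewrite -!iterD addnC.
apply: le_trans (nrmD _ _ _) _ => //; first exact: measurable_sum.
rewrite EFinM; apply: leeD.
  apply: le_trans (nrm_sum _ _ _) _ => //.
  apply: (@le_trans _ _ (\sum_(k < K) (delta k * A)%:E)%E).
    apply: lee_sum => k _; rewrite nrm_le; last by rewrite mulr_ge0 ?sqrtr_ge0.
    rewrite /G (sqI_iter_shift (u := lag_sum _ _ _)); last exact: measurable_lag_sum.
    apply: le_trans (sqI_lag_sum_mdiff _ _ (mT k)) _.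
    rewrite exprMn sqr_sqrtr// mulr_sumr -sumEFin.
    rewrite [leLHS]big_nat_cond [leRHS]big_nat_cond.
    apply: lee_sum => i /andP[i1n _]; have [->|ai] := eqVneq (a i) 0.
      by rewrite expr0n mul0e mulr0.
    rewrite (mulrC (delta k ^+ 2)) [X in (_ <= X)%E]EFinM.
    by apply: lee_wpmul2l; [rewrite lee_fin sqr_ge0|exact: Ddelta].
  by rewrite sumEFin -mulr_suml -EFinM lee_fin ler_wpM2r ?sqrtr_ge0.
have -> : H = fun F => \sum_(i <- index_iota 1 n.+1) (fun i F => a i *
   iter K trans (D i) (iter (n - i) (@shift _ S) (iter K (@shift _ S) F))) i F by [].
have mterm i : measurable_fun setT (fun F => a i *
   iter K trans (D i) (iter (n - i) (@shift _ S) (iter K (@shift _ S) F))).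
  apply: measurable_funM => //.
  apply: (measurableT_comp (mT K i)).
  exact: measurableT_comp (measurable_iter_shift _) (measurable_iter_shift _).
apply: le_trans (nrm_sum _ _ mterm) _.
apply: (@le_trans _ _ (\sum_(1 <= i < n.+1) (`|a i| * (e / (B + 1)))%:E)%E).
  rewrite [leLHS]big_nat_cond [leRHS]big_nat_cond.
  apply: lee_sum => i /andP[i1n _]; rewrite nrm_le; last first.
    by rewrite mulr_ge0// divr_ge0// ltW.
  rewrite (_ : (fun F => _) = fun F => a i * ((iter K trans (D i)) \o
     iter ((n - i) + K) (@shift _ S)) F); last first.
    by apply/funext => F /=; rewrite iterD.
  rewrite sqIZ; last exact: measurableT_comp (mT K i) (measurable_iter_shift _).
  rewrite sqI_iter_shift// exprMn real_normK ?num_real//.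
  have [->|ai] := eqVneq (a i) 0; first by rewrite expr0n mul0e mul0r.
  rewrite [X in (_ <= X)%E]EFinM.
  by apply: lee_wpmul2l; [rewrite lee_fin sqr_ge0|exact: HK].
rewrite sumEFin -mulr_suml lee_fin -/B mulrCA -[leRHS]mulr1.
apply: ler_wpM2l; first exact: ltW.
by rewrite ler_pdivrMr// mul1r lerDl.
Qed.

End transition.

(** * A zero-one law in L2 *)

Import HBNNSimple.

Section zero_one.
Context dS (S : measurableType dS) (R : realType)
  (mu : probability (seqT S) R) (nu : probability S R).
Hypothesis mu_scons : forall A, measurable A ->
  mu A = (mu \x nu)%E (@sconsp _ S @^-1` A).
Implicit Types (u v : seqT S -> R) (F : seqT S).
Local Notation Q := (trans nu).

Lemma integrable_sconsp u : mu.-integrable setT (EFin \o u) ->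
  (mu \x nu)%E.-integrable setT ((EFin \o u) \o @sconsp _ S).
Proof.
move=> /[dup] iu /integrableP [mE uoo].
apply/integrable12ltyP; first exact: measurableT_comp mE (@measurable_sconsp _ S).
apply: le_lt_trans uoo.
rewrite [leRHS](tonelli_scons mu_scons)//.
exact: measurableT_comp.
Qed.

Lemma ae_integrable_slice u : mu.-integrable setT (EFin \o u) ->
  {ae mu, forall F, nu.-integrable setT (EFin \o (fun s => u (scons s F)))}.
Proof. by move=> /integrable_sconsp /ae_integrable1. Qed.

Lemma integral_trans u : mu.-integrable setT (EFin \o u) ->
  mu.-integrable setT (EFin \o Q u) /\
  (\int[mu]_F (Q u F)%:E = \int[mu]_F (u F)%:E)%E.
Proof.
move=> iu.
have mE : measurable_fun setT (EFin \o u) by exact: measurable_int iu.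
have mf : measurable_fun setT u by exact/measurable_EFinP.
have mQ : measurable_fun setT (EFin \o Q u).
  by apply/measurable_EFinP; exact: measurable_trans.
have ip := integrable_sconsp iu.
pose I F := (\int[nu]_s (u (scons s F))%:E)%E.
have iI : mu.-integrable setT I by exact: (integrable_fubini_F ip).
have IQ : {ae mu, forall F, setT F -> I F = (EFin \o Q u) F}.
  have := integrable_ae measurableT iI.
  by apply: filterS => F /= /(_ Logic.I) h _; rewrite /Q fineK.
have mI := measurable_int _ iI.
split.
  apply/integrableP; split => //.
  rewrite -(ge0_ae_eq_integral (f := abse \o I))//.
  - by case/integrableP: iI.
  - exact: measurableT_comp.
  - exact: measurableT_comp.
  - by move=> F _; exact: abse_ge0.
  - by apply: filterS IQ => F + _ => /= ->.
rewrite -(@ae_eq_integral _ _ _ mu setT _ I _ mI mQ)//.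
rewrite [LHS](_ : _ = \int[mu]_F fubini_F nu ((EFin \o u) \o @sconsp _ S) F)%E//.
rewrite fubini1//.
transitivity (\int[pushforward (mu \x nu)%E (scons_mfun S)]_F (u F)%:E)%E.
  by apply/esym; apply: integral_pushforward.
by apply: eq_measure_integral => A mA _; apply/esym; exact: mu_scons.
Qed.

Lemma ae_scons (p : seqT S -> Prop) : {ae mu, forall F, p F} ->
  {ae mu, forall F, {ae nu, forall s, p (scons s F)}}.
Proof.
move=> [N [mN N0 subN]].
have mI : measurable_fun setT (fun F => (\1_N F : R)%:E).
  by apply/measurable_EFinP; exact: measurable_indic.
have I0 F : (0 <= (\1_N F : R)%:E)%E by rewrite lee_fin.
have mJ := measurable_tonelli_scons nu mI I0.
have J0 : (\int[mu]_F `| \int[nu]_s (\1_N (scons s F) : R)%:E | = 0)%E.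
  under eq_integral do rewrite gee0_abs ?integral_ge0//.
  by rewrite -(tonelli_scons mu_scons mI)// integral_indic// setIT.
have := (ae_eq_integral_abs _ measurableT mJ).1 J0.
apply: filterS => F /= /(_ Logic.I) JF.
have mIF := measurable_slice F mI.
have : (\int[nu]_s `| (\1_N (scons s F) : R)%:E | = 0)%E.
  by rewrite -[RHS]JF; apply: eq_integral => s _; rewrite gee0_abs.
move=> /(ae_eq_integral_abs _ measurableT mIF).1.
apply: filterS => s /= /(_ Logic.I) Is; apply: contrapT => np.
have : N (scons s F) by apply: subN.
by move=> Ns; move: Is; rewrite indicE mem_set// => -[] /eqP; rewrite oner_eq0.
Qed.

Lemma trans_ae_eq u v : measurable_fun setT u -> measurable_fun setT v ->
  {ae mu, forall F, u F = v F} -> {ae mu, forall F, Q u F = Q v F}.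
Proof.
move=> mf mg /ae_scons; apply: filterS => F uv; rewrite /trans; congr fine.
apply: ae_eq_integral => //.
- by apply/measurable_EFinP; exact: measurable_slice.
- by apply/measurable_EFinP; exact: measurable_slice.
- by apply: filterS uv => s /= -> _.
Qed.

(** Linearity holds only almost everywhere: on fibres where [u] or [v] is not integrable, [fine]
    destroys it. Hence identities between iterates of [Q] are [ae] statements from here on. *)
Lemma trans_lin_ae (a : R) u v : mu.-integrable setT (EFin \o u) ->
  mu.-integrable setT (EFin \o v) ->
  {ae mu, forall F, Q (fun F => a * u F + v F) F = a * Q u F + Q v F}.
Proof.
move=> /ae_integrable_slice iu /ae_integrable_slice iv.
apply: filterS2 iu iv => F iu iv; rewrite /trans.
have iau := integrableZl measurableT a iu.
under eq_integral do rewrite EFinD.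
rewrite integralD_EFin// fineD.
- congr (_ + _); under eq_integral do rewrite /= EFinM.
  by rewrite (integralZl measurableT iu) fineM// integrable_fin_num.
- exact: integrable_fin_num iau.
- exact: integrable_fin_num.
Qed.

Definition L2 u := measurable_fun setT u /\ (sqI mu u < +oo)%E.

Lemma L2_lin a u v : L2 u -> L2 v -> L2 (fun F => a * u F + v F).
Proof.
move=> [mf fo] [mg go].
have maf : measurable_fun setT (fun F => a * u F) by exact: measurable_funM.
split; first exact: measurable_funD.
apply: le_lt_trans (sqID mu maf mg) _; rewrite sqIZ//.
by rewrite lte_add_pinfty// !lte_mul_pinfty// lee_fin ?sqr_ge0.
Qed.

Lemma L2_cst c : L2 (cst c).
Proof. by split => //; rewrite sqI_cst ltry. Qed.

Lemma L2_iter_trans k u : L2 u -> L2 (iter k Q u).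
Proof.
move=> [mf fo]; split; first exact: measurable_iter_trans.
apply: le_lt_trans fo; exact: (sqI_iter_trans_le mu_scons (leq0n k)).
Qed.

Lemma L2_integrable u : L2 u -> mu.-integrable setT (EFin \o u).
Proof. by case=> mf fo; exact: sqI_integrable. Qed.

Lemma iter_trans_lin_ae k a u v : L2 u -> L2 v ->
  {ae mu, forall F, iter k Q (fun F => a * u F + v F) F =
                    a * iter k Q u F + iter k Q v F}.
Proof.
move=> Lu Lv; elim: k => [|k ih] /=; first exact: aeW.
have Lk := L2_iter_trans k Lu; have Lk' := L2_iter_trans k Lv.
have := trans_lin_ae a (L2_integrable Lk) (L2_integrable Lk').
have mf : measurable_fun setT (iter k Q (fun F => a * u F + v F)).
  by have [] := L2_iter_trans k (L2_lin a Lu Lv).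
have := trans_ae_eq mf (L2_lin a Lk Lk').1 ih.
by apply: filterS2 => F -> ->.
Qed.

(* Kolmogorov's law in L2: indicators of cylinders satisfy [tail_cst] after finitely
   many steps, and the property survives linear combinations and L2 limits. *)
Definition tail_cst u := L2 u /\ forall e : R, 0 < e ->
  exists K c, (sqI mu (fun F => iter K Q u F - c)%R <= e%:E)%E.

(** By Jensen the distance to a constant does not increase along the iterates, which lets two
    functions with different [K] be compared at the larger one. *)
Lemma sqI_iter_trans_shift_le j k u (c : R) : (j <= k)%N -> measurable_fun setT u ->
  (sqI mu (fun F => iter k Q u F - c)%R <=
   sqI mu (fun F => iter j Q u F - c)%R)%E.
Proof.
move=> jk mf; rewrite -(subnK jk); elim: (k - j)%N => [|i ih]; first by rewrite add0n.
apply: le_trans ih; rewrite addSn iterS; set w := iter _ Q u.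
have mw : measurable_fun setT w by exact: measurable_iter_trans.
have mwc : measurable_fun setT (fun F => w F - c) by exact: measurable_funB.
rewrite [leRHS](sqI_scons mu_scons)//.
apply: ge0_le_integral => //.
- by move=> F _; rewrite lee_fin sqr_ge0.
- by apply: measurable_sqE; apply: measurable_funB => //; exact: measurable_trans.
- exact: (measurable_sqI_scons _ mwc).
- by move=> F _; exact: (mean_shift_sq_le nu c (measurable_slice F mw)).
Qed.

Lemma tail_cst_lin a u v : tail_cst u -> tail_cst v ->
  tail_cst (fun F => a * u F + v F).
Proof.
move=> [Lu tu] [Lv tv]; split; first exact: L2_lin.
(* Chosen so that [2 * a ^+ 2 * d + 2 * d = e], the loss in [sqID]. *)
move=> e e0; pose d := e / (2 * (a ^+ 2 + 1)).
have a0 : 0 < a ^+ 2 + 1 by rewrite ltr_wpDl// sqr_ge0.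
have d0 : 0 < d by rewrite divr_gt0// mulr_gt0.
have [K1 [c1 H1]] := tu _ d0; have [K2 [c2 H2]] := tv _ d0.
pose K := maxn K1 K2; exists K, (a * c1 + c2).
have LK1 := L2_iter_trans K Lu; have LK2 := L2_iter_trans K Lv.
have LK := L2_iter_trans K (L2_lin a Lu Lv).
have m1 : measurable_fun setT (fun F => iter K Q u F - c1).
  by apply: measurable_funB => //; case: LK1.
have m2 : measurable_fun setT (fun F => iter K Q v F - c2).
  by apply: measurable_funB => //; case: LK2.
have m1a : measurable_fun setT (fun F => a * (iter K Q u F - c1)).
  exact: measurable_funM.
rewrite (sqI_ae_eq (g := fun F => a * (iter K Q u F - c1) + (iter K Q v F - c2))).
- apply: le_trans (sqID mu m1a m2) _; rewrite sqIZ//.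
  have {}H1 := le_trans (sqI_iter_trans_shift_le c1 (leq_maxl K1 K2) Lu.1) H1.
  have {}H2 := le_trans (sqI_iter_trans_shift_le c2 (leq_maxr K1 K2) Lv.1) H2.
  apply: (@le_trans _ _ (2%:E * ((a ^+ 2)%:E * d%:E) + 2%:E * d%:E)%E).
    by apply: leeD; apply: lee_wpmul2l => //; apply: lee_wpmul2l; rewrite ?lee_fin ?sqr_ge0.
  rewrite -!EFinM -EFinD lee_fin /d.
  by rewrite le_eqVlt; apply/orP; left; apply/eqP; field; rewrite gt_eqF.
- by apply: measurable_funB => //; case: LK.
- exact: measurable_funD.
- have := iter_trans_lin_ae K a Lu Lv; apply: filterS => F ->; ring.
Qed.

Lemma tail_cst_cst c : tail_cst (cst c).
Proof.
split; first exact: L2_cst.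
move=> e e0; exists 0%N, c; rewrite (_ : (fun _ => _) = cst 0).
  by rewrite (sqI_cst mu 0) expr0n lee_fin ltW.
by apply/funext => F /=; rewrite subrr.
Qed.

Lemma tail_cst_approx u : L2 u ->
  (forall e : R, 0 < e -> exists2 v, tail_cst v &
     (sqI mu (fun F => u F - v F)%R <= e%:E)%E) -> tail_cst u.
Proof.
move=> Lu H; split=> // e e0.
(* [sqID] doubles both errors: the approximation of [u] by [v], which [Q] contracts, and the
   distance of the iterates of [v] to a constant. *)
have e4 : 0 < e / 4 by rewrite divr_gt0.
have [v [Lv tv] uv] := H _ e4; have [K [c Hc]] := tv _ e4.
exists K, c.
have Luv : L2 (fun F => (-1) * v F + u F) by exact: L2_lin.
have LK1 := L2_iter_trans K Luv; have LK2 := L2_iter_trans K Lv.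
have LK := L2_iter_trans K Lu.
have m2 : measurable_fun setT (fun F => iter K Q v F - c).
  by apply: measurable_funB => //; case: LK2.
rewrite (sqI_ae_eq (g := fun F =>
    iter K Q (fun F => (-1) * v F + u F) F + (iter K Q v F - c))).
- apply: le_trans (sqID mu LK1.1 m2) _.
  have h : (sqI mu (iter K Q (fun F => (-1) * v F + u F)%R) <= (e / 4)%:E)%E.
    apply: le_trans (sqI_iter_trans_le mu_scons (leq0n K) Luv.1) _.
    by rewrite /= (_ : (fun F => _) = (fun F => u F - v F))//; apply/funext => F; ring.
  apply: (@le_trans _ _ (2%:E * (e / 4)%:E + 2%:E * (e / 4)%:E)%E).
    by apply: leeD; apply: lee_wpmul2l.
  by rewrite -!EFinM -EFinD lee_fin; lra.
- by apply: measurable_funB => //; case: LK.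
- by apply: measurable_funD => //; case: LK1.
- by have := iter_trans_lin_ae K (-1) Lv Lu; apply: filterS => F ->; ring.
Qed.

(** Each application of [Q] integrates out one of the [n] letters on which [u] depends; after [n] of
    them nothing is left. *)
Lemma iter_trans_finite_dim n u :
  (forall F F' : seqT S, (forall j, (j < n)%N -> F j = F' j) -> u F = u F') ->
  forall F F', iter n Q u F = iter n Q u F'.
Proof.
elim: n u => [u H F F'|n ih u H F F']; first exact: H.
rewrite iterSr; apply: ih => {}F {}F' FF'; rewrite /trans; congr fine.
by apply: eq_integral => s _; congr (_%:E); apply: H => -[//|j] /=; exact: FF'.
Qed.

Lemma sqI_indic (A : set (seqT S)) : measurable A -> sqI mu (\1_A) = mu A.
Proof.
move=> mA; rewrite /sqI -[A in RHS]setIT -integral_indic//.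
by apply: eq_integral => F _; rewrite indicE; case: (_ \in _); rewrite ?expr1n ?expr0n.
Qed.

Lemma L2_indic (A : set (seqT S)) : measurable A -> L2 (\1_A).
Proof.
move=> mA; split; first exact: measurable_indic.
by rewrite sqI_indic// (le_lt_trans (probability_le1 _ _)) ?ltry.
Qed.

Lemma tail_cst_indic (A : set (seqT S)) : measurable A -> tail_cst (\1_A).
Proof.
suff H : forall A, <<s @cyls _ S >> A -> tail_cst (\1_A).
  by rewrite seqT_cyls => /H.
apply: (@dynkin_induction _ (seqT S) (@cyls _ S) (fun A => tail_cst (\1_A))).
- exact: seqT_cyls.
- exact: setI_closed_cyls.
- rewrite (_ : \1_setT = cst 1); first exact: tail_cst_cst.
  by apply/funext => F; rewrite indicE in_setT.
- move=> _ [n [B [mB ->]]].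
  split; first by apply: L2_indic; exact: measurable_cyl.
  (* The iterate is a constant function, so its value at the default path [point] is that
     constant. *)
  move=> e e0; exists n, (iter n Q (\1_(cyl n B)) point).
  rewrite (_ : (fun _ => _) = cst 0).
    by rewrite (sqI_cst mu 0) expr0n lee_fin ltW.
  apply/funext => F; apply/eqP; rewrite subr_eq0; apply/eqP.
  apply: iter_trans_finite_dim => {}F F' FF'; rewrite !indicE; congr ((_ : bool)%:R).
  apply/idP/idP => /set_mem H; apply/mem_set => j jn.
    by rewrite -FF'//; exact: H.
  by rewrite FF'//; exact: H.
- move=> {}A mA tA.
  rewrite (_ : \1_(~` A) = fun F => (-1) * \1_A F + cst 1 F).
    by apply: tail_cst_lin => //; exact: tail_cst_cst.
  apply/funext => F; rewrite !indicE in_setC /=.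
  by case: (_ \in _); rewrite ?mulr1 ?mulr0 ?addNr ?add0r.
- move=> B mB tB HB.
  pose U m := \big[setU/set0]_(n < m) B n.
  have mU m : measurable (U m) by apply: bigsetU_measurable.
  have tU m : tail_cst (\1_(U m)).
    elim: m => [|m ih].
      rewrite (_ : \1_(U 0%N) = cst 0); first exact: tail_cst_cst.
      by apply/funext => F; rewrite /U big_ord0 indicE in_set0.
    rewrite (_ : \1_(U m.+1) = fun F => 1 * \1_(U m) F + \1_(B m) F).
      exact: tail_cst_lin.
    apply/funext => F; rewrite mul1r /U big_ord_recr /= -/(U m) !indicE in_setU.
    have [FU|_] := boolP (F \in U m); have [FB|_] := boolP (F \in B m);
      rewrite ?addr0 ?add0r//.
    exfalso; move: FU FB => /set_mem + /set_mem.
    rewrite /U -bigcup_mkord => -[j /= jm Bj] Bm.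
    have jm' := tB j m Logic.I Logic.I (ex_intro _ F (conj Bj Bm)).
    by rewrite jm' ltnn in jm.
  have mUB : measurable (\bigcup_k B k) by exact: bigcupT_measurable.
  apply: tail_cst_approx; first exact: L2_indic.
  move=> e e0.
  (* Continuity from below: finite unions exhaust the whole one in measure, so their indicators
     converge in L2. *)
  have cU : mu \o U @ \oo --> mu (\bigcup_k B k).
    have UE : \bigcup_m U m = \bigcup_k B k.
      apply/seteqP; split => F.
        by move=> [m _]; rewrite /U -bigcup_mkord => -[j _ Bj]; exists j.
      by move=> [j _ Bj]; exists j.+1 => //; rewrite /U -bigcup_mkord; exists j => /=.
    rewrite -UE; apply: nondecreasing_cvg_mu; rewrite ?UE//.
    move=> a b ab; apply/subsetPset => F; rewrite /U -!bigcup_mkord.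
    by move=> [j /= ja Bj]; exists j => //=; exact: leq_trans ab.
  have [m Hm] : exists m, (mu (\bigcup_k B k) - mu (U m) <= e%:E)%E.
    have : mu (\bigcup_k B k) \is a fin_num by exact: fin_num_measure.
    move=> /fineK H; move: cU; rewrite -H => /fine_cvgP[_ /cvgrPdist_le /(_ _ e0)].
    move=> [m _ /(_ m (leqnn m)) /=] /(le_trans (ler_norm _)) h.
    exists m; rewrite -[X in (_ - X)%E]fineK; last exact: fin_num_measure.
    by rewrite -EFinB lee_fin.
  exists (\1_(U m)) => //.
  rewrite (_ : (fun F => _) = \1_((\bigcup_k B k) `\` U m)).
    rewrite sqI_indic; last exact: measurableD.
    rewrite measureD//; last by rewrite (le_lt_trans (probability_le1 _ _)) ?ltry.
    rewrite (_ : _ `&` U m = U m)//; apply/setIidPr.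
    by rewrite /U -bigcup_mkord => F [j _ Bj]; exists j.
  apply/funext => F; rewrite !indicE in_setD.
  have [FU|FU] := boolP (F \in U m); last by rewrite subr0 andbT.
  rewrite andbF mem_set ?subrr//.
  by move: FU => /set_mem; rewrite /U -bigcup_mkord => -[j _ Bj]; exists j.
Qed.

Lemma tail_cst_nnsfun (g : {nnsfun seqT S >-> R}) : tail_cst g.
Proof.
have [s ->] : exists s : seq R,
    (g : seqT S -> R) = fun F => \sum_(r <- s) r * \1_(g @^-1` [set r]) F.
  exists (finmap.enum_fset (fset_set (range g))).
  by apply/funext => F; rewrite fimfunE fsbig_finite.
elim: s => [|r s ih].
  rewrite (_ : (fun _ => _) = cst 0); first exact: tail_cst_cst.
  by apply/funext => F; rewrite big_nil.
rewrite (_ : (fun _ => _) = fun F => r * \1_(g @^-1` [set r]) F +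
    (fun F => \sum_(r <- s) r * \1_(g @^-1` [set r]) F) F).
  by apply: tail_cst_lin => //; exact: tail_cst_indic.
by apply/funext => F; rewrite big_cons.
Qed.

(** Simple functions increase to [u]; dominated convergence with the integrable bound [u ^+ 2] makes
    the approximation one in L2. *)
Lemma tail_cst_ge0 u : L2 u -> (forall F, 0 <= u F) -> tail_cst u.
Proof.
move=> Lu u0; apply: tail_cst_approx => // e e0.
have [mf foo] := Lu.
have mE : measurable_fun setT (EFin \o u) by exact/measurable_EFinP.
pose g := nnsfun_approx measurableT mE.
have gu F : g n F @[n --> \oo] --> u F.
  have /fine_cvgP[_ ] := @cvg_nnsfun_approx _ _ _ setT measurableT _ mE
     (fun x _ => u0 x) F Logic.I.
  exact.
have gle n F : g n F <= u F.
  have nd : nondecreasing_seq (fun n => g n F).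
    by move=> a b ab; exact/lefP/nd_nnsfun_approx.
  by have := nondecreasing_cvgn_le nd (cvgP _ (gu F)) n; rewrite (cvg_lim _ (gu F)).
pose f n F := ((u F - g n F) ^+ 2)%:E.
have mfn n : measurable_fun setT (f n).
  by apply: measurable_sqE; apply: measurable_funB.
have fcv F : f n F @[n --> \oo] --> 0%E.
  apply/fine_cvgP; split; first by apply: nearW.
  rewrite (_ : 0 = (u F - u F) ^+ 2); last by rewrite subrr expr0n.
  by apply: cvgM; apply: cvgB => //; exact: cvg_cst.
have dom : mu.-integrable setT (fun F => ((u F) ^+ 2)%:E).
  apply/integrableP; split; first exact: measurable_sqE.
  by under eq_integral do rewrite gee0_abs ?lee_fin ?sqr_ge0//.
have dlt F n : [set: seqT S] F -> (`|f n F| <= ((u F) ^+ 2)%:E)%E.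
  move=> _; rewrite gee0_abs ?lee_fin ?sqr_ge0// ler_sqr ?nnegrE ?u0//.
    by rewrite lerBlDr lerDl fun_ge0.
  by rewrite subr_ge0.
have [_ _] := @dominated_convergence _ _ _ mu setT measurableT f (cst 0%E)
  (fun F => ((u F) ^+ 2)%:E) mfn (measurable_cst _) (aeW _ (fun F _ => fcv F)) dom
  (aeW _ (fun F n Ft => dlt F n Ft)).
rewrite integral0 => /fine_cvgP[fn /cvgrPdist_le /(_ _ e0) fe].
have [m [fm em]] : exists m, (\int[mu]_F f m F)%E \is a fin_num /\
    `|0 - fine (\int[mu]_F f m F)%E| <= e.
  have [m _ Hm] := filterI fn fe; exists m; exact: (Hm m (leqnn m)).
exists (g m); first exact: tail_cst_nnsfun.
rewrite /sqI -/(f m _) -[leLHS](fineK fm) lee_fin.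
by apply: le_trans em; rewrite sub0r normrN ler_norm.
Qed.

Lemma zero_one u : L2 u -> (\int[mu]_F (u F)%:E = 0)%E ->
  forall e : R, 0 < e -> exists K, (sqI mu (iter K Q u) <= e%:E)%E.
Proof.
move=> Lu u0 e e0; have [mf foo] := Lu.
have tu : tail_cst u.
  have -> : u = fun F => (-1) * u^\- F + u^\+ F.
    apply/funext => F; have /(congr1 (fun h => h F)) <- := funrposBneg u.
    by rewrite mulN1r addrC.
  have mp : measurable_fun setT u^\+ by exact: measurable_funrpos.
  have mn : measurable_fun setT u^\- by exact: measurable_funrneg.
  apply: tail_cst_lin; apply: tail_cst_ge0 => //.
  - split => //; apply: le_lt_trans foo; apply: le_sqI => // F.
    by rewrite ger0_norm ?funrneg_ge0// /funrneg ge_max normr_ge0 andbT -normrN ler_norm.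
  - split => //; apply: le_lt_trans foo; apply: le_sqI => // F.
    by rewrite ger0_norm ?funrpos_ge0// /funrpos ge_max normr_ge0 ler_norm.
(* The constant [c] is unknown, but the mean of [iter K Q u] approximates at least as well, and it
   stays at its initial value [0]. *)
have [K [c Hc]] := tu.2 _ e0; exists K; apply: le_trans Hc.
have LK := L2_iter_trans K Lu.
have mean0 : fine (\int[mu]_F (iter K Q u F)%:E)%E = 0.
  rewrite -[RHS]/(fine 0%E); congr fine; rewrite -[RHS]u0.
  elim: K {LK} => // K ih; rewrite -ih /=.
  by have [] := integral_trans (L2_integrable (L2_iter_trans K Lu)).
have := sqI_mean_best mu c LK.1; rewrite mean0; apply: le_trans.
by rewrite (_ : (fun F => _) = iter K Q u)//; apply/funext => F; rewrite subr0.
Qed.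

End zero_one.

(** * A dyadic maximal inequality *)

Section dyadic_maximal.
Context (R : realType).
Implicit Types (Z : nat -> R) (o d n : nat).

(** Offset and length: the indices run from [o + 1] to [o + n], matching a design numbered from
    1. *)
Definition block Z o n : R := \sum_(o.+1 <= i < (o + n).+1) Z i.

(** The squared block sums over all dyadic subintervals, added up: one variable that dominates every
    initial block at once. *)
Fixpoint dyadW Z o d : R :=
  if d is d'.+1 then dyadW Z o d' + dyadW Z (o + 2 ^ d') d' + block Z o (2 ^ d) ^+ 2
  else Z o.+1 ^+ 2.

Lemma block0 Z o : block Z o 0 = 0.
Proof. by rewrite /block addn0 big_geq. Qed.

Lemma block1 Z o : block Z o 1 = Z o.+1.
Proof. by rewrite /block addn1 big_nat1. Qed.

Lemma blockD Z o m n : block Z o (m + n) = block Z o m + block Z (o + m) n.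
Proof. by rewrite /block (@big_cat_nat _ _ _ (o + m).+1)//= ?ltnS ?leq_addr// ?addnA// leq_addr. Qed.

Lemma dyadW_ge0 Z o d : 0 <= dyadW Z o d.
Proof.
elim: d o => [|d ih] o /=; first exact: sqr_ge0.
by rewrite !addr_ge0// sqr_ge0.
Qed.

Lemma block_sq_dyadW Z o d : block Z o (2 ^ d) ^+ 2 <= dyadW Z o d.
Proof.
case: d => [|d] /=; first by rewrite expn0 block1.
by rewrite lerDr addr_ge0// dyadW_ge0.
Qed.

(* Rademacher-Menshov: the binary expansion of n splits the block into at most
   one dyadic block of each size. *)
Lemma sqr_block_le Z o d n : (n <= 2 ^ d)%N ->
  block Z o n ^+ 2 <= d.+1%:R * dyadW Z o d.
Proof.
elim: d o n => [|d ih] o n.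
  rewrite expn0 leq_eqVlt ltnS leqn0 => /orP[/eqP->|/eqP->].
    by rewrite block1 mul1r.
  by rewrite block0 expr0n mulr_ge0// dyadW_ge0.
have d0 : 0 < d.+1%:R :> R by rewrite ltr0n.
have W1 := dyadW_ge0 Z o d; have W2 := dyadW_ge0 Z (o + 2 ^ d) d.
have W3 := sqr_ge0 (block Z o (2 ^ d.+1)).
rewrite [dyadW _ _ d.+1]/=; set B3 := _ ^+ 2 in W3 *.
rewrite -(natr1 d.+1).
have [nd _|dn nd] := leqP n (2 ^ d).
  apply: (le_trans (ih o n nd)); nra.
have nd' : (n - 2 ^ d <= 2 ^ d)%N by move: nd; rewrite expnS; lia.
rewrite -(subnKC (ltnW dn)) blockD.
have H1 := block_sq_dyadW Z o d; have H2 := ih (o + 2 ^ d)%N _ nd'.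
move: H1 H2; set A := block _ _ _; set B := block _ _ _ => H1 H2.
move: d0 H2; set D : R := d.+1%:R => d0 H2.
(* This gives [(A + B)^2 <= (1 + D) A^2 + (1 + 1/D) B^2], multiplied by [D] below. The weights are
   chosen so that the induction factor [D] of [B] becomes exactly [D + 1]. *)
have H3 := sqr_ge0 (B - D * A).
have H4 : D * (A + B) ^+ 2 <= (D + 1) * B ^+ 2 + D * (D + 1) * A ^+ 2 by nra.
have H5 : D * (A + B) ^+ 2 <= D * ((D + 1) * (dyadW Z o d + dyadW Z (o + 2 ^ d) d)).
  apply: (le_trans H4).
  have D1 : 0 <= D + 1 by lra.
  have DD1 : 0 <= D * (D + 1) by rewrite mulr_ge0// ltW.
  by have K1 := ler_wpM2l DD1 H1; have K2 := ler_wpM2l D1 H2; lra.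
have H6 : (A + B) ^+ 2 <= (D + 1) * (dyadW Z o d + dyadW Z (o + 2 ^ d) d).
  by rewrite -(ler_pM2l d0).
apply: (le_trans H6); rewrite ler_pM2l; last by lra.
by rewrite lerDl.
Qed.

Context dT (T : measurableType dT) (m : probability T R).

Lemma measurable_block (Z : nat -> T -> R) o n :
  (forall i, measurable_fun setT (Z i)) ->
  measurable_fun setT (fun w => block (fun i => Z i w) o n).
Proof. by move=> mZ; exact: measurable_sum. Qed.

Lemma measurable_dyadW (Z : nat -> T -> R) o k :
  (forall i, measurable_fun setT (Z i)) ->
  measurable_fun setT (fun w => dyadW (fun i => Z i w) o k).
Proof.
move=> mZ; elim: k o => [|k ih] o /=; first exact: measurable_funX.
by apply: measurable_funD; [exact: measurable_funD|apply: measurable_funX; exact: measurable_block].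
Qed.

(** Each of the [k + 1] levels of the dyadic tree partitions the block, and [block c] is
    additive. *)
Lemma integral_dyadW (Z : nat -> T -> R) (c : nat -> R) (k o : nat) :
  (forall i, measurable_fun setT (Z i)) ->
  (forall o' n, (o <= o')%N -> (o' + n <= o + 2 ^ k)%N ->
    (sqI m (fun w => block (fun i => Z i w) o' n) <= (block c o' n)%:E)%E) ->
  (\int[m]_w (dyadW (fun i => Z i w) o k)%:E <= (k.+1%:R * block c o (2 ^ k))%:E)%E.
Proof.
move=> mZ; elim: k o => [|k ih] o Hc.
  rewrite mul1r /=; have := Hc o 1%N (leqnn _); rewrite expn0 => /(_ (leqnn _)).
  by rewrite /sqI; under eq_integral do rewrite block1.
have m1 := measurable_dyadW o k mZ; have m2 := measurable_dyadW (o + 2 ^ k) k mZ.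
have m3 := measurable_block o (2 ^ k.+1) mZ.
have E2 : (2 ^ k.+1 = 2 ^ k + 2 ^ k)%N by rewrite expnS mul2n addnn.
under eq_integral do rewrite [dyadW _ _ _]/= !EFinD.
rewrite ge0_integralD//; last 4 first.
- by move=> w _; rewrite -EFinD lee_fin addr_ge0// dyadW_ge0.
- by apply: emeasurable_funD; exact/measurable_EFinP.
- by move=> w _; rewrite lee_fin sqr_ge0.
- exact: measurable_sqE.
rewrite ge0_integralD//; last 4 first.
- by move=> w _; rewrite lee_fin dyadW_ge0.
- exact/measurable_EFinP.
- by move=> w _; rewrite lee_fin dyadW_ge0.
- exact/measurable_EFinP.
have I1 := ih o (fun o' n h1 h2 => Hc o' n h1 (leq_trans h2 _)).
have I2 := ih (o + 2 ^ k)%N (fun o' n h1 h2 => Hc o' n (leq_trans (leq_addr _ _) h1) (leq_trans h2 _)).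
have I3 := Hc o (2 ^ k.+1)%N (leqnn _) (leqnn _).
have -> : k.+2%:R * block c o (2 ^ k.+1) =
   k.+1%:R * block c o (2 ^ k) + k.+1%:R * block c (o + 2 ^ k) (2 ^ k) + block c o (2 ^ k.+1).
  by rewrite E2 blockD -(natr1 k.+1); ring.
rewrite !EFinD; apply: leeD; first apply: leeD.
- by apply: I1; rewrite leq_add2l E2 leq_addr.
- by apply: I2; rewrite E2 addnA.
- exact: I3.
Qed.

End dyadic_maximal.

(** * Increments bounded by Riemann sums; lower limits *)

Section one_dim.
Context (R : realType).
Implicit Types (f g : R -> R).

Lemma unif_cont_itv g (a b e : R) : continuous g -> 0 < e ->
  exists2 d : R, 0 < d & forall y z : R, a <= y <= b -> `|y - z| < d -> `|g y - g z| < e.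
Proof.
move=> cg e0.
have cab := @segment_compact R a b.
have H : \forall d \near (0:R)^'+, `[a, b]%classic `<=`
    (fun y => forall z, `|y - z| < d -> `|g y - g z| < e).
  apply: ((compact_near_coveringP _).1 cab R (0:R)^'+ (fun d y =>
    forall z, `|y - z| < d -> `|g y - g z| < e)) => y0 _.
  have /cvgrPdist_lt /(_ (e / 2)) := cg y0.
  rewrite divr_gt0// => /(_ isT) /nbhs_ballP [r /= r0 Hr].
  have r2 : 0 < r / 2 by rewrite divr_gt0.
  exists ([set y | `|y0 - y| < r / 2], [set d | d < r / 2]) => /=.
    split; first by apply/nbhs_ballP; exists (r / 2).
    exact: nbhs_right_lt.
  move=> [y d] /= [y0y dr] z yz.
  have h1 : `|g y0 - g y| < e / 2.
    by apply: Hr; rewrite /ball /= (lt_le_trans y0y)//; lra.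
  have h2 : `|g y0 - g z| < e / 2.
    apply: Hr; rewrite /ball /= [r]splitr (le_lt_trans (ler_distD y _ _))// ltrD//.
    exact: lt_trans dr.
  rewrite [e]splitr (le_lt_trans (ler_distD (g y0) _ _))// ltrD// distrC//.
have [d [d0 Hd]] : exists d : R, 0 < d /\ `[a, b]%classic `<=`
    (fun y => forall z, `|y - z| < d -> `|g y - g z| < e).
  by have [d [Hd d0]] := filter_ex (filterI H (nbhs_right_gt (0:R))); exists d.
exists d => // y z yab; apply: Hd => /=; by rewrite in_itv.
Qed.

Lemma mvt_abs f f' (a b M : R) : (forall t, is_derive t (1:R) f (f' t)) -> a <= b ->
  (forall t, a <= t <= b -> `|f' t| <= M) -> `|f b - f a| <= (b - a) * M.
Proof.
move=> df ab HM.
have cf : {within `[a, b], continuous f}.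
  apply: derivable_within_continuous => t _; exact: (@ex_derive _ _ _ _ _ _ _ (df t)).
have [c cab ->] := MVT_segment ab (fun t _ => df t) cf.
rewrite normrM mulrC (ger0_norm (_ : 0 <= b - a)) ?subr_ge0//.
by rewrite ler_wpM2l ?subr_ge0// HM// -in_itv.
Qed.

Lemma mvt_cell f f' (c d w s s' : R) : (forall t, is_derive t (1:R) f (f' t)) ->
  (forall z, c <= z <= c + d -> `|f' c - f' z| <= w) ->
  c <= s <= c + d -> c <= s' <= c + d -> `|f s' - f s| <= d * (`|f' c| + w).
Proof.
move=> df Hw; wlog ss' : s s' / s <= s'.
  move=> H hs hs'; have [h|h] := leP s s'; first exact: H.
  by rewrite distrC; apply: H => //; exact: ltW.
move=> /andP[h1 h2] /andP[h3 h4].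
have cw : 0 <= `|f' c| + w.
  rewrite addr_ge0//; apply: le_trans (Hw c _); first exact: normr_ge0.
  by rewrite lexx /=; lra.
apply: (le_trans (mvt_abs (M := `|f' c| + w) df ss' _)).
  move=> t /andP[st ts']; rewrite -lerBlDl.
  apply: le_trans (lerB_dist _ _) _; rewrite distrC; apply: Hw; lra.
by rewrite ler_wpM2r//; lra.
Qed.

(** Cell by cell the mean value theorem bounds the increment through the derivative at the left end,
    [w] paying for its oscillation inside the cell. *)
Lemma mvt_riemann f f' (u d w : R) (m : nat) : 0 <= d ->
  (forall t, is_derive t (1:R) f (f' t)) ->
  (forall y z, u <= y <= u + m%:R * d -> `|y - z| <= d -> `|f' y - f' z| <= w) ->
  forall s s', u <= s <= u + m%:R * d -> u <= s' <= u + m%:R * d ->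
  `|f s' - f s| <= \sum_(j < m) d * (`|f' (u + j%:R * d)| + w).
Proof.
move=> d0 df; elim: m => [|m ih] Hw s s' hs hs'.
  have -> : s = u by apply/eqP; rewrite eq_le; move: hs; rewrite mul0r addr0 andbC.
  have -> : s' = u by apply/eqP; rewrite eq_le; move: hs'; rewrite mul0r addr0 andbC.
  by rewrite subrr normr0 big_ord0.
have mS : m.+1%:R * d = m%:R * d + d by rewrite -natr1; ring.
have md : 0 <= m%:R * d by rewrite mulr_ge0.
rewrite mS in hs hs' Hw.
set c := u + m%:R * d.
(* Cutting at [c] through [min] and [max] treats all positions of [s] and [s'] relative to the last
   cell at once. *)
have Emm t : f t = f (Num.min t c) + f (Num.max t c) - f c.
  by case: (leP t c) => h; ring.
rewrite big_ord_recr /=.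
have -> : f s' - f s = (f (Num.min s' c) - f (Num.min s c)) +
                      (f (Num.max s' c) - f (Num.max s c)).
  by rewrite (Emm s') (Emm s); ring.
apply: (le_trans (ler_normD _ _)); apply: lerD.
  apply: ih.
  - by move=> y z hy; apply: Hw; move: hy => /andP[-> h] /=; lra.
  - by rewrite le_min ge_min lexx orbT andbT; move: hs => /andP[-> _]; rewrite /c; lra.
  - by rewrite le_min ge_min lexx orbT andbT; move: hs' => /andP[-> _]; rewrite /c; lra.
apply: mvt_cell => //.
- move=> z /andP[h1 h2]; apply: Hw; first by rewrite /c; lra.
  by rewrite distrC ger0_norm; [|rewrite subr_ge0]; lra.
- rewrite le_max lexx orbT ge_max /=; move: hs => /andP[_ h]; rewrite /c; lra.
- rewrite le_max lexx orbT ge_max /=; move: hs' => /andP[_ h]; rewrite /c; lra.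
Qed.

Lemma limn_einfE (u : nat -> \bar R) : limn_einf u = ereal_sup (range (einfs u)).
Proof.
rewrite limn_einf_lim; apply/cvg_lim => //; apply: ereal_nondecreasing_cvgn.
exact: nondecreasing_einfs.
Qed.

Lemma le_limn_einf (c : \bar R) (u : nat -> \bar R) :
  (\forall n \near \oo, (c <= u n)%E) -> (c <= limn_einf u)%E.
Proof.
move=> [N _ HN].
rewrite limn_einfE; apply: (@le_trans _ _ (einfs u N)).
  by apply: le_ereal_inf_tmp => _ [n /= Nn <-]; exact: HN.
by apply: ereal_sup_ubound; exists N.
Qed.

Lemma limn_einf_le_cst (c : \bar R) (u : nat -> \bar R) :
  (forall n, (u n <= c)%E) -> (limn_einf u <= c)%E.
Proof.
move=> H; rewrite limn_einfE; apply: ub_ereal_sup => _ [n _ <-].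
apply: le_trans (H n); apply: ereal_inf_lbound; exists n => //=.
Qed.

(** Left ends of the [m + 1] equal cells of [[-b, b]]; the successor keeps the number of cells
    positive. *)
Definition gridpt (b : R) (m j : nat) : R := - b + j%:R * (2 * b / m.+1%:R).

Lemma gridpt_in (b : R) m j : 0 <= b -> (j < m.+1)%N -> `|gridpt b m j| <= b.
Proof.
move=> b0 jm; rewrite ler_norml /gridpt.
have : 0 <= j%:R * (2 * b / m.+1%:R) by rewrite mulr_ge0// divr_ge0// mulr_ge0.
have : j%:R * (2 * b / m.+1%:R) <= 2 * b.
  rewrite mulrA ler_pdivrMr ?ltr0n// mulrC ler_wpM2l ?mulr_ge0//.
  by rewrite ler_nat ltnW.
by move: (j%:R * _) => q h1 h2; apply/andP; split; lra.
Qed.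

Lemma sqr_sum_le (m : nat) (a : nat -> R) :
  (\sum_(j < m) a j) ^+ 2 <= m%:R * \sum_(j < m) a j ^+ 2.
Proof.
elim: m => [|m ih]; first by rewrite !big_ord0 expr0n mul0r.
rewrite !big_ord_recr /= -natr1.
have Q0 : 0 <= \sum_(j < m) a j ^+ 2 by apply: sumr_ge0 => j _; exact: sqr_ge0.
move: ih Q0; set A := \sum_(j < m) a j; set Q := \sum_(j < m) a j ^+ 2 => ih Q0.
have [m0|m0] := posnP m.
  move: ih; rewrite m0 mul0r => ih; have A0 : A = 0 by apply/eqP; rewrite -sqrf_eq0 eq_le ih sqr_ge0.
  rewrite A0; nra.
have : 0 < m%:R :> R by rewrite ltr0n.
move: ih; set M : R := m%:R => ih M0.
have h := sqr_ge0 (A - M * a m).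
have : 0 <= M * (Q + M * a m ^+ 2 - 2 * A * a m) by nra.
rewrite pmulr_rge0//; nra.
Qed.

(* Riemann sums replace the integral of f'^2, so that Fatou applies to random f
   without joint measurability. *)
Lemma sqr_increment_le f f' (b s : R) : 0 <= b -> `|s| <= b ->
  (forall t, is_derive t (1:R) f (f' t)) -> continuous f' ->
  (((f s - f 0) ^+ 2)%:E <= limn_einf (fun m => (4 * b ^+ 2 / m.+1%:R *
     \sum_(j < m.+1) f' (gridpt b m j) ^+ 2)%:E))%E.
Proof.
move=> b0 sb df cf'.
apply/lee_subgt0Pr => e e0; apply: le_limn_einf.
set D := `|f s - f 0|.
have D0 : 0 <= D by exact: normr_ge0.
have DE : (f s - f 0) ^+ 2 = D ^+ 2 by rewrite real_normK ?num_real.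
(* Replacing [D] by [D - eta] loses at most [2 * eta * D <= e] in the square; [w] below makes the
   oscillation over the whole length [2 * b] cost at most [eta]. *)
pose eta := e / (2 * (D + 1)).
have eta0 : 0 < eta by rewrite divr_gt0// mulr_gt0//; lra.
pose w := eta / (2 * b + 1).
have w0 : 0 < w by rewrite divr_gt0//; lra.
have [r r0 Hr] := @unif_cont_itv f' (- b) b w cf' w0.
have Hm : \forall m \near \oo, 2 * b / m.+1%:R < r.
  exists (Num.truncn (2 * b / r)).+1 => // m /= Hm.
  rewrite ltr_pdivrMr ?ltr0n// (mulrC r) -ltr_pdivrMr//.
  apply: (lt_le_trans (truncnS_gt _)); rewrite ler_nat; exact: leq_trans Hm _.
apply: filterS Hm => m Hm; rewrite DE -EFinB lee_fin.
set del := 2 * b / m.+1%:R in Hm *.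
have del0 : 0 <= del by rewrite divr_ge0// mulr_ge0.
have mdel : m.+1%:R * del = 2 * b by rewrite /del mulrC divfK// pnatr_eq0.
set A := \sum_(j < m.+1) del * `|f' (gridpt b m j)|.
have H1 : D <= A + eta.
  have H := @mvt_riemann f f' (- b) del w m.+1 del0 df.
  have {}H := H _ 0 s _ _.
  have : D <= \sum_(j < m.+1) del * (`|f' (- b + j%:R * del)| + w).
    apply: H.
    - rewrite mdel => y z hy yz; apply/ltW/Hr; first by lra.
      exact: le_lt_trans Hm.
    - by rewrite mdel; lra.
    - by rewrite mdel; move: sb; rewrite ler_norml; lra.
  move/le_trans; apply; under eq_bigr do rewrite mulrDr.
  rewrite big_split /= lerD2l sumr_const card_ord -mulr_natl mulrA mdel.
  have wE : w * (2 * b + 1) = eta by rewrite /w divfK// gt_eqF//; lra.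
  move: wE w0; clear; nra.
have A0 : 0 <= A by apply: sumr_ge0 => j _; rewrite mulr_ge0.
have H2 : A ^+ 2 <= 4 * b ^+ 2 / m.+1%:R * \sum_(j < m.+1) f' (gridpt b m j) ^+ 2.
  have CS : (\sum_(j < m.+1) `|f' (gridpt b m j)|) ^+ 2 <=
            m.+1%:R * \sum_(j < m.+1) f' (gridpt b m j) ^+ 2.
    apply: le_trans (sqr_sum_le _ (fun j => `|f' (gridpt b m j)|)) _.
    rewrite ler_wpM2l// ler_sum// => j _; by rewrite real_normK ?num_real.
  rewrite /A -mulr_sumr exprMn.
  apply: le_trans (ler_wpM2l (sqr_ge0 _) CS) _.
  rewrite mulrA; apply: ler_wpM2r; first by apply: sumr_ge0 => j _; exact: sqr_ge0.
  rewrite le_eqVlt; apply/orP; left; apply/eqP.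
  by rewrite /del; field; rewrite gt_eqF// ltr0n.
apply: le_trans H2.
have H3 : 2 * eta * D <= e.
  rewrite /eta -mulrA -[X in _ <= X]mulr1.
  have -> : 2 * (e / (2 * (D + 1)) * D) = e * (D / (D + 1)) by field; rewrite gt_eqF//; lra.
  apply: ler_wpM2l; first exact: ltW.
  by rewrite ler_pdivrMr ?mul1r; lra.
have [h|h] := leP eta D; last by nra.
have H4 : (D - eta) ^+ 2 <= A ^+ 2 by rewrite ler_sqr ?nnegrE//; lra.
nra.
Qed.

End one_dim.

(** * Suprema over boxes *)

Lemma lee_limn_einf (R : realType) (u v : nat -> \bar R) :
  (forall n, (u n <= v n)%E) -> (limn_einf u <= limn_einf v)%E.
Proof.
move=> uv; rewrite !limn_einfE; apply: ge_ereal_sup => _ [n _ <-].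
apply: (@le_trans _ _ (einfs v n)); last by apply: ereal_sup_ubound; exists n.
apply: le_ereal_inf_tmp => _ [k /= nk <-]; apply: le_trans (uv k).
by apply: ereal_inf_lbound; exists k.
Qed.

Section box_sup.
Context dT (T : measurableType dT) (R : realType) (m : probability T R).
Variables (L : nat) (H : nat -> nat -> R -> T -> R) (e0 C : R)
  (x : nat -> nat -> R) (b : R).
Hypothesis e0_ge0 : 0 <= e0.
Hypothesis C_ge0 : 0 <= C.
Hypothesis b_ge0 : 0 <= b.
Hypothesis mH : forall l i t, measurable_fun setT (H l i t).
Hypothesis dH : forall l i w t, (l < L)%N ->
  is_derive t (1:R) (fun t => H l i t w) (H l.+1 i t w).
Hypothesis cH : forall l i w, (l <= L)%N -> continuous (fun t => H l i t w).
Hypothesis H2 : forall l o n a tau, (l <= L)%N ->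
  (forall i, (o < i <= o + n)%N -> `|tau i| <= e0) ->
  (sqI m (fun w => block (fun i => a i * H l i (tau i) w)%R o n) <=
   (block (fun i => C * a i ^+ 2)%R o n)%:E)%E.

Definition shiftx (k i : nat) (beta : nat -> R) : R := \sum_(j < k) x i j * beta j.
Definition absx (k i : nat) : R := \sum_(j < k) `|x i j|.

(** The factor per coordinate in [box_majorant]: both summands of [(y + z)^2 <= 2 y^2 + 2 z^2], the
    increment carrying [4 * b ^+ 2] and a weight [x i k] that is absorbed by [b * |x i k| <= e0]. *)
Definition Kcst : R := 2 + 8 * e0 ^+ 2.

(** A measurable dominating variable replaces the supremum over [beta] and [n], whose own
    measurability is thereby never at stake. *)
Definition has_majorant (f : T -> (nat -> R) -> nat -> R) (k d : nat) (c : R) :=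
  exists U : T -> \bar R, [/\ measurable_fun setT U, (forall w, (0 <= U w)%E),
    (\int[m]_w U w <= c%:E)%E &
    forall w beta n, (forall j, (j < k)%N -> `|beta j| <= b) -> (n <= 2 ^ d)%N ->
      ((f w beta n ^+ 2)%:E <= U w)%E].

(** [l] counts the derivatives already spent and [k] the coordinates of [beta] still free;
    coordinates already frozen are stored in [tau]. *)
Definition boxsum l k (a tau : nat -> R) (w : T) (beta : nat -> R) (n : nat) : R :=
  block (fun i => a i * H l i (tau i - shiftx k i beta) w) 0 n.

(** One factor [d + 1] comes from the pathwise bound [sqr_block_le], the other from the number of
    levels in [integral_dyadW]. *)
Definition cost d (a : nat -> R) : R := d.+1%:R ^+ 2 * block (fun i => C * a i ^+ 2) 0 (2 ^ d).

Lemma cost_ge0 d a : 0 <= cost d a.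
Proof.
by rewrite mulr_ge0// sumr_ge0// => i _; rewrite mulr_ge0// sqr_ge0.
Qed.

Lemma shiftxS k i beta : shiftx k.+1 i beta = shiftx k i beta + x i k * beta k.
Proof. by rewrite /shiftx big_ord_recr. Qed.

Lemma absx_ge0 k i : 0 <= absx k i.
Proof. by apply: sumr_ge0. Qed.

Lemma absx_le j k i : (j <= k)%N -> absx j i <= absx k i.
Proof.
move=> jk; rewrite -(subnK jk); elim: (k - j)%N => // n ih.
by apply: (le_trans ih); rewrite addSn /absx big_ord_recr /= lerDl.
Qed.

Lemma is_derive_block l k (a c : nat -> R) w o n t : (l < L)%N ->
  is_derive t (1:R) (fun s => block (fun i => a i * H l i (c i - x i k * s) w) o n)
    (block (fun i => - (a i * x i k) * H l.+1 i (c i - x i k * t) w) o n).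
Proof.
move=> lL; elim: n => [|n ih].
  rewrite block0 (_ : (fun s => _) = cst 0); first exact: is_derive_cst.
  by apply/funext => s; rewrite block0.
rewrite -addn1 blockD block1.
rewrite (_ : (fun s => _) = (fun s => block (fun i => a i * H l i (c i - x i k * s) w) o n) \+
   (fun s => a (o + n).+1 * H l (o + n).+1 (c (o + n).+1 - x (o + n).+1 k * s) w)); last first.
  by apply/funext => s; rewrite blockD block1.
apply: is_deriveD; set i := (o + n).+1.
have d1 : is_derive t (1:R) (fun s => c i - x i k * s) (- x i k).
  have := is_derive_poly ((c i)%:P - (x i k) *: 'X) t.
  rewrite derivB derivC derivZ derivX sub0r hornerN hornerZ hornerC mulr1.
  by congr is_derive; apply/funext => s; rewrite !hornerE.
have d2 := @is_derive1_comp _ (fun s => H l i s w) (fun s => c i - x i k * s) t _ _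
  (dH i w (c i - x i k * t) lL) d1.
have h := is_deriveZ (a i) d2.
have -> : - (a i * x i k) * H l.+1 i (c i - x i k * t) w =
  a i *: (H l.+1 i (c i - x i k * t) w * - x i k) by rewrite /GRing.scale /=; ring.
exact: h.
Qed.

Lemma continuous_block l k (a c : nat -> R) w o n : (l <= L)%N ->
  continuous (fun s => block (fun i => a i * H l i (c i - x i k * s) w) o n).
Proof.
move=> lL; elim: n => [|n ih].
  rewrite (_ : (fun s => _) = cst 0); first exact: cst_continuous.
  by apply/funext => s; rewrite block0.
rewrite (_ : (fun s => _) = (fun s => block (fun i => a i * H l i (c i - x i k * s) w) o n) \+
   (fun s => a (o + n).+1 * H l (o + n).+1 (c (o + n).+1 - x (o + n).+1 k * s) w)); last first.
  by apply/funext => s; rewrite -addn1 blockD block1.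
move=> t; apply: continuousD; first exact: ih.
apply: continuousM; first exact: cst_continuous.
apply: (@continuous_comp _ _ _ (fun s => c (o + n).+1 - x (o + n).+1 k * s)
  (fun s => H l (o + n).+1 s w)); last exact: cH.
apply: continuousB; first exact: cst_continuous.
by apply: continuousM; [exact: cst_continuous|exact: cvg_id].
Qed.

(* The last coordinate is integrated out at the cost of one derivative in t. *)
Lemma increment_majorant l k d (a tau : nat -> R) : (l < L)%N ->
  (forall a' tau', (forall i, (0 < i <= 2 ^ d)%N -> `|tau' i| + b * absx k i <= e0) ->
     has_majorant (boxsum l.+1 k a' tau') k d (Kcst ^+ k * cost d a')) ->
  (forall i, (0 < i <= 2 ^ d)%N -> `|tau i| + b * absx k.+1 i <= e0) ->
  has_majorant (fun w beta n => boxsum l k.+1 a tau w beta n - boxsum l k a tau w beta n)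
    k.+1 d (4 * b ^+ 2 * (Kcst ^+ k * cost d (fun i => a i * x i k))).
Proof.
move=> lL IH Htau.
pose a' i := - (a i * x i k).
have costE : cost d a' = cost d (fun i => a i * x i k).
  by rewrite /cost /block; congr (_ * _); apply: eq_bigr => i _; rewrite sqrrN.
set c := Kcst ^+ k * _; have c0 : 0 <= c.
  rewrite /c mulr_ge0 ?cost_ge0// exprn_ge0// /Kcst.
  by have := sqr_ge0 e0; lra.
(* The last coordinate is frozen at [s] and moved into [tau]; the bound with [absx k.+1] leaves room
   for that shift. For [|s| > b] any [U] will do, since only grid points are used. *)
have HU s : exists U : T -> \bar R, `|s| <= b ->
    [/\ measurable_fun setT U, (forall w, (0 <= U w)%E), (\int[m]_w U w <= c%:E)%E &
    forall w beta n, (forall j, (j < k)%N -> `|beta j| <= b) -> (n <= 2 ^ d)%N ->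
      ((boxsum l.+1 k a' (fun i => tau i - x i k * s) w beta n ^+ 2)%:E <= U w)%E].
  have [sb|sb] := leP `|s| b; last by exists (cst 0%E).
  have [i i1|U [h1 h2 h3 h4]] := IH a' (fun i => tau i - x i k * s).
    apply: le_trans (Htau i i1); rewrite /absx big_ord_recr /= mulrDr addrA [leRHS]addrAC.
    rewrite lerD2r (le_trans (ler_normB _ _))// lerD2l normrM mulrC.
    by rewrite ler_wpM2r.
  by exists U => _; rewrite /c -costE.
have [U {}HU] := choice HU.
(* By Fatou the mean of [V] is at most the common bound [4 * b ^+ 2 * c] of the means of the Riemann
   sums. *)
pose V w := limn_einf (fun N => (4 * b ^+ 2 / N.+1%:R)%:E * \sum_(j < N.+1) U (gridpt b N j) w)%E.
have HUg N (j : 'I_N.+1) := HU _ (gridpt_in b_ge0 (ltn_ord j)).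
have cN (N : nat) : 0 <= 4 * b ^+ 2 / N.+1%:R :> R.
  by rewrite divr_ge0// mulr_ge0// sqr_ge0.
have mS N : measurable_fun setT (fun w => \sum_(j < N.+1) U (gridpt b N j) w)%E.
  by apply: emeasurable_sum => j; case: (HUg N j).
have S0 N w : (0 <= \sum_(j < N.+1) U (gridpt b N j) w)%E.
  by apply: sume_ge0 => j _; case: (HUg N j).
have mV N : measurable_fun setT (fun w => (4 * b ^+ 2 / N.+1%:R)%:E * \sum_(j < N.+1) U (gridpt b N j) w)%E.
  exact: measurable_funeM.
have V0 N w : (0 <= (4 * b ^+ 2 / N.+1%:R)%:E * \sum_(j < N.+1) U (gridpt b N j) w)%E.
  by apply: mule_ge0; [rewrite lee_fin|exact: S0].
exists V; split.
- rewrite (_ : V = fun w => - limn_esup (fun N => - ((4 * b ^+ 2 / N.+1%:R)%:E * \sum_(j < N.+1) U (gridpt b N j) w)))%E//.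
  apply: measurableT_comp => //; apply: measurable_fun_limn_esup => N.
  exact: measurableT_comp.
- by move=> w; apply: le_limn_einf; apply: nearW.
- apply: le_trans (fatou _ measurableT mV (fun N w _ => V0 N w)) _.
  apply: limn_einf_le_cst => N.
  rewrite ge0_integralZl//; last by rewrite lee_fin.
  rewrite ge0_integral_sum//; last 2 first.
  - by move=> j; case: (HUg N j).
  - by move=> j w _; case: (HUg N j).
  apply: (@le_trans _ _ ((4 * b ^+ 2 / N.+1%:R)%:E * \sum_(j < N.+1) c%:E)%E).
    by apply: lee_wpmul2l; [rewrite lee_fin|apply: lee_sum => j _; case: (HUg N j)].
  rewrite sumEFin -EFinM lee_fin sumr_const card_ord -(mulr_natl c).
  by rewrite mulrA divfK.
- move=> w beta n Hbeta nd.
  pose f s := block (fun i => a i * H l i (tau i - shiftx k i beta - x i k * s) w) 0 n.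
  pose f' s := block (fun i => a' i * H l.+1 i (tau i - shiftx k i beta - x i k * s) w) 0 n.
  have fE : boxsum l k.+1 a tau w beta n - boxsum l k a tau w beta n = f (beta k) - f 0.
    congr (_ - _); apply: eq_bigr => i _; first by rewrite shiftxS opprD addrA.
    by rewrite mulr0 subr0.
  have df t : is_derive t (1:R) f (f' t).
    exact: (is_derive_block k a (fun i => tau i - shiftx k i beta)).
  have cf' : continuous f'.
    rewrite /f' => t.
    exact: (@continuous_block l.+1 k a' (fun i => tau i - shiftx k i beta) w 0 n lL t).
  have bk : `|beta k| <= b by apply: Hbeta.
  rewrite fE; apply: le_trans (sqr_increment_le b_ge0 bk df cf') _.
  apply: lee_limn_einf => N.
  rewrite EFinM -sumEFin; apply: lee_wpmul2l; first by rewrite lee_fin.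
  apply: lee_sum => j _; have [_ _ _ HUj] := HUg N j.
  apply: le_trans (HUj w beta n _ nd); last by move=> i ik; apply: Hbeta; exact: ltnW.
  rewrite lee_fin le_eqVlt; apply/orP; left; apply/eqP; congr (_ ^+ 2).
  by apply: eq_bigr => i _; congr (_ * H _ _ _ _); ring.
Qed.

(** Induction on the free coordinates: the sum is its value with the last coordinate at [0] plus an
    increment, and the increment consumes one of the derivatives that [l + k <= L] keeps in
    reserve. *)
Lemma box_majorant k : forall l d (a tau : nat -> R), (l + k <= L)%N ->
  (forall i, (0 < i <= 2 ^ d)%N -> `|tau i| + b * absx k i <= e0) ->
  has_majorant (boxsum l k a tau) k d (Kcst ^+ k * cost d a).
Proof.
elim: k => [|k ih] l d a tau lL Htau.
  have mZ i : measurable_fun setT (fun w => a i * H l i (tau i) w).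
    exact: measurable_funM.
  exists (fun w => (d.+1%:R * dyadW (fun i => a i * H l i (tau i) w) 0 d)%:E); split.
  - apply/measurable_EFinP; apply: measurable_funM => //.
    exact: (@measurable_dyadW _ _ _ (fun i w => a i * H l i (tau i) w)).
  - by move=> w; rewrite lee_fin mulr_ge0// dyadW_ge0.
  - under eq_integral do rewrite EFinM.
    rewrite ge0_integralZl//; last 2 first.
    + apply/measurable_EFinP.
      exact: (@measurable_dyadW _ _ _ (fun i w => a i * H l i (tau i) w)).
    + by move=> w _; rewrite lee_fin dyadW_ge0.
    rewrite expr0 mul1r /cost expr2 -mulrA EFinM; apply: lee_wpmul2l; first by rewrite lee_fin.
    apply: (@integral_dyadW _ _ _ m (fun i w => a i * H l i (tau i) w) (fun i => C * a i ^+ 2)) => //.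
    move=> o n _; rewrite add0n => on; apply: H2.
      by move: lL; rewrite addn0.
    move=> i /andP[oi ion]; have := Htau i; rewrite /absx big_ord0 mulr0 addr0; apply.
    by rewrite (leq_ltn_trans _ oi)// (leq_trans ion).
  - move=> w beta n _ nd; rewrite lee_fin.
    have -> : boxsum l 0 a tau w beta n = block (fun i => a i * H l i (tau i) w) 0 n.
      by apply: eq_bigr => i _; rewrite /shiftx big_ord0 subr0.
    exact: sqr_block_le.
have lL' : (l < L)%N by rewrite (leq_trans _ lL)// addnS ltnS leq_addr.
have lkL : (l.+1 + k <= L)%N by rewrite addSnnS.
have [U1 [m1 p1 I1 B1]] : has_majorant (boxsum l k a tau) k d (Kcst ^+ k * cost d a).
  apply: ih; first by rewrite (leq_trans _ lL)// leq_add2l.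
  move=> i i1; apply: le_trans (Htau i i1); rewrite lerD2l ler_wpM2l//.
  by rewrite /absx big_ord_recr /= lerDl.
have [U2 [m2 p2 I2 B2]] := increment_majorant a lL' (fun a' tau' => ih l.+1 d a' tau' lkL) Htau.
have m1' : measurable_fun setT (fun w => 2%:E * U1 w)%E by exact: measurable_funeM.
have m2' : measurable_fun setT (fun w => 2%:E * U2 w)%E by exact: measurable_funeM.
exists (fun w => 2%:E * U1 w + 2%:E * U2 w)%E; split.
- exact: emeasurable_funD.
- by move=> w; rewrite adde_ge0// mule_ge0.
- rewrite ge0_integralD//; last 2 first.
  + by move=> w _; rewrite mule_ge0.
  + by move=> w _; rewrite mule_ge0.
  rewrite !ge0_integralZl//.
  apply: (@le_trans _ _ (2%:E * (Kcst ^+ k * cost d a)%:E +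
     2%:E * (4 * b ^+ 2 * (Kcst ^+ k * cost d (fun i => a i * x i k)))%:E)%E).
    by apply: leeD; apply: lee_wpmul2l.
  rewrite -!EFinM -EFinD lee_fin.
  have K0 : 0 <= Kcst ^+ k.
    by rewrite exprn_ge0// /Kcst; have := sqr_ge0 e0; lra.
  have h : b ^+ 2 * cost d (fun i => a i * x i k) <= e0 ^+ 2 * cost d a.
    rewrite /cost (mulrCA (b ^+ 2)) (mulrCA (e0 ^+ 2)); apply: ler_wpM2l; first exact: sqr_ge0.
    rewrite /block !mulr_sumr add0n !big_nat; apply: ler_sum => i i1.
    have hx : `|b * x i k| <= e0.
      apply: le_trans (Htau i _); last by move: i1; rewrite ltnS.
      rewrite normrM (ger0_norm b_ge0); apply: le_trans (_ : b * absx k.+1 i <= _).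
        by rewrite ler_wpM2l// /absx big_ord_recr /= lerDr absx_ge0.
      by rewrite lerDr.
    have hx2 : (b * x i k) ^+ 2 <= e0 ^+ 2.
      by rewrite -(real_normK (num_real (b * x i k))) ler_sqr ?nnegrE.
    have -> : b ^+ 2 * (C * (a i * x i k) ^+ 2) = (b * x i k) ^+ 2 * (C * a i ^+ 2) by ring.
    by apply: ler_wpM2r => //; rewrite mulr_ge0// sqr_ge0.
  have -> : 2 * (Kcst ^+ k * cost d a) + 2 * (4 * b ^+ 2 * (Kcst ^+ k * cost d (fun i => a i * x i k))) =
     Kcst ^+ k * (2 * cost d a + 8 * (b ^+ 2 * cost d (fun i => a i * x i k))) by ring.
  have -> : Kcst ^+ k.+1 * cost d a = Kcst ^+ k * (Kcst * cost d a) by rewrite exprSr mulrA.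
  by apply: ler_wpM2l => //; rewrite /Kcst; move: h; lra.
- move=> w beta n Hbeta nd.
  have h1 := B1 w beta n (fun j jk => Hbeta j (ltnW jk)) nd.
  have h2 := B2 w beta n Hbeta nd.
  apply: le_trans (leeD (lee_wpmul2l _ h1) (lee_wpmul2l _ h2)); rewrite ?lee_fin//.
  set y := boxsum l k _ _ _ _ _; set z := boxsum l k.+1 _ _ _ _ _.
  by have := sqr_ge0 (y - (z - y)); nra.
Qed.

(** Telescoping over the coordinates makes every summand an increment; this produces the factor
    [b ^+ 2], absent from the bound on the sum itself and responsible for the [b_n] in [Bn]. *)
Lemma box_increment_majorant k : forall d (a : nat -> R), (k <= L)%N ->
  (forall i, (0 < i <= 2 ^ d)%N -> b * absx k i <= e0) ->
  has_majorant (fun w beta n => boxsum 0 k a (fun=> 0) w beta n -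
                                boxsum 0 0 a (fun=> 0) w beta n) k d
    (k%:R * (4 * b ^+ 2 * (Kcst ^+ k * \sum_(j < k) cost d (fun i => a i * x i j)))).
Proof.
move=> d a kL Hx.
have K1 : 1 <= Kcst by rewrite /Kcst; have := sqr_ge0 e0; lra.
have HU (j : 'I_k) : has_majorant (fun w beta n => boxsum 0 j.+1 a (fun=> 0) w beta n -
    boxsum 0 j a (fun=> 0) w beta n) j.+1 d
    (4 * b ^+ 2 * (Kcst ^+ j * cost d (fun i => a i * x i j))).
  apply: increment_majorant.
  - exact: leq_ltn_trans (leq0n j) (leq_trans (ltn_ord j) kL).
  - by move=> a' tau' Ht; apply: box_majorant => //; rewrite add1n (leq_trans (ltn_ord j)).
  - move=> i i1; rewrite normr0 add0r; apply: le_trans (Hx i i1); rewrite ler_wpM2l//.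
    exact: absx_le.
have [U {}HU] := choice HU.
have mU j : measurable_fun setT (U j) by case: (HU j).
have U0 j w : (0 <= U j w)%E by case: (HU j).
have S0 w : (0 <= \sum_(j < k) U j w)%E by apply: sume_ge0.
have mS : measurable_fun setT (fun w => \sum_(j < k) U j w)%E.
  exact: emeasurable_sum.
exists (fun w => k%:R%:E * \sum_(j < k) U j w)%E; split.
- exact: measurable_funeM.
- by move=> w; apply: mule_ge0; [rewrite lee_fin|exact: S0].
- rewrite ge0_integralZl//.
  rewrite EFinM; apply: lee_wpmul2l; first by rewrite lee_fin.
  rewrite ge0_integral_sum//.
  apply: (@le_trans _ _ (\sum_(j < k) (4 * b ^+ 2 * (Kcst ^+ j *
     cost d (fun i => a i * x i j)))%:E)%E).
    by apply: lee_sum => j _; case: (HU j).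
  rewrite sumEFin lee_fin !mulr_sumr; apply: ler_sum => j _.
  rewrite ler_wpM2l ?mulr_ge0 ?sqr_ge0//; apply: ler_wpM2r; first exact: cost_ge0.
  by apply: ler_weXn2l => //; exact: ltnW.
- move=> w beta n Hbeta nd.
  rewrite -(@telescope_sumr _ 0 k (fun j => boxsum 0 j a (fun=> 0) w beta n))//.
  rewrite big_mkord.
  apply: (@le_trans _ _ (k%:R * \sum_(j < k) (boxsum 0 j.+1 a (fun=> 0) w beta n -
     boxsum 0 j a (fun=> 0) w beta n) ^+ 2)%:E).
    by rewrite lee_fin; apply: (sqr_sum_le k (fun j => boxsum 0 j.+1 a (fun=> 0) w beta n -
     boxsum 0 j a (fun=> 0) w beta n)).
  rewrite EFinM -sumEFin; apply: lee_wpmul2l; first by rewrite lee_fin.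
  apply: lee_sum => j _; have [_ _ _] := HU j; apply => // i ij; apply: Hbeta.
  exact: leq_trans ij (ltn_ord j).
Qed.

End box_sup.

(** * Exponential martingales *)

Section mgf.
Context d (T : measurableType d) (R : realType) (m : probability T R).

(** Inverting [e^(-x) >= 1 - x] reduces it to [(1 - x)(1 + x + 2 x^2) = 1 + x^2 (1 - 2 x) >= 1]. *)
Lemma expR_quad (x : R) : x <= 1 / 2 -> expR x <= 1 + x + 2 * x ^+ 2.
Proof.
move=> x2.
have h := expR_ge1Dx (- x); rewrite expRN in h.
have e0 := expR_gt0 x.
have p0 : 0 <= 1 + x + 2 * x ^+ 2 by nra.
have h2 : (1 - x) * expR x <= 1.
  have := ler_wpM2r (ltW e0) h; rewrite mulVf ?gt_eqF//.
have h3 : 1 <= (1 - x) * (1 + x + 2 * x ^+ 2) by have := sqr_ge0 x; nra.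
have x1 : 0 < 1 - x by lra.
by rewrite -(ler_pM2l x1) (le_trans h2).
Qed.

(** The rate [1 / (2 t)] is the largest that keeps the exponent within the range of [expR_quad]. *)
Lemma mgf_le (f g : T -> R) (t : R) : 0 < t ->
  measurable_fun setT f -> measurable_fun setT g ->
  (forall x, `|f x| <= g x <= t) ->
  (\int[m]_x (expR ((2 * t)^-1 * f x))%:E <=
   (expR ((2 * t)^-1 * fine (\int[m]_x (f x)%:E) +
          2 * (2 * t)^-1 ^+ 2 * fine (\int[m]_x ((g x) ^+ 2)%:E)))%:E)%E.
Proof.
move=> t0 mf mg fg.
set lam := (2 * t)^-1.
have lam0 : 0 < lam by rewrite invr_gt0 mulr_gt0.
have lt2 : lam * t = 1 / 2 by rewrite /lam; field; rewrite gt_eqF.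
have g0 x : 0 <= g x by have /andP[h _] := fg x; exact: le_trans h.
have g2oo : (sqI m g < +oo)%E.
  apply: (@le_lt_trans _ _ (sqI m (cst t))); last by rewrite sqI_cst ltry.
  apply: le_sqI => // x; rewrite /= !ger0_norm// ?(ltW t0)//.
  by case/andP: (fg x).
have f2oo : (sqI m f < +oo)%E.
  apply: le_lt_trans g2oo; apply: le_sqI => // x; rewrite (ger0_norm (g0 x)).
  by case/andP: (fg x).
have fi := sqI_integrable mf f2oo.
have gi : m.-integrable setT (EFin \o (fun x => g x ^+ 2)).
  apply/integrableP; split; first exact: measurable_sqE.
  by under eq_integral do rewrite gee0_abs ?lee_fin ?sqr_ge0//.
pose h x := 1 + (lam * f x + 2 * lam ^+ 2 * g x ^+ 2).
have hle x : expR (lam * f x) <= h x.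
  have /andP[h1 h2] := fg x.
  apply: (le_trans (expR_quad _)).
    by rewrite -lt2 ler_wpM2l ?(ltW lam0)// (le_trans (ler_norm _))// (le_trans h1).
  rewrite /h -addrA lerD2l lerD2l exprMn mulrA.
  apply: ler_wpM2l; first by rewrite mulr_ge0// sqr_ge0.
  by rewrite -(real_normK (num_real (f x))) ler_sqr ?nnegrE.
have i1 : m.-integrable setT (EFin \o (fun x => lam * f x)).
  by have := integrableZl measurableT lam fi.
have i2 : m.-integrable setT (EFin \o (fun x => 2 * lam ^+ 2 * g x ^+ 2)).
  by have := integrableZl measurableT (2 * lam ^+ 2) gi.
have i3 : m.-integrable setT (EFin \o (fun x => lam * f x + 2 * lam ^+ 2 * g x ^+ 2)).
  by have := integrableD measurableT i1 i2.
have i0 : m.-integrable setT (EFin \o cst (1:R)).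
  exact: finite_measure_integrable_cst.
have mh : measurable_fun setT h.
  apply: measurable_funD => //; apply: measurable_funD; apply: measurable_funM => //.
  exact: measurable_funX.
apply: (@le_trans _ _ (\int[m]_x (h x)%:E)%E).
  apply: ge0_le_integral => //.
  - apply/measurable_EFinP; apply: (measurableT_comp (@measurable_expR R)).
    exact: measurable_funM.
  - exact/measurable_EFinP.
  - by move=> x _; rewrite lee_fin.
have -> : (\int[m]_x (h x)%:E = (1 + (lam * fine (\int[m]_x (f x)%:E) +
    2 * lam ^+ 2 * fine (\int[m]_x (g x ^+ 2)%:E)))%:E)%E.
  transitivity (\int[m]_x ((EFin \o cst (1%R : R)) \+
     (EFin \o (fun x => lam * f x + 2 * lam ^+ 2 * g x ^+ 2)%R)) x)%E; first by [].
  rewrite integralD_EFin// (integral1 m 1) [in RHS]EFinD; congr (_ + _)%E.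
  transitivity (\int[m]_x ((EFin \o (fun x => lam * f x)%R) \+
     (EFin \o (fun x => 2 * lam ^+ 2 * g x ^+ 2)%R)) x)%E; first by [].
  rewrite integralD_EFin// [in RHS]EFinD; congr (_ + _)%E.
    rewrite EFinM fineK ?(integrable_fin_num measurableT fi)//.
    exact: (integralZl measurableT fi).
  rewrite EFinM fineK ?(integrable_fin_num measurableT gi)//.
  exact: (integralZl measurableT gi).
by rewrite lee_fin expR_ge1Dx.
Qed.

End mgf.

Section exp_martingale.
Context dS (S : measurableType dS) (R : realType)
  (mu : probability (seqT S) R) (nu : probability S R).
Hypothesis mu_scons : forall A, measurable A ->
  mu A = (mu \x nu)%E (@sconsp _ S @^-1` A).
Variables (v V : nat -> seqT S -> R) (t : R).
Hypothesis t0 : 0 < t.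
Hypothesis mv : forall i, measurable_fun setT (v i).
Hypothesis mV : forall i, measurable_fun setT (V i).
Hypothesis vV : forall i F, `|v i F| <= V i F.

Definition trunc (f : seqT S -> R) (U : seqT S -> R) (F : seqT S) : R := if U F <= t then f F else 0.

Let tv i := trunc (v i) (V i).
Let tV i := trunc (V i) (V i).

Lemma measurable_trunc f U : measurable_fun setT f -> measurable_fun setT U ->
  measurable_fun setT (trunc f U).
Proof.
move=> mf mU; apply: measurable_fun_ifT => //.
by apply: measurable_fun_ler.
Qed.

(* On the truncated increments e^z <= 1 + z + 2 z^2 applies, which makes the
   exponential of the partial sums a supermartingale of mean at most 1. *)
Definition expinc i (F : seqT S) : R :=
  (2 * t)^-1 * (tv i F - trans nu (tv i) (shift F)) -
  2 * (2 * t)^-1 ^+ 2 * trans nu (fun F => tV i F ^+ 2) (shift F).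

Definition expmart n (F : seqT S) : R :=
  expR (\sum_(1 <= i < n.+1) expinc i (iter (n - i) (@shift _ S) F)).

Lemma measurable_expinc i : measurable_fun setT (expinc i).
Proof.
have mtv : measurable_fun setT (tv i) by exact: measurable_trunc.
have mtV : measurable_fun setT (fun F => tV i F ^+ 2).
  by apply: measurable_funX; exact: measurable_trunc.
have ms := @measurable_shift _ S.
apply: measurable_funB; apply: measurable_funM => //.
  apply: measurable_funB => //.
  exact: measurableT_comp (measurable_trans nu mtv) ms.
exact: measurableT_comp (measurable_trans nu mtV) ms.
Qed.

Lemma measurable_expmart n : measurable_fun setT (expmart n).
Proof.
apply: (measurableT_comp (@measurable_expR R)); apply: measurable_sum => i.
exact: measurableT_comp (measurable_expinc i) (measurable_iter_shift _).
Qed.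

Lemma expmartS n F : expmart n.+1 F = expmart n (shift F) * expR (expinc n.+1 F).
Proof.
rewrite /expmart -expRD; congr expR; rewrite big_nat_recr//= subnn; congr (_ + _).
apply: eq_big_nat => i /andP[_]; rewrite ltnS => i_n.
by rewrite subSn// iterSr.
Qed.

Lemma integral_expmart n : (\int[mu]_F (expmart n F)%:E <= 1)%E.
Proof.
elim: n => [|n ih].
  rewrite (_ : (fun F => _) = fun=> 1%E); first by rewrite (integral1 mu 1).
  by apply/funext => F; rewrite /expmart big_geq// expR0.
have mE k : measurable_fun setT (EFin \o expmart k).
  by apply/measurable_EFinP; exact: measurable_expmart.
rewrite (tonelli_scons mu_scons (f := EFin \o expmart n.+1))//; last first.
- by move=> F; rewrite lee_fin expR_ge0.
apply: le_trans ih; apply: ge0_le_integral => //.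
- by move=> F _; apply: integral_ge0 => s _; rewrite lee_fin expR_ge0.
- by apply: (measurable_tonelli_scons nu (mE n.+1)) => F; rewrite lee_fin expR_ge0.
- exact: mE.
move=> F _ /=.
pose a := - ((2 * t)^-1 * trans nu (tv n.+1) F +
   2 * (2 * t)^-1 ^+ 2 * trans nu (fun F => tV n.+1 F ^+ 2) F).
have -> : (\int[nu]_s (expmart n.+1 (scons s F))%:E =
   (expmart n F * expR a)%:E * \int[nu]_s (expR ((2 * t)^-1 * tv n.+1 (scons s F)))%:E)%E.
  rewrite -ge0_integralZl//.
  - apply: eq_integral => s _; rewrite expmartS shift_scons -EFinM; congr (_%:E).
    have -> : expinc n.+1 (scons s F) = a + (2 * t)^-1 * tv n.+1 (scons s F).
      by rewrite /expinc shift_scons /a; ring.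
    by rewrite expRD mulrA.
  - apply/measurable_EFinP; apply: (measurableT_comp (@measurable_expR R)).
    by apply: measurable_funM => //; apply: measurable_slice; exact: measurable_trunc.
  - by rewrite lee_fin mulr_ge0// expR_ge0.
have H := @mgf_le _ _ _ nu (fun s => tv n.+1 (scons s F)) (fun s => tV n.+1 (scons s F)) t t0.
have {}H := H (measurable_slice F (measurable_trunc (mv _) (mV _)))
  (measurable_slice F (measurable_trunc (mV _) (mV _))).
apply: (@le_trans _ _ ((expmart n F * expR a)%:E * (expR (- a))%:E)%E).
  apply: lee_wpmul2l; first by rewrite lee_fin mulr_ge0// expR_ge0.
  rewrite /a opprK; apply: H => s; rewrite /tv /tV /trunc.
  by case: ifPn => // h; rewrite ?vV// normr0 lexx ltW.
by rewrite -EFinM lee_fin -mulrA -expRD subrr expR0 mulr1.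
Qed.

(** Truncation spoils the centring; the bias is at most the conditional mean of [V] on [V > t],
    hence at most that of [V^2 / t]. *)
Lemma trans_trunc_le i (F : seqT S) : (sqI nu (fun s => V i (scons s F)) < +oo)%E ->
  `|trans nu (v i) F - trans nu (tv i) F| <= fine (sqI nu (fun s => V i (scons s F))) / t.
Proof.
move=> Voo.
have mVF := measurable_slice F (mV i); have mvF := measurable_slice F (mv i).
have mtvF := measurable_slice F (measurable_trunc (mv i) (mV i)).
have V0 F' : 0 <= V i F' by exact: le_trans (vV i F').
have v2 : (sqI nu (fun s => v i (scons s F)) < +oo)%E.
  by apply: le_lt_trans Voo; apply: le_sqI => // s; rewrite [leRHS]ger0_norm.
have tv2 : (sqI nu (fun s => tv i (scons s F)) < +oo)%E.
  apply: le_lt_trans v2; apply: le_sqI => // s; rewrite /tv /trunc.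
  by case: ifP => // _; rewrite normr0.
have iv := sqI_integrable mvF v2; have itv := sqI_integrable mtvF tv2.
have iV2 : nu.-integrable setT (EFin \o (fun s => V i (scons s F) ^+ 2)).
  apply/integrableP; split; first exact: measurable_sqE.
  by under eq_integral do rewrite gee0_abs ?lee_fin ?sqr_ge0//.
have mb : measurable_fun setT (fun s => v i (scons s F) - tv i (scons s F)).
  exact: measurable_funB.
have ib : nu.-integrable setT (EFin \o (fun s => v i (scons s F) - tv i (scons s F))).
  by have := integrableB measurableT iv itv.
have ibn : nu.-integrable setT (EFin \o (fun s => `|v i (scons s F) - tv i (scons s F)|)).
  exact: integrable_norm.
have iVt : nu.-integrable setT (EFin \o (fun s => V i (scons s F) ^+ 2 / t)).
  by have := integrableZr measurableT t^-1 iV2.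
have -> : trans nu (v i) F - trans nu (tv i) F =
    (\int[nu]_(s in setT) (v i (scons s F) - tv i (scons s F)))%R.
  by rewrite RintegralB.
have -> : fine (sqI nu (fun s => V i (scons s F))) / t =
    (\int[nu]_(s in setT) (V i (scons s F) ^+ 2 / t))%R.
  by rewrite RintegralZr.
apply: le_trans (le_normr_Rintegral measurableT ib) _.
apply: le_Rintegral => // s _; rewrite /tv /trunc.
case: ifPn => [_|]; first by rewrite subrr normr0 divr_ge0 ?sqr_ge0// ltW.
rewrite -ltNge subr0 => ltV; apply: (le_trans (vV _ _)).
by rewrite ler_pdivlMr// expr2 ler_wpM2l// ltW.
Qed.

(** [2 * t] times the exponent is the truncated martingale minus its conditional variance over [t].
    That variance term and the truncation bias each add up to at most [t ^+ 2 / t], whence the [+ 1]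
    beside [kappa]. *)
Lemma expmart_bound n (F : seqT S) (kappa : R) : 0 <= kappa ->
  expmart n F <= expR kappa ->
  (forall i, (1 <= i <= n)%N -> V i (iter (n - i) (@shift _ S) F) <= t) ->
  (\sum_(1 <= i < n.+1) sqI nu (fun s => V i (scons s (shift (iter (n - i) (@shift _ S) F)))) <= (t ^+ 2)%:E)%E ->
  \sum_(1 <= i < n.+1) (v i (iter (n - i) (@shift _ S) F) -
     trans nu (v i) (shift (iter (n - i) (@shift _ S) F))) <= 2 * t * (kappa + 1).
Proof.
move=> k0 Zk Vt Ut.
pose Fi i := iter (n - i) (@shift _ S) F.
pose U i := fine (sqI nu (fun s => V i (scons s (shift (Fi i))))).
have Uoo i : (1 <= i < n.+1)%N -> (sqI nu (fun s => V i (scons s (shift (Fi i)))) < +oo)%E.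
  move=> i1n; apply: (@le_lt_trans _ _ (t ^+ 2)%:E); last by rewrite ltry.
  apply: le_trans Ut; rewrite (bigD1_seq i) ?mem_index_iota ?iota_uniq//=.
  by rewrite leeDl// sume_ge0// => j _; exact: sqI_ge0.
have sU : \sum_(1 <= i < n.+1) U i <= t ^+ 2.
  rewrite -lee_fin -sumEFin; apply: le_trans Ut.
  rewrite big_nat_cond [leRHS]big_nat_cond; apply: lee_sum => i /andP[i1n _].
  by rewrite /U fineK// ge0_fin_numE ?Uoo// sqI_ge0.
have E : \sum_(1 <= i < n.+1) expinc i (Fi i) <= kappa by rewrite -ler_expR.
have step i : (1 <= i < n.+1)%N ->
    v i (Fi i) - trans nu (v i) (shift (Fi i)) <= 2 * t * expinc i (Fi i) + 2 * (U i / t).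
  move=> i1n; have Vi : V i (Fi i) <= t by apply: Vt; rewrite -ltnS.
  have h1 := trans_trunc_le (Uoo i i1n); rewrite -/(U i) in h1.
  have tvE : v i (Fi i) = tv i (Fi i) by rewrite /tv /trunc Vi.
  have h2 : trans nu (fun F => tV i F ^+ 2) (shift (Fi i)) <= U i.
    rewrite /trans /U; apply: fine_le.
    - rewrite ge0_fin_numE; last by apply: integral_ge0 => s _; rewrite lee_fin sqr_ge0.
      apply: le_lt_trans (Uoo i i1n); apply: le_sqI.
      + by apply: measurable_slice; exact: measurable_trunc.
      + exact: measurable_slice.
      + by move=> s; rewrite /tV /trunc; case: ifP => // _; rewrite normr0.
    - by rewrite ge0_fin_numE ?sqI_ge0// Uoo.
    - apply: le_sqI.
      + by apply: measurable_slice; exact: measurable_trunc.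
      + exact: measurable_slice.
      + by move=> s; rewrite /tV /trunc; case: ifP => // _; rewrite normr0.
  have h3 : trans nu (tv i) (shift (Fi i)) - trans nu (v i) (shift (Fi i)) <= U i / t.
    by apply: le_trans h1; rewrite distrC ler_norm.
  have -> : 2 * t * expinc i (Fi i) = (tv i (Fi i) - trans nu (tv i) (shift (Fi i))) -
      trans nu (fun F => tV i F ^+ 2) (shift (Fi i)) / t.
    by rewrite /expinc; field; rewrite gt_eqF.
  have h4 : trans nu (fun F => tV i F ^+ 2) (shift (Fi i)) / t <= U i / t.
    by rewrite ler_pM2r ?invr_gt0.
  by rewrite tvE; lra.
apply: (@le_trans _ _ (\sum_(1 <= i < n.+1) (2 * t * expinc i (Fi i) + 2 * (U i / t)))).
  by rewrite big_nat [leRHS]big_nat; apply: ler_sum => i; exact: step.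
rewrite big_split /= -!mulr_sumr -mulr_suml.
have h5 : (\sum_(1 <= i < n.+1) U i) / t <= t.
  by rewrite ler_pdivrMr// -expr2.
have h6 : 2 * t * \sum_(1 <= i < n.+1) expinc i (Fi i) <= 2 * t * kappa.
  by rewrite ler_pM2l// mulr_gt0.
lra.
Qed.

End exp_martingale.

(** * Summable means *)

Section summable.
Context (R : realType).
Implicit Types (u v : nat -> R).

Definition bounded_sums u := exists M : R, forall n, \sum_(i < n) u i <= M.

Lemma bounded_sumsZ c u : 0 <= c -> bounded_sums u -> bounded_sums (fun i => c * u i).
Proof.
move=> c0 [M HM]; exists (c * M) => n; rewrite -mulr_sumr.
by rewrite ler_wpM2l.
Qed.

Lemma bounded_sumsD u v : bounded_sums u -> bounded_sums v ->
  bounded_sums (fun i => u i + v i).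
Proof.
move=> [M HM] [N HN]; exists (M + N) => n; rewrite big_split /=.
by apply: lerD; [exact: HM|exact: HN].
Qed.

Lemma bounded_sums_geo (r : R) : 0 <= r < 1 -> bounded_sums (fun i => r ^+ i).
Proof.
move=> /andP[r0 r1]; exists (1 - r)^-1 => n.
have h : (1 - r) * \sum_(i < n) r ^+ i = 1 - r ^+ n.
  by rewrite -opprB mulNr -subrX1 opprB.
have p : 0 < 1 - r by rewrite subr_gt0.
rewrite -(ler_pM2l p) h mulfV ?gt_eqF// gerBl exprn_ge0//.
Qed.

(** Cauchy condensation, [v k] dominating [u] on the dyadic range that starts at [2 ^ k]. *)
Lemma bounded_sums_dyadic u v k0 : (forall i, 0 <= u i) ->
  (forall k d, (k0 <= k)%N -> (2 ^ k <= d < 2 ^ k.+1)%N -> u d <= v k) ->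
  (forall k, 0 <= v k) ->
  bounded_sums (fun k => 2 ^+ k * v k) -> bounded_sums u.
Proof.
move=> u0 uv v0 [M HM].
exists (\sum_(i < 2 ^ k0) u i + M) => n.
have H K : \sum_(i < 2 ^ (k0 + K)) u i <= \sum_(i < 2 ^ k0) u i + \sum_(k0 <= k < k0 + K) 2 ^+ k * v k.
  elim: K => [|K ih]; first by rewrite addn0 (big_geq (leqnn k0)) addr0.
  have E : (2 ^ (k0 + K.+1) = 2 ^ (k0 + K) + 2 ^ (k0 + K))%N.
    by rewrite addnS expnS mul2n addnn.
  rewrite E big_split_ord /= addnS big_nat_recr ?leq_addr//= addrA lerD//.
  apply: (@le_trans _ _ (\sum_(i < 2 ^ (k0 + K)) v (k0 + K)%N)).
    apply: ler_sum => i _; apply: uv; first exact: leq_addr.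
    by rewrite leq_addr expnS mul2n -addnn ltn_add2l ltn_ord.
  by rewrite sumr_const card_ord -(natrX R 2) mulr_natl.
have n2 : (n <= 2 ^ (k0 + n))%N.
  apply: ltnW; apply: leq_trans (ltn_expl n (leqnn 2)) _.
  by rewrite leq_exp2l// leq_addl.
apply: (@le_trans _ _ (\sum_(i < 2 ^ (k0 + n)) u i)).
  rewrite -!(big_mkord predT u) [leRHS](@big_cat_nat _ _ _ n) //= lerDl.
  by apply: sumr_ge0.
apply: (le_trans (H n)); rewrite lerD2l; apply: le_trans (HM (k0 + n)%N).
rewrite -(big_mkord predT (fun k => 2 ^+ k * v k)) [leRHS](@big_cat_nat _ _ _ k0) ?leq_addr//= lerDr.
by apply: sumr_ge0 => i _; rewrite mulr_ge0// exprn_ge0.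
Qed.

Lemma bounded_sums_powR (s : R) : 1 < s -> bounded_sums (fun d => d%:R `^ (- s)).
Proof.
move=> s1; have s0 : 0 < s by lra.
apply: (@bounded_sums_dyadic _ (fun k => (2 ^+ k) `^ (- s)) 0).
- by move=> i; exact: powR_ge0.
- move=> k d _ /andP[kd _].
  have k2 : 0 < 2 ^+ k :> R by rewrite exprn_gt0.
  have d2 : 2 ^+ k <= d%:R :> R by rewrite -natrX ler_nat.
  rewrite !powRN lef_pV2 ?posrE ?powR_gt0//; last exact: lt_le_trans d2.
  by rewrite ge0_ler_powR ?nnegrE ?(ltW s0)// ltW.
- by move=> k; exact: powR_ge0.
- have -> : (fun k => 2 ^+ k * (2 ^+ k) `^ (- s)) = fun k => ((2 : R) `^ (1 - s)) ^+ k.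
    apply/funext => k.
    rewrite -{1}[2 ^+ k]powRr1 ?exprn_ge0// -powRD; last first.
      by apply/implyP => _; rewrite expf_neq0.
    by rewrite -powR_mulrn// -powRrM mulrC powRrM powR_mulrn// powR_ge0.
  apply: bounded_sums_geo; rewrite powR_ge0 /=.
  have -> : 1 - s = - (s - 1) by ring.
  rewrite powRN invf_lt1 ?powR_gt0//.
  have s10 : 0 < s - 1 by rewrite subr_gt0.
  rewrite -[X in X < _](_ : 1 `^ (s - 1) = 1); last by rewrite powR1.
  apply: (gt0_ltr_powR s10); rewrite ?nnegrE ?ler01 ?ler0n ?ltr1n//.
Qed.

Lemma ln2_gt0 : 0 < ln 2 :> R. Proof. by rewrite ln_gt0// ltr1n. Qed.

Lemma ln_exp2 (d : nat) : ln (2 ^+ d) = d%:R * ln 2 :> R.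
Proof. by rewrite lnXn// mulr_natl. Qed.

Lemma ln2_gt_half : (2^-1 : R) < ln 2.
Proof.
have e4 : expR (4^-1) <= 4 / 3 :> R.
  have := @expR_ge1Dx R (- 4^-1); rewrite expRN => h.
  have e0 := expR_gt0 (4^-1 : R).
  have := ler_wpM2r (ltW e0) h; rewrite mulVf ?gt_eqF//; lra.
rewrite -ltr_expR lnK ?posrE//.
have -> : (2^-1 : R) = 4^-1 + 4^-1 by field.
rewrite expRD; have e0 := expR_gt0 (4^-1 : R).
nra.
Qed.

Lemma lnln2_gt : - ln 2 < ln (ln 2) :> R.
Proof. by rewrite -lnV ?posrE// ltr_ln ?posrE ?invr_gt0 ?ln2_gt0 ?ln2_gt_half. Qed.

(** Since [ln (ln (2 ^+ d)) = ln d + ln (ln 2)], these are the terms of Bertrand's series.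
    Condensation gives [(k - 1)^(-s)], the shift by one coming from [ln (ln 2) > - ln 2]. *)
Lemma bounded_sums_bertrand (s : R) : 1 < s ->
  bounded_sums (fun d => d%:R^-1 * (ln (ln (2 ^+ d : R))) `^ (- s)).
Proof.
move=> s1; have s0 : 0 < s by lra.
have l2 := ln2_gt0.
apply: (@bounded_sums_dyadic _ (fun k => (2 ^+ k)^-1 * ((k%:R - 1) * ln 2) `^ (- s)) 2).
- by move=> i; rewrite mulr_ge0 ?invr_ge0// powR_ge0.
- move=> k d k2 /andP[kd _].
  have k20 : 0 < 2 ^+ k :> R by rewrite exprn_gt0.
  have d2 : 2 ^+ k <= d%:R :> R by rewrite -natrX ler_nat.
  have d0 : 0 < d%:R :> R by exact: lt_le_trans d2.
  have k1 : 1 < k%:R :> R by rewrite ltr1n.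
  have kl : 0 < (k%:R - 1) * ln 2 :> R by rewrite mulr_gt0// subr_gt0.
  have lle : (k%:R - 1) * ln 2 <= ln (ln (2 ^+ d)) :> R.
    rewrite ln_exp2 lnM ?posrE//.
    have : ln (2 ^+ k) <= ln d%:R :> R by rewrite ler_ln ?posrE.
    rewrite ln_exp2; have := lnln2_gt; lra.
  apply: ler_pM.
  - by rewrite invr_ge0.
  - exact: powR_ge0.
  - by rewrite lef_pV2 ?posrE.
  - rewrite !powRN lef_pV2 ?posrE ?powR_gt0//; last exact: lt_le_trans lle.
    by rewrite ge0_ler_powR ?nnegrE ?(ltW s0)// ?(ltW kl)// (le_trans (ltW kl)).
- by move=> k; rewrite mulr_ge0 ?invr_ge0 ?exprn_ge0// powR_ge0.
- have -> : (fun k => 2 ^+ k * ((2 ^+ k)^-1 * ((k%:R - 1) * ln 2) `^ (- s))) =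
     fun k => ((k%:R - 1) * ln 2 : R) `^ (- s).
    by apply/funext => k; rewrite mulrA mulfV ?mul1r// expf_neq0.
  have [M HM] := bounded_sumsZ (powR_ge0 (ln 2) (- s)) (bounded_sums_powR s1).
  (* The shifted series starts at the argument [-1]; that single term is kept apart, as it
     stands. *)
  exists ((- 1 * ln 2) `^ (- s) + M) => -[|n].
    by rewrite big_ord0 addr_ge0 ?powR_ge0//; have := HM 0%N; rewrite big_ord0.
  rewrite big_ord_recl /= sub0r lerD2l; apply: le_trans (HM n).
  apply: ler_sum => i _; rewrite /bump /= add1n -natr1 addrK powRM ?(ltW l2)// [leRHS]mulrC; exact: lexx.
Qed.

End summable.

(** * From summable means to almost sure bounds *)

Section almost_sure.
Context d (T : measurableType d) (R : realType) (P : probability T R).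

(* Stands in for Borel-Cantelli: the series of the X_k is a.s. finite. *)
Lemma ae_eventually_le1 (X : nat -> T -> \bar R) (u : nat -> R) :
  (forall k, measurable_fun setT (X k)) -> (forall k w, (0 <= X k w)%E) ->
  bounded_sums u -> (forall k, 0 <= u k) ->
  (\forall k \near \oo, (\int[P]_w X k w <= (u k)%:E)%E) ->
  {ae P, forall w, \forall k \near \oo, (X k w <= 1)%E}.
Proof.
move=> mX X0 [M HM] u0 [k0 _ Hk0].
pose Y k w := if (k < k0)%N then 0%E else X k w.
have mY k : measurable_fun setT (Y k).
  by rewrite /Y; case: (k < k0)%N; [exact: measurable_cst|exact: mX].
have Y0 k w : (0 <= Y k w)%E by rewrite /Y; case: ifP.
have IY k : (\int[P]_w Y k w <= (u k)%:E)%E.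
  rewrite /Y; case: (ltnP k k0) => kk0; first by rewrite integral0 lee_fin.
  exact: Hk0.
have SY : (\int[P]_w (\sum_(0 <= k <oo) Y k w) <= M%:E)%E.
  rewrite integral_nneseries//.
  apply: lime_le; first by apply: is_cvg_nneseries => k _ _; exact: integral_ge0.
  apply: nearW => n; rewrite big_mkord.
  apply: (@le_trans _ _ (\sum_(k < n) (u k)%:E)%E); first by apply: lee_sum.
  by rewrite sumEFin lee_fin.
have mS : measurable_fun setT (fun w => \sum_(0 <= k <oo) Y k w)%E.
  exact: ge0_emeasurable_sum.
have iS : P.-integrable setT (fun w => \sum_(0 <= k <oo) Y k w)%E.
  apply/integrableP; split => //.
  under eq_integral do rewrite gee0_abs ?nneseries_ge0//.
  by apply: le_lt_trans SY _; rewrite ltry.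
have := integrable_ae measurableT iS; apply: filterS => w /= /(_ I) fin.
have fo : (\sum_(0 <= k <oo) Y k w < +oo)%E.
  by rewrite -ge0_fin_numE// nneseries_ge0.
have := nneseries_tail_cvg fo (fun k _ => Y0 k w).
move=> /fine_cvgP[H2 /cvgrPdist_le /(_ 1 ltr01) H1].
near=> k; have k0k : (k0 <= k)%N by near: k; exact: nbhs_infty_ge.
have tf : (\sum_(k <= i <oo) Y i w)%E \is a fin_num by near: k.
have t1 : `|0 - fine (\sum_(k <= i <oo) Y i w)%E| <= 1 by near: k.
have -> : X k w = Y k w by rewrite /Y ltnNge k0k.
apply: (@le_trans _ _ (\sum_(k <= i <oo) Y i w)%E).
  have := @nneseries_lim_ge R (Y ^~ w) xpredT k k.+1 (fun i _ _ => Y0 i w).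
  by rewrite big_nat1.
rewrite -(fineK tf) lee_fin; apply: le_trans t1.
by rewrite sub0r normrN ler_norm.
Unshelve. all: by end_near. Qed.

End almost_sure.

Section growth.
Context (R : realType).

(** The term of order [m + 1] of the exponential series, with [m >= a], exceeds [y^a] by a factor
    proportional to [y]. *)
Lemma expR_dominates (a c e : R) : 0 < c -> 0 < e ->
  exists y0 : R, 0 < y0 /\ forall y, y0 <= y -> y `^ a <= e * expR (c * y).
Proof.
move=> c0 e0.
pose m := (Num.truncn `|a|).+1.
pose K : R := c ^+ m.+1 / m.+1`!%:R.
have K0 : 0 < K by rewrite divr_gt0 ?exprn_gt0// ltr0n fact_gt0.
exists (Num.max 1 (e * K)^-1); split; first by rewrite lt_max ltr01.
move=> y; rewrite ge_max => /andP[y1 y2].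
have y0 : 0 < y by lra.
have am : a <= m%:R.
  by apply: le_trans (ler_norm a) _; rewrite ltW// /m truncnS_gt.
apply: (@le_trans _ _ (y `^ m%:R)).
  by apply: ler_powR.
rewrite powR_mulrn ?(ltW y0)//.
have cy : 0 <= c * y by rewrite mulr_ge0 ?ltW.
have h := expR_ge1Dxn m cy.
have h2 : K * y ^+ m.+1 <= expR (c * y).
  by apply: le_trans h; rewrite exprMn /K mulrAC lerDr ler01.
have h3 : 1 <= e * K * y.
  have eK : 0 < e * K by rewrite mulr_gt0.
  by rewrite -(mulfV (lt0r_neq0 eK)) ler_pM2l.
apply: (@le_trans _ _ (e * (K * y ^+ m.+1))); last by rewrite ler_pM2l.
have ym : 0 <= y ^+ m by rewrite exprn_ge0// ltW.
have -> : e * (K * y ^+ m.+1) = e * K * y * y ^+ m by rewrite [y ^+ m.+1]exprS !mulrA.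
by have := ler_wpM2r ym h3; rewrite mul1r.
Qed.

End growth.

(** * Martingale increments of a monotone score *)

Lemma le_sume_term (R : realType) (I : finType) (f : I -> \bar R) i :
  (forall j, 0 <= f j)%E -> (f i <= \sum_j f j)%E.
Proof. by move=> f0; rewrite (bigD1 i)//= leeDl// sume_ge0. Qed.

Section mart_majorant.
Context dS (S : measurableType dS) (R : realType)
  (mu : probability (seqT S) R) (nu : probability S R).
Hypothesis mu_scons : forall A, measurable A ->
  mu A = (mu \x nu)%E (@sconsp _ S @^-1` A).
Variables (psi : R -> R) (G : seqT S -> R).
Hypothesis psi_homo : {homo psi : s t / s <= t}.
Hypothesis mpsi : measurable_fun setT psi.
Hypothesis mG : measurable_fun setT G.

Lemma measurable_psiG (t : R) : measurable_fun setT (fun F => psi (G F + t)).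
Proof. by apply: (measurableT_comp mpsi); exact: measurable_funD. Qed.

Lemma integral_iter_shift (f : seqT S -> \bar R) k : measurable_fun setT f ->
  (forall F, (0 <= f F)%E) ->
  (\int[mu]_F f (iter k (@shift _ S) F) = \int[mu]_F f F)%E.
Proof.
move=> mf f0; elim: k => [//|k <-].
rewrite -[RHS](integral_shift mu_scons (f := f \o iter k (@shift _ S)))//.
  by apply: eq_integral => F _; rewrite iterSr.
  exact: measurableT_comp mf (measurable_iter_shift k).
by move=> F; exact: f0.
Qed.

Definition psi_incr (t : R) (F : seqT S) : R := psi (G F + t) - psi (G F).

Lemma measurable_psi_incr t : measurable_fun setT (psi_incr t).
Proof.
apply: measurable_funB; first exact: measurable_psiG.
exact: measurableT_comp.
Qed.

(** With [a] as [|x_i|] and [r] as the radius, monotonicity of [psi] makes this a common envelope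
    for all weighted increments over the ball ([psi_incr_range]). *)
Definition psi_range (a r : R) (F : seqT S) : R :=
  a * (psi (G F + a * r) - psi (G F - a * r)).

Lemma measurable_psi_range a r : measurable_fun setT (psi_range a r).
Proof.
apply: measurable_funM => //.
by apply: measurable_funB; exact: measurable_psiG.
Qed.

Lemma psi_incr_range (w t a r : R) F : `|w| <= a -> `|t| <= a * r ->
  `|w * psi_incr t F| <= psi_range a r F.
Proof.
move=> wa; rewrite ler_norml => /andP[t1 t2].
have ar : 0 <= a * r by lra.
have h1 : psi (G F - a * r) <= psi (G F + t) by apply: psi_homo; lra.
have h2 : psi (G F + t) <= psi (G F + a * r) by apply: psi_homo; lra.
have h3 : psi (G F - a * r) <= psi (G F) by apply: psi_homo; lra.
have h4 : psi (G F) <= psi (G F + a * r) by apply: psi_homo; lra.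
rewrite normrM /psi_range; apply: ler_pM => //.
by rewrite /psi_incr ler_norml; apply/andP; split; lra.
Qed.

(** This turns the envelope into the summands of [taut]: the two signs of the argument there are the
    two ends of the range. *)
Lemma sqI_psi_range_le (a r : R) : 0 <= a ->
  (sqI mu (psi_range a r) <=
   (2 * a ^+ 2)%:E * (sqI mu (psi_incr (a * r)) + sqI mu (psi_incr (- (a * r)))))%E.
Proof.
move=> a0.
have E F : psi_range a r F = a * (psi_incr (a * r) F - psi_incr (- (a * r)) F).
  by rewrite /psi_range /psi_incr; ring.
have m1 := measurable_psi_incr (a * r); have m2 := measurable_psi_incr (- (a * r)).
have m3 : measurable_fun setT (fun F => - psi_incr (- (a * r)) F) by exact: measurable_funN.
rewrite (_ : psi_range a r = fun F => a * (psi_incr (a * r) F - psi_incr (- (a * r)) F)); last exact/funext.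
rewrite sqIZ//; last exact: measurable_funB.
have -> : ((2 * a ^+ 2)%:E = (a ^+ 2)%:E * 2%:E)%E by rewrite -EFinM mulrC.
rewrite -muleA.
apply: lee_wpmul2l; first by rewrite lee_fin sqr_ge0.
have := sqID mu m1 m3.
rewrite (_ : sqI mu (fun F => - psi_incr (- (a * r)) F) = sqI mu (psi_incr (- (a * r)))); last first.
  by rewrite /sqI; under eq_integral do rewrite sqrrN.
move=> h; apply: (le_trans h).
move: (sqI_ge0 mu (psi_incr (a * r))) (sqI_ge0 mu (psi_incr (- (a * r)))).
move: (sqI mu (psi_incr (a * r))) (sqI mu (psi_incr (- (a * r)))) => y z y0 z0.
by rewrite ge0_muleDr.
Qed.

(* X <= 1 bounds by Markov all increments and the conditional variance by the
   truncation level [tr], and all exponential martingales by e^kappa. *)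
Lemma mart_majorant (N : nat) (C : finType) (t w : C -> nat -> R) (a : nat -> R)
    (r tr kappa : R) : 0 < tr -> 0 <= kappa ->
  (forall c i, `|w c i| <= a i) -> (forall c i, `|t c i| <= a i * r) ->
  exists X : seqT S -> \bar R, [/\ measurable_fun setT X, forall F, (0 <= X F)%E,
   (\int[mu]_F X F <= (2 * tr ^- 2)%:E * (\sum_(1 <= i < N.+1) sqI mu (psi_range (a i) r)) +
      (expR (- kappa) * #|C|%:R * N.+1%:R)%:E)%E &
   forall F, (X F <= 1)%E -> forall c n, (n <= N)%N ->
    \sum_(1 <= i < n.+1) (w c i * psi_incr (t c i) (iter (N - i) (@shift _ S) F) -
      trans nu (fun F' => w c i * psi_incr (t c i) F') (shift (iter (N - i) (@shift _ S) F)))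
    <= 2 * tr * (kappa + 1)].
Proof.
move=> tr0 k0 wa ta.
pose V i := psi_range (a i) r.
pose v c i F := w c i * psi_incr (t c i) F.
have mV i : measurable_fun setT (V i) by exact: measurable_psi_range.
have mv c i : measurable_fun setT (v c i).
  by apply: measurable_funM => //; exact: measurable_psi_incr.
have vV c i F : `|v c i F| <= V i F by exact: psi_incr_range.
pose Fi i (F : seqT S) : seqT S := iter (N - i) (@shift _ S) F.
have mFi i : measurable_fun setT (Fi i) by exact: measurable_iter_shift.
have trp : 0 <= tr ^- 2 by rewrite invr_ge0 sqr_ge0.
pose X1 F := (\sum_(1 <= i < N.+1) (tr ^- 2)%:E * (V i (Fi i F) ^+ 2)%:E)%E.
pose X2 F := (\sum_(1 <= i < N.+1)
   (tr ^- 2)%:E * sqI nu (fun s => V i (scons s (shift (Fi i F)))))%E.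
pose X3 F := (\sum_(n < N.+1) \sum_(c : C)
   (expR (- kappa))%:E * (expmart nu (v c) V tr n (Fi n F))%:E)%E.
have m1 i : measurable_fun setT (fun F => (tr ^- 2)%:E * (V i (Fi i F) ^+ 2)%:E)%E.
  apply: measurable_funeM; apply: measurable_sqE.
  exact: measurableT_comp (mV i) (mFi i).
have m2 i : measurable_fun setT (fun F => (tr ^- 2)%:E *
    sqI nu (fun s => V i (scons s (shift (Fi i F)))))%E.
  apply: measurable_funeM.
  apply: (measurableT_comp (measurable_sqI_scons nu (mV i))).
  exact: measurableT_comp (@measurable_shift _ S) (mFi i).
have m3 n c : measurable_fun setT (fun F => (expR (- kappa))%:E *
    (expmart nu (v c) V tr n (Fi n F))%:E)%E.
  apply: measurable_funeM; apply/measurable_EFinP.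
  apply: (measurableT_comp _ (mFi n)); exact: measurable_expmart.
have mX1 : measurable_fun setT X1 by exact: emeasurable_sum.
have mX2 : measurable_fun setT X2 by exact: emeasurable_sum.
have mX3 : measurable_fun setT X3.
  by apply: emeasurable_sum => n; exact: emeasurable_sum.
have p1 i F : (0 <= (tr ^- 2)%:E * (V i (Fi i F) ^+ 2)%:E)%E.
  by rewrite mule_ge0// lee_fin// sqr_ge0.
have p2 i F : (0 <= (tr ^- 2)%:E * sqI nu (fun s => V i (scons s (shift (Fi i F)))))%E.
  by rewrite mule_ge0// ?lee_fin// sqI_ge0.
have p3 n c F : (0 <= (expR (- kappa))%:E * (expmart nu (v c) V tr n (Fi n F))%:E)%E.
  by rewrite mule_ge0// lee_fin expR_ge0.
have X10 F : (0 <= X1 F)%E by exact: sume_ge0.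
have X20 F : (0 <= X2 F)%E by exact: sume_ge0.
have X30 F : (0 <= X3 F)%E by apply: sume_ge0 => n _; exact: sume_ge0.
exists (fun F => X1 F + X2 F + X3 F)%E; split.
- by apply: emeasurable_funD => //; exact: emeasurable_funD.
- by move=> F; rewrite !adde_ge0.
- have I1 : (\int[mu]_F X1 F = (tr ^- 2)%:E * \sum_(1 <= i < N.+1) sqI mu (V i))%E.
    rewrite ge0_integral_sum// ge0_sume_distrr; last by move=> i _; exact: sqI_ge0.
    apply: eq_bigr => i _; rewrite ge0_integralZl//.
    + by congr (_ * _)%E; exact: (sqI_iter_shift mu_scons _ (mV i)).
    + by apply: measurable_sqE; exact: measurableT_comp (mV i) (mFi i).
    + by move=> F _; rewrite lee_fin sqr_ge0.
  have I2 : (\int[mu]_F X2 F = (tr ^- 2)%:E * \sum_(1 <= i < N.+1) sqI mu (V i))%E.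
    rewrite ge0_integral_sum// ge0_sume_distrr; last by move=> i _; exact: sqI_ge0.
    apply: eq_bigr => i _; rewrite ge0_integralZl//.
    + congr (_ * _)%E; rewrite (sqI_scons mu_scons (mV i)).
      rewrite -(integral_iter_shift (N - i).+1 (measurable_sqI_scons nu (mV i)))//.
      by move=> F; exact: sqI_ge0.
    + apply: (measurableT_comp (measurable_sqI_scons nu (mV i))).
      exact: measurableT_comp (@measurable_shift _ S) (mFi i).
    + by move=> F _; exact: sqI_ge0.
  have I3 : (\int[mu]_F X3 F <= (expR (- kappa) * #|C|%:R * N.+1%:R)%:E)%E.
    rewrite ge0_integral_sum//; last 2 first.
    + by move=> n; exact: emeasurable_sum.
    + by move=> n F _; exact: sume_ge0.
    apply: (@le_trans _ _ (\sum_(n < N.+1) (expR (- kappa) * #|C|%:R)%:E)%E).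
      apply: lee_sum => n _; rewrite ge0_integral_sum//.
      apply: (@le_trans _ _ (\sum_(c : C) (expR (- kappa))%:E)%E); last first.
        by rewrite sumEFin lee_fin sumr_const -[leLHS]mulr_natr.
      apply: lee_sum => c _; rewrite ge0_integralZl//.
      + apply: (@le_trans _ _ ((expR (- kappa))%:E * 1)%E); last by rewrite mule1.
        apply: lee_wpmul2l; first by rewrite lee_fin expR_ge0.
        rewrite (integral_iter_shift (f := EFin \o expmart nu (v c) V tr n)).
        * exact: (integral_expmart mu_scons tr0 (mv c) mV (vV c)).
        * by apply/measurable_EFinP; exact: measurable_expmart.
        * by move=> F; rewrite lee_fin expR_ge0.
      + apply/measurable_EFinP; apply: (measurableT_comp _ (mFi n)).
        exact: measurable_expmart.
      + by move=> F _; rewrite lee_fin expR_ge0.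
    by rewrite sumEFin lee_fin sumr_const card_ord -[leLHS]mulr_natr.
  rewrite ge0_integralD//; last 2 first.
  + by move=> F _; exact: adde_ge0.
  + exact: emeasurable_funD.
  rewrite ge0_integralD// I1 I2; apply: leeD => //.
  rewrite -ge0_muleDl ?lee_fin// -EFinD.
  by apply: lee_wpmul2r; [apply: sume_ge0 => i _; exact: sqI_ge0|rewrite lee_fin; lra].
move=> F XF c n nN.
have h1 : (X1 F <= 1)%E.
  by apply: le_trans XF; rewrite -addeA leeDl// adde_ge0.
have h2 : (X2 F <= 1)%E.
  by apply: le_trans XF; rewrite -addeA addeCA leeDl// adde_ge0.
have h3 : (X3 F <= 1)%E.
  by apply: le_trans XF; rewrite leeDr// adde_ge0.
have FiE i : (1 <= i < n.+1)%N -> iter (n - i) (@shift _ S) (Fi n F) = Fi i F.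
  move=> /andP[_ iN]; rewrite /Fi -iterD; congr (iter _ _ _); lia.
have := @expmart_bound _ S R nu (v c) V tr tr0 (mv c) mV (vV c) n (Fi n F) kappa k0.
rewrite (eq_big_nat _ _ (F2 := fun i => v c i (Fi i F) - trans nu (v c i) (shift (Fi i F)))); last first.
  by move=> i /FiE ->.
apply.
- have : ((expR (- kappa))%:E * (expmart nu (v c) V tr n (Fi n F))%:E <= 1)%E.
    apply: le_trans h3; rewrite /X3.
    apply: (le_trans (le_sume_term (f := fun c => (expR (- kappa))%:E *
      (expmart nu (v c) V tr n (Fi n F))%:E)%E c _)) => //.
    pose g (k : 'I_N.+1) := (\sum_(c : C)
      (expR (- kappa))%:E * (expmart nu (v c) V tr k (Fi k F))%:E)%E.
    apply: (le_sume_term (f := g) (Ordinal (nN : (n < N.+1)%N))) => k.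
    exact: sume_ge0.
  by rewrite -EFinM lee_fin expRN mulrC ler_pdivrMr ?expR_gt0// mul1r.
- move=> i /andP[i1 iN]; rewrite FiE ?i1//.
  have V0 : 0 <= V i (Fi i F) by exact: le_trans (vV c _ _).
  have : ((tr ^- 2)%:E * (V i (Fi i F) ^+ 2)%:E <= 1)%E.
    apply: le_trans h1; rewrite /X1 (bigD1_seq i) ?mem_index_iota ?iota_uniq ?i1 ?ltnS ?(leq_trans iN)//=.
    by rewrite leeDl// sume_ge0.
  rewrite -EFinM lee_fin mulrC ler_pdivrMr ?exprn_gt0// mul1r ler_sqr ?nnegrE// ltW//.
- have : (X2 F <= 1)%E by [].
  rewrite /X2 -ge0_sume_distrr; last by move=> i _; exact: sqI_ge0.
  move=> h.
  apply: (@le_trans _ _ (\sum_(1 <= i < N.+1) sqI nu (fun s => V i (scons s (shift (Fi i F)))))%E).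
    rewrite [leRHS](@big_cat_nat _ _ _ n.+1)//= (eq_big_nat _ _ (F2 := fun i => sqI nu (fun s => V i (scons s (shift (Fi i F)))))); last first.
      by move=> i /FiE ->.
    by rewrite leeDl// sume_ge0// => i _; exact: sqI_ge0.
  have := lee_wpmul2l (_ : 0 <= (tr ^+ 2)%:E)%E h; rewrite lee_fin sqr_ge0 => /(_ isT).
  by rewrite muleA -EFinM mulfV ?sqrf_eq0 ?gt_eqF// mul1e mule1.
Qed.

End mart_majorant.

(** * Conditioning on the past *)

Lemma measurable_seqT_fun dS (S : measurableType dS) (R : realType) (g : (nat -> S) -> R) :
  seq_measurable_fun g -> measurable_fun setT (g : seqT S -> R).
Proof. by move=> mg _ B mB; rewrite setTI; exact: mg. Qed.

Section generated.
Context d (T : measurableType d) dS (S : measurableType dS) (R : realType)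
  (I : eqType) (X : I -> T -> S) (J : set I) (h : nat -> I).
Hypothesis hJ : forall j, J (h j).
Hypothesis Jh : forall i, J i -> exists j, h j = i.

Lemma gen_sigma_fam (A : set T) :
  gen_sigma J X A <-> exists2 B : set (seqT S), measurable B & A = fam X h @^-1` B.
Proof.
split.
- pose Pr := preimage_set_system setT (fam X h) (@measurable _ (seqT S)).
  suff: gen_sigma J X `<=` Pr by move=> /[apply] -[B mB <-]; exists B => //; rewrite setTI.
  apply: smallest_sub; first exact: sigma_algebra_preimage (sigma_algebra_measurable _).
  move=> _ [i Ji [B mB <-]]; have [j ji] := Jh Ji.
  exists ((fun F : seqT S => F j) @^-1` B).
    by rewrite -[X in measurable X]setTI; exact: measurable_coord.
  by rewrite /fam -ji.
- move=> [B mB ->].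
  suff: @measurable _ (seqT S) `<=` [set B | gen_sigma J X (fam X h @^-1` B)] by apply.
  apply: smallest_sub.
    have [s0 sC sU] := smallest_sigma_algebra setT (\bigcup_(j in J) preimage_set_system setT (X j) measurable).
    split.
    - by rewrite /= preimage_set0.
    - move=> A0 /= mA; rewrite setTD preimage_setC -setTD; exact: sC.
    - by move=> F mF /=; rewrite preimage_bigcup; exact: sU.
  move=> _ [j _ [C mC <-]] /=; apply: sub_sigma_algebra; exists (h j) => //.
  by exists C => //.
Qed.

(** [Y] is recovered as the infimum of the rationals [q] with [Y < q], each such event being the
    preimage of a measurable set [B q] of paths. *)
Lemma doob_dynkin (Y : T -> R) : G_measurable (gen_sigma J X) Y ->
  exists2 y : seqT S -> R, measurable_fun setT y & Y = y \o fam X h.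
Proof.
move=> mY.
have H (q : rat) : exists B : set (seqT S), measurable B /\ Y @^-1` `]-oo, ratr q[ = fam X h @^-1` B.
  have /gen_sigma_fam[B mB E] := mY `]-oo, (ratr q : R)[%classic (measurable_itv _).
  by exists B.
have [B HB] := choice H.
pose f (n : nat) (F : seqT S) : \bar R :=
  if unpickle n is Some q then (if F \in B q then (ratr q)%:E else +oo%E) else +oo%E.
have mf n : measurable_fun setT (f n).
  rewrite /f; case: (unpickle n) => [q|]; last exact: measurable_cst.
  apply: measurable_fun_if => //.
  apply: (measurable_fun_bool true); rewrite setTI.
  rewrite (_ : _ @^-1` _ = B q); first by have [] := HB q.
  by apply/seteqP; split => F /=; [move/set_mem|move/mem_set].
exists (fine \o (fun F => einfs (f ^~ F) 0%N)).
  apply: measurableT_comp => //; exact: measurable_fun_einfs.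
apply/funext => w /=.
suff -> : einfs (f ^~ (fam X h w)) 0%N = (Y w)%:E by [].
have key q : (fam X h w \in B q) = (Y w < ratr q).
  have [_ /(congr1 (fun A => A w)) /= E] := HB q.
  apply/idP/idP; rewrite inE => Hw.
    by have := Hw; rewrite -E /= in_itv.
  by have : B q (fam X h w) by rewrite -E /= in_itv.
apply/eqP; rewrite eq_le; apply/andP; split.
- apply/lee_addgt0Pr => e e0.
  have [q /andP[q1 q2]] : exists q, (Y w < ratr q < Y w + e).
    have lt : Y w < Y w + e by rewrite ltrDl.
    have [q] := rat_in_itvoo lt.
    by rewrite in_itv /=; exists q.
  apply: (@le_trans _ _ (ratr q)%:E); last by rewrite -EFinD lee_fin ltW.
  apply: ereal_inf_lbound; exists (pickle q) => //.
  by rewrite /f pickleK key q1.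
- apply: le_ereal_inf_tmp => _ [n _ <-]; rewrite /f; case: (unpickle n) => [q|]; last exact: leey.
  by rewrite key; case: ifP => [|_]; [rewrite lee_fin => /ltW|exact: leey].
Qed.

End generated.

(** * Conditional expectations as powers of the transition operator *)

Section past.
Context d (T : measurableType d) (R : realType) (P : probability T R)
  dS (S : measurableType dS) (eps eps' : int -> T -> S).
Hypothesis iidE : iid P (joint eps eps').

Definition past_ix (i : int) (j : nat) : (int + int)%type := inl (i - j%:Z).

(** The reading order of the coupled past at time 0: [eps'_0] in front, then [eps_(-1)], [eps_(-2)]
    and so on. *)
Definition star_ix (j : nat) : (int + int)%type :=
  if 0 - j%:Z == 0 then inr 0 else inl (0 - j%:Z).

Lemma past_ix_inj i : injective (past_ix i).
Proof. by move=> j k [] /addrI /oppr_inj []. Qed.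

Definition past_law : probability (seqT S) R := distribution P (seqlaw iidE (past_ix 0)).
Definition letter_law : probability S R := distribution P (letterlaw iidE (past_ix 0)).
Let mu := past_law.
Let nu := letter_law.
Let fm := fam (joint eps eps').

Lemma past_scons A : measurable A -> mu A = (mu \x nu)%E (@sconsp _ S @^-1` A).
Proof. exact: (mu_scons iidE (@past_ix_inj 0)). Qed.

Lemma Fpast_fam i w : Fpast eps i w = fm (past_ix i) w. Proof. by []. Qed.

Lemma shift_Fpast i w : shift (Fpast eps i w) = Fpast eps (i - 1) w.
Proof. by apply/funext => j; rewrite /shift /Fpast; congr (eps _ w); lia. Qed.

Lemma iter_shift_Fpast k i w : iter k (@shift _ S) (Fpast eps i w) = Fpast eps (i - k%:Z) w.
Proof.
elim: k => [|k ih]; first by rewrite subr0.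
by rewrite iterS ih shift_Fpast; congr (Fpast eps _ w); lia.
Qed.

Lemma measurable_Fpast i : measurable_fun setT (Fpast eps i : T -> seqT S).
Proof. exact: (measurable_fam iidE (past_ix i)). Qed.

Section injective_index.
Variable h : nat -> (int + int)%type.
Hypothesis injh : injective h.

Let mfm : measurable_fun setT (fm h) := measurable_fam iidE h.

Lemma integral_fam (f : seqT S -> \bar R) (A : set (seqT S)) :
  measurable_fun setT f -> measurable A ->
  (\int[P]_(w in fm h @^-1` A) f (fm h w) = \int[mu]_(F in A) f F)%E.
Proof.
move=> mf mA.
pose mh : {mfun T >-> seqT S} :=
  HB.pack (fm h) (isMeasurableFun.Build _ _ _ _ _ mfm).
have E (g : seqT S -> \bar R) : measurable_fun setT g -> (forall F, (0 <= g F)%E) ->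
    (\int[P]_(w in fm h @^-1` A) g (fm h w) = \int[mu]_(F in A) g F)%E.
  move=> mg g0; rewrite -(ge0_integral_pushforward (measurable_funP mh) P mA)//; last exact: measurable_funTS.
  by apply: eq_measure_integral => B mB _; exact: (fam_law iidE (@past_ix_inj 0) injh mB).
rewrite integralE [RHS]integralE -!E//.
- by congr (_ - _)%E; apply: eq_integral => w _; rewrite ?funeposE ?funenegE.
- exact: measurable_funeneg.
- exact: measurable_funepos.
Qed.

Lemma integral_famT (f : seqT S -> \bar R) : measurable_fun setT f ->
  (\int[P]_w f (fm h w) = \int[mu]_F f F)%E.
Proof. by move=> mf; have := integral_fam mf measurableT; rewrite preimage_setT. Qed.

Lemma integrable_fam (u : seqT S -> R) : measurable_fun setT u ->
  P.-integrable setT (EFin \o (fun w => u (fm h w))) <-> mu.-integrable setT (EFin \o u).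
Proof.
move=> mf.
have E : (\int[P]_w `|(u (fm h w))%:E| = \int[mu]_F `|(u F)%:E|)%E.
  apply: (integral_famT (f := fun F => `|(u F)%:E|%E)).
  by apply: measurableT_comp => //; exact/measurable_EFinP.
split => /integrableP[_ h2]; apply/integrableP; split.
- exact/measurable_EFinP.
- by rewrite -E.
- by apply/measurable_EFinP; exact: measurableT_comp mf mfm.
- by rewrite E.
Qed.

Lemma sqI_fam (u : seqT S -> R) : measurable_fun setT u ->
  sqI P (fun w => u (fm h w)) = sqI mu u.
Proof.
move=> mf; apply: (integral_famT (f := fun F => (u F ^+ 2)%:E)); exact: measurable_sqE.
Qed.

Lemma ae_fam (p : seqT S -> Prop) : {ae mu, forall F, p F} -> {ae P, forall w, p (fm h w)}.
Proof.
move=> [N [mN N0 sub]]; exists (fm h @^-1` N); split.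
- by rewrite -[X in measurable X]setTI; exact: mfm.
- by rewrite (fam_law iidE (@past_ix_inj 0) injh mN).
- by move=> w /=; exact: sub.
Qed.

End injective_index.

(** The defining identity of conditional expectation at lag [k]: an indicator that looks only [k]
    steps back passes unchanged through [k] integrations of the newest letter. *)
Lemma integral_iter_trans_indic k (u : seqT S -> R) (B : set (seqT S)) :
  measurable B -> mu.-integrable setT (EFin \o u) ->
  mu.-integrable setT (EFin \o iter k (trans nu) u) /\
  (\int[mu]_F (u F * \1_B (iter k (@shift _ S) F))%:E =
   \int[mu]_F (iter k (trans nu) u F * \1_B F)%:E)%E.
Proof.
move=> mB; elim: k u => [//|k ih] u iu.
have mE : measurable_fun setT (EFin \o u) by exact: measurable_int iu.
have mf : measurable_fun setT u by exact/measurable_EFinP.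
have [iQ _] := integral_trans past_scons iu.
have [i1 e1] := ih _ iQ; rewrite -iterSr in i1 e1; split => //.
rewrite -e1.
pose v F := u F * \1_B (iter k.+1 (@shift _ S) F).
have mv : measurable_fun setT v.
  apply: measurable_funM => //; apply: (measurableT_comp (f := \1_B : seqT S -> R)); first exact: measurable_indic.
  exact: (measurable_iter_shift k.+1).
have iv : mu.-integrable setT (EFin \o v).
  apply: le_integrable iu => //; first exact/measurable_EFinP.
  move=> F _; rewrite /= lee_fin /v normrM ler_piMr//.
  by rewrite indicE; case: (_ \in _); rewrite ?normr1 ?normr0.
have [_ <-] := integral_trans past_scons iv.
apply: eq_integral => F _; congr (_%:E).
rewrite /trans /v.
under eq_integral do rewrite iterSr shift_scons.
rewrite indicE; case: (_ \in B).
  by rewrite mulr1; congr fine; apply: eq_integral => s _; rewrite mulr1.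
by rewrite mulr0; under eq_integral do rewrite mulr0; rewrite integral0.
Qed.

(** Uniqueness of conditional expectations. The versions supplied by the hypotheses are replaced,
    almost everywhere, by iterates of one explicit operator. *)
Lemma condexp_past (i : int) (k : nat) (u y : seqT S -> R) :
  measurable_fun setT u -> measurable_fun setT y ->
  is_condexp P (sigmaF eps i) (fun w => u (Fpast eps (i + k%:Z) w)) (fun w => y (Fpast eps i w)) ->
  {ae mu, forall F, iter k (trans nu) u F = y F}.
Proof.
move=> mf my [_ iu iy E].
have iu' : mu.-integrable setT (EFin \o u) by apply/(integrable_fam (@past_ix_inj (i + k%:Z))).
have iy' : mu.-integrable setT (EFin \o y) by apply/(integrable_fam (@past_ix_inj i)).
have iQ : mu.-integrable setT (EFin \o iter k (trans nu) u).
  by have [] := integral_iter_trans_indic k measurableT iu'.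
have : ae_eq mu setT (EFin \o iter k (trans nu) u) (EFin \o y).
  apply: integral_ae_eq => //; first exact/measurable_EFinP.
  move=> B _ mB.
  have mB' : measurable (fm (past_ix i) @^-1` B).
    by rewrite -[X in measurable X]setTI; exact: (measurable_fam iidE).
  have Hy : (\int[P]_(w in fm (past_ix i) @^-1` B) (y (Fpast eps i w))%:E = \int[mu]_(F in B) (y F)%:E)%E.
    by apply: (integral_fam (@past_ix_inj i) (f := EFin \o y)) => //; exact/measurable_EFinP.
  rewrite [RHS](_ : _ = \int[mu]_(F in B) (y F)%:E)%E// -Hy -E; last first.
    apply/(@gen_sigma_fam _ _ _ _ _ eps _ (fun j => i - j%:Z)).
    - by move=> j; rewrite /=; lia.
    - by move=> j /= ji; exists `|i - j|%N; lia.
    - by exists B.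
  have indE (v : seqT S -> R) : (\int[mu]_(F in B) (v F)%:E = \int[mu]_F (v F * \1_B F)%:E)%E.
    rewrite integral_mkcond; apply: eq_integral => F _; rewrite patchE indicE.
    by case: (_ \in _); rewrite ?mulr1// mulr0.
  rewrite (indE (iter k (trans nu) u)).
  have [_ <-] := integral_iter_trans_indic k mB iu'.
  rewrite -(integral_famT (@past_ix_inj (i + k%:Z))); last first.
    apply/measurable_EFinP; apply: measurable_funM => //.
    apply: (measurableT_comp (f := \1_B : seqT S -> R)); first exact: measurable_indic.
    exact: measurable_iter_shift.
  rewrite [RHS]integral_mkcond; apply: eq_integral => w _; rewrite patchE indicE.
  rewrite -Fpast_fam iter_shift_Fpast.
  have -> : i + k%:Z - k%:Z = i by lia.
  rewrite (_ : (w \in _) = (Fpast eps i w \in B)).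
    by case: (_ \in _); rewrite ?mulr1// mulr0.
  by apply/idP/idP; rewrite !inE.
by apply: filterS => F /(_ I) [].
Qed.

End past.

(** * Physical dependence *)

Section derivative_version.
Context dS (S : measurableType dS) (R : realType) (u : R -> seqT S -> R).
Hypothesis mu_ : forall s, measurable_fun setT (u s).

(* Measurable in F for every t, and equal to the l-th derivative under [Ck]. *)
Fixpoint hder (l : nat) (t : R) (F : seqT S) : R :=
  if l is l'.+1 then
    fine (limn_esup (fun n => (n.+1%:R * (hder l' (n.+1%:R^-1 + t) F - hder l' t F))%:E))
  else u t F.

Lemma measurable_hder l t : measurable_fun setT (hder l t).
Proof.
elim: l t => [|l ih] t /=; first exact: mu_.
apply: (measurableT_comp (f := @fine R)); first exact: fine_measurable.
apply: measurable_fun_limn_esup => n; apply/measurable_EFinP.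
by apply: measurable_funM => //; apply: measurable_funB.
Qed.

Lemma hderE l t F :
  (forall k, (k < l)%N -> forall s, derivable (derive1n k (fun s => u s F)) s 1) ->
  hder l t F = derive1n l (fun s => u s F) t.
Proof.
elim: l t => [//|l ih] t dl.
have E s : hder l s F = derive1n l (fun s => u s F) s.
  by apply: ih => k kl; apply: dl; exact: ltnW.
rewrite /=; set f := derive1n l _ in E *.
have df : derivable f t 1 by exact: dl.
have cf : n.+1%:R * (f (n.+1%:R^-1 + t) - f t) @[n --> \oo] --> derive1 f t.
  have c1 : h^-1 *: (f (h + t) - f t) @[h --> 0^'] --> derive1 f t.
    have eq : (fun h => h^-1 *: (f (h *: (1 : R) + t) - f t)) =
        (fun h => h^-1 *: (f (h + t) - f t)).
      by apply/funext => h; congr (_ *: (f (_ + _) - _)); rewrite /GRing.scale /= mulr1.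
    by move: df; rewrite /derivable eq.
  have /cvgr_dnbhsP/(_ (fun n => n.+1%:R^-1)) := c1.
  have h0 : (forall n, n.+1%:R^-1 != 0 :> R) /\ (n.+1%:R^-1 : R) @[n --> \oo] --> 0.
    by split; [move=> n; rewrite invr_eq0 pnatr_eq0|exact: cvg_harmonic].
  by move=> /(_ h0); apply: cvg_trans; apply: near_eq_cvg; apply: nearW => n; rewrite invrK.
have : (n.+1%:R * (hder l (n.+1%:R^-1 + t) F - hder l t F))%:E @[n --> \oo] --> (derive1 f t)%:E.
  apply: cvg_EFin; first exact: nearW.
  apply: cvg_trans cf; apply: near_eq_cvg; apply: nearW => n /=; by rewrite !E.
by move=> /cvg_limn_einf_sup[_ ->].
Qed.

End derivative_version.

Section summable_dependence.
Context d (T : measurableType d) (R : realType) (P : probability T R)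
  dS (S : measurableType dS) (eps eps' : int -> T -> S).
Hypothesis iidE : iid P (joint eps eps').
Let mu := past_law iidE.
Let nu := letter_law iidE.
Let Q := trans nu.

Lemma ae_shift (p : seqT S -> Prop) : {ae mu, forall F, p F} -> {ae mu, forall F, p (shift F)}.
Proof.
move=> [N [mN N0 sub]]; exists ((@shift _ S : seqT S -> seqT S) @^-1` N); split.
- by rewrite -[X in measurable X]setTI; exact: measurable_shift.
- have mI : measurable_fun setT (fun F : seqT S => (\1_N F : R)%:E).
    by apply/measurable_EFinP; exact: measurable_indic.
  have I0 F : (0 <= (\1_N F : R)%:E)%E by rewrite lee_fin.
  have mN' : measurable ((@shift _ S : seqT S -> seqT S) @^-1` N).
    by rewrite -[X in measurable X]setTI; exact: measurable_shift.
  rewrite -[X in mu X]setIT -integral_indic//.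
  rewrite (integral_shift (past_scons iidE) mI I0) integral_indic// setIT.
  exact: N0.
- by move=> F /= nF; exact: sub.
Qed.

Lemma mdiff_ae_eq (u v : seqT S -> R) : measurable_fun setT u -> measurable_fun setT v ->
  {ae mu, forall F, u F = v F} -> {ae mu, forall F, mdiff nu u F = mdiff nu v F}.
Proof.
move=> mf mg uv; have := ae_shift (trans_ae_eq (past_scons iidE) mf mg uv).
by apply: filterS2 uv => F; rewrite /mdiff => -> ->.
Qed.

Lemma iter_trans_cst k (c : R) : iter k Q (cst c) = cst c.
Proof.
elim: k => [//|k /= ->]; apply/funext => F; rewrite /Q /trans /=.
by rewrite (integral1 nu c).
Qed.

(** (A6) in the form that is used, with projections in place of couplings. A single [delta] serves
    all [|t| <= e0], so that different times may use different arguments. *)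
Definition summable_dep (e0 : R) (u : R -> seqT S -> R) (Delta : R) : Prop :=
  [/\ forall t, measurable_fun setT (u t),
      forall t, `|t| <= e0 -> (sqI mu (u t) < +oo)%E &
      exists delta : nat -> R, [/\ forall k, 0 <= delta k,
        forall K, \sum_(k < K) delta k <= Delta &
        forall t k, `|t| <= e0 ->
          (sqI mu (mdiff nu (iter k Q (u t))) <= ((delta k) ^+ 2)%:E)%E]].

Definition past_mean (u : seqT S -> R) : R := fine (\int[mu]_F (u F)%:E)%E.

Lemma sqI_block_le e0 u Delta c o n (a tau : nat -> R) : summable_dep e0 u Delta ->
  (forall i, (o < i <= o + n)%N -> `|tau i| <= e0) ->
  (sqI P (fun w => block (fun i => a i *
      (u (tau i) (Fpast eps (i%:Z - c) w) - past_mean (u (tau i))))%R o n) <=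
   (block (fun i => Delta ^+ 2 * a i ^+ 2)%R o n)%:E)%E.
Proof.
move=> [mu_ uoo [delta [d0 dD Hd]]] tau0.
(* Zero weights up to [o] turn the block into a [lag_sum] started at 1. *)
pose a' i := if (o < i)%N then a i else 0.
(* Centred, so that the zero-one law removes the remainder; the coefficient [1] fits the form of
   [iter_trans_lin_ae]. *)
pose D i F := 1 * u (tau i) F + cst (- past_mean (u (tau i))) F.
have mD i : measurable_fun setT (D i).
  by apply: measurable_funD => //; exact: measurable_funM.
have E w : block (fun i => a i * (u (tau i) (Fpast eps (i%:Z - c) w) - past_mean (u (tau i)))) o n =
    lag_sum a' D (o + n) (Fpast eps ((o + n)%:Z - c) w).
  rewrite /lag_sum (@big_cat_nat _ _ _ o.+1)//=; last by rewrite ltnS leq_addr.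
  rewrite [X in _ = X + _]big1_seq ?add0r; last first.
    by move=> i /andP[_]; rewrite mem_index_iota ltnS /a' => /andP[_ io]; rewrite ltnNge io mul0r.
  apply: eq_big_nat => i /andP[oi ion]; rewrite /a' oi iter_shift_Fpast /D mul1r.
  by congr (_ * (u _ (Fpast eps _ w) - _)); lia.
rewrite (_ : (fun w => _) = (fun w => lag_sum a' D (o + n) (Fpast eps ((o + n)%:Z - c) w))); last exact/funext.
rewrite (sqI_fam iidE (@past_ix_inj ((o + n)%:Z - c)) (u := lag_sum a' D (o + n))); last exact: measurable_lag_sum.
have range i : a' i != 0 -> (1 <= i <= o + n)%N -> `|tau i| <= e0.
  by rewrite /a'; case: ltnP => [oi _ /andP[_ ?]|]; [apply: tau0; rewrite oi|rewrite eqxx].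
have L2u i : `|tau i| <= e0 -> L2 mu (u (tau i)) by move=> ti; split => //; exact: uoo.
have aeD i k : `|tau i| <= e0 ->
    {ae mu, forall F, iter k Q (D i) F = iter k Q (u (tau i)) F - past_mean (u (tau i))}.
  move=> ti; have := iter_trans_lin_ae (past_scons iidE) k 1 (L2u i ti) (L2_cst mu (- past_mean (u (tau i)))).
  by apply: filterS => F ->; rewrite mul1r iter_trans_cst.
apply: le_trans (sqI_lag_sum_le (past_scons iidE) mD d0 dD _ _) _.
- move=> i k i1 ai; have ti := range i ai i1.
  apply: le_trans (Hd _ k ti).
  rewrite (sqI_ae_eq (g := mdiff nu (iter k Q (u (tau i)))))//.
  + by apply: measurable_mdiff; exact: measurable_iter_trans.
  + by apply: measurable_mdiff; exact: measurable_iter_trans.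
  + have := ae_shift (aeD i k.+1 ti); apply: filterS2 (aeD i k ti) => F; rewrite /mdiff => h1 h2.
    rewrite -/Q -[Q _ _]/(iter k.+1 Q (D i) (shift F)) -[in RHS]/(iter k.+1 Q _ (shift F)) h1 h2.
    by rewrite opprB addrA subrK.
- move=> i e i1 ai e0'; have ti := range i ai i1.
  apply: (zero_one (past_scons iidE)) => //.
  + by apply: L2_lin; [exact: L2u|exact: L2_cst].
  + have iu := L2_integrable (L2u i ti).
    have ic : mu.-integrable setT (EFin \o cst (- past_mean (u (tau i)))).
      exact: finite_measure_integrable_cst.
    under eq_integral do rewrite /D mul1r EFinD.
    rewrite integralD_EFin//.
    have fi : (\int[mu]_F (u (tau i) F)%:E)%E \is a fin_num.
      exact: (integrable_fin_num measurableT iu).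
    by rewrite (integral1 mu (- past_mean (u (tau i)))) EFinN /past_mean fineK// subee.
- rewrite lee_fin mulr_sumr /block (@big_cat_nat _ _ _ o.+1)//=; last by rewrite ltnS leq_addr.
  rewrite big1_seq ?add0r; last first.
    by move=> i /andP[_]; rewrite mem_index_iota ltnS /a' => /andP[_ io]; rewrite ltnNge io expr0n mulr0.
  rewrite le_eqVlt; apply/orP; left; apply/eqP/eq_big_nat => i /andP[oi _].
  by rewrite /a' oi.
Qed.

(* Y* does not involve eps_0, and among such variables the best approximation of
   E[u(F_k) | F_0] is E[u(F_k) | F_{-1}]. *)
Lemma coupling_bound k (u : seqT S -> R) (Y Ys : T -> R) : measurable_fun setT u ->
  is_condexp P (sigmaF eps 0) (fun w => u (Fpast eps k%:Z w)) Y ->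
  G_measurable (sigmaF0star eps eps') Ys ->
  (sqI mu (mdiff nu (iter k Q u)) <= sqI P (fun w => Y w - Ys w)%R)%E.
Proof.
move=> mf cY mYs.
have [y my YE] : exists2 y : seqT S -> R, measurable_fun setT y & Y = y \o Fpast eps 0.
  have [mY _ _ _] := cY.
  apply: (@doob_dynkin _ _ _ _ _ _ _ _ (fun j => 0 - j%:Z) _ _ Y mY).
  - by move=> j /=; lia.
  - by move=> j /= ji; exists `|j|%N; lia.
have [c mc YsE] : exists2 c : seqT S -> R, measurable_fun setT c & Ys = c \o fam (joint eps eps') star_ix.
  apply: (@doob_dynkin _ _ _ _ _ _ _ _ star_ix _ _ Ys mYs).
  - by move=> [|j].
  - move=> [i|i] /= i0; last by exists 0%N; rewrite (eqP i0).
    by exists `|i|%N; rewrite /star_ix; case: eqP => [|_]; [lia|congr inl; lia].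
have yk : {ae mu, forall F, iter k Q u F = y F}.
  by apply: (condexp_past iidE mf my (i := 0)); rewrite add0r; move: cY; rewrite YE.
have mk : measurable_fun setT (iter k Q u) by exact: measurable_iter_trans.
rewrite (sqI_ae_eq (measurable_mdiff nu mk) (measurable_mdiff nu my) (mdiff_ae_eq mk my yk)).
apply: (le_trans (sqI_mdiff_best (past_scons iidE) my mc)).
(* A path holding [eps_0] in front of the coupled past [eps'_0, eps_(-1), ...]. It is injective,
   hence of law [mu], and its newest letter is independent of what [c] reads. *)
pose h j : (int + int)%type := if j is j'.+1 then star_ix j' else inl 0.
have injh : injective h.
  by move=> [|[|i]] [|[|j]] //= []; rewrite /star_ix /=; [lia| ..].
pose f (F : seqT S) := ((y (scons (F 0%N) (shift (shift F))) - c (shift F)) ^+ 2)%:E.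
have mff : measurable_fun setT f.
  have ms2 : measurable_fun setT (fun F : seqT S => scons (F 0%N) (shift (shift F)) : seqT S).
    apply: measurable_fun_seqT => -[|j]; exact: measurable_coord.
  apply: measurable_sqE; apply: measurable_funB.
    exact: measurableT_comp my ms2.
  exact: measurableT_comp mc (@measurable_shift _ S).
have -> : (sqI P (fun w => Y w - Ys w)%R = \int[P]_w f (fam (joint eps eps') h w))%E.
  apply: eq_integral => w _; rewrite YE YsE /f /=; congr ((_ - _) ^+ 2)%:E.
  congr y; apply/funext => -[|j]; rewrite /Fpast /scons /shift /fam /h /=; first by rewrite subr0.
  by [].

rewrite (integral_famT iidE injh mff) (tonelli_scons (past_scons iidE) mff)//.
by move=> F; rewrite lee_fin sqr_ge0.
Qed.

(** By the coupling bound the suprema in (A6) can serve as [delta], and their series as [Delta]. The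
    derivative is replaced by [hder], which equals it on the paths of the process. *)
Lemma summable_dep_psi1 (psi1 : R -> (nat -> S) -> R) (l : nat) (e0 : R) :
  (forall s, seq_measurable_fun (psi1 s)) ->
  (forall (i : int) w, Ck l (fun s => psi1 s (Fpast eps i w))) -> 0 < e0 ->
  (forall i : int, (ereal_sup [set Lnorm P 2%:E (fun w =>
     (derive1n l (fun s => psi1 s (Fpast eps i w)) ep)%:E) | ep in
     [set ep : R | (`|ep| <= e0)%R]] < +oo)%E) ->
  (exists Y Ys : nat -> R -> T -> R,
   (forall (i : nat) (ep : R), `|ep| <= e0 ->
     is_condexp P (sigmaF eps 0)
       (fun w => derive1n l (fun s => psi1 s (Fpast eps i%:Z w)) ep) (Y i ep) /\
     is_condexp P (sigmaF0star eps eps')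
       (fun w => derive1n l (fun s => psi1 s (Fstar eps eps' i%:Z w)) ep)
       (Ys i ep)) /\
   (\sum_(0 <= i <oo) ereal_sup [set Lnorm P 2%:E (fun w =>
      (Y i ep w - Ys i ep w)%:E) | ep in [set ep : R | (`|ep| <= e0)%R]] < +oo)%E) ->
  exists Delta, summable_dep e0 (hder psi1 l) Delta.
Proof.
move=> mpsi1 Cl e00 bd [Y [Ys [cY sY]]].
have mp1 s : measurable_fun setT (psi1 s : seqT S -> R) by exact: measurable_seqT_fun.
have hE i t w : hder psi1 l t (Fpast eps i w) = derive1n l (fun s => psi1 s (Fpast eps i w)) t.
  by apply: hderE; have [] := Cl i w.
pose sp k := ereal_sup [set Lnorm P 2%:E (fun w =>
      (Y k ep w - Ys k ep w)%:E) | ep in [set ep : R | (`|ep| <= e0)%R]].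
have sp0 k : (0 <= sp k)%E.
  apply: (@le_trans _ _ (Lnorm P 2%:E (fun w => (Y k 0 w - Ys k 0 w)%:E))); first exact: Lnorm_ge0.
  by apply: ereal_sup_ubound; exists 0 => //=; rewrite normr0 ltW.
have psum K : (\sum_(0 <= k < K) sp k <= \sum_(0 <= k <oo) sp k)%E.
  exact: nneseries_lim_ge.
have spfin k : sp k \is a fin_num.
  rewrite ge0_fin_numE//; apply: le_lt_trans sY; apply: le_trans (psum k.+1).
  by rewrite big_nat_recr//= leeDr// sume_ge0.
have serfin : (\sum_(0 <= k <oo) sp k)%E \is a fin_num.
  by rewrite ge0_fin_numE ?nneseries_ge0.
exists (fine (\sum_(0 <= k <oo) sp k)%E); split.
- by move=> t; exact: measurable_hder.
- move=> t t0.
  rewrite -(sqI_fam iidE (@past_ix_inj 0) (measurable_hder mp1 l t)).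
  have : (Lnorm P 2%:E (fun w => (derive1n l (fun s => psi1 s (Fpast eps 0 w)) t)%:E) < +oo)%E.
    by apply: le_lt_trans (bd 0); apply: ereal_sup_ubound; exists t.
  rewrite (_ : (fun w => (derive1n l _ t)%:E) = EFin \o (fun w => hder psi1 l t (Fpast eps 0 w))); last first.
    by apply/funext => w /=; rewrite hE.
  move=> h; rewrite -nrmM; rewrite -/(nrm P _) in h.
  rewrite -/(Fpast eps 0).
  have K (y : \bar R) : (0 <= y -> y < +oo -> y * y < +oo)%E.
    by case: y => // r _ _; rewrite -EFinM ltry.
  by apply: (K _ _ h); exact: nrm_ge0.
- exists (fun k => fine (sp k)); split.
  + by move=> k; exact: fine_ge0.
  + move=> K; rewrite -lee_fin fineK// -sumEFin; apply: le_trans (psum K).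
    by rewrite big_mkord; apply: lee_sum => k _; rewrite fineK.
  + move=> t k t0; have [cY1 [mYs _ _ _]] := cY k t t0.
    apply: (@le_trans _ _ (sqI P (fun w => Y k t w - Ys k t w)%R)).
      apply: coupling_bound => //; first exact: measurable_hder.
      by move: cY1; under eq_fun do rewrite -hE.
    rewrite -nrm_le ?fine_ge0// fineK//.
    by apply: ereal_sup_ubound; exists t.
Qed.

End summable_dependence.

(** * Maximal inequalities under physical dependence *)

Section square_probability.
Context d (T : measurableType d) (R : realType) (P : probability T R).

Let PP : set (T * T) -> \bar R := (P \x P)%E.

Let PP_setT : PP setT = 1%E.
Proof.
rewrite /PP -setXTT product_measure1E//; transitivity (1 * 1 : \bar R)%E; last by rewrite mule1.
by congr (_ * _)%E; exact: probability_setT.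
Qed.

(** Two independent copies: differences between them are symmetric, and differentiable wherever each
    copy is. *)
Definition square_prob : probability (T * T)%type R :=
  HB.pack (P \x P)%E (Measure_isProbability.Build _ _ _ (P \x P)%E PP_setT).

Lemma sqI_fst (f : T -> R) : measurable_fun setT f ->
  sqI square_prob (fun z => f z.1) = sqI P f.
Proof.
move=> mf; rewrite /sqI.
rewrite (@fubini_tonelli1 _ _ _ _ _ P P (fun z => (f z.1 ^+ 2)%:E))//=.
- by apply: eq_integral => w _; rewrite /fubini_F /= (integral1 P (f w ^+ 2)).
- by apply: measurable_sqE; exact: measurableT_comp mf measurable_fst.
- by move=> z; rewrite lee_fin sqr_ge0.
Qed.

Lemma sqI_snd (f : T -> R) : measurable_fun setT f ->
  sqI square_prob (fun z => f z.2) = sqI P f.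
Proof.
move=> mf; rewrite /sqI.
rewrite (@fubini_tonelli2 _ _ _ _ _ P P (fun z => (f z.2 ^+ 2)%:E))//=.
- by apply: eq_integral => w _; rewrite /fubini_G /= (integral1 P (f w ^+ 2)).
- by apply: measurable_sqE; exact: measurableT_comp mf measurable_snd.
- by move=> z; rewrite lee_fin sqr_ge0.
Qed.

Lemma sqI_sub_le (f : T -> R) : measurable_fun setT f ->
  (sqI square_prob (fun z => f z.1 - f z.2)%R <= 4%:E * sqI P f)%E.
Proof.
move=> mf.
have m1 : measurable_fun setT (fun z : T * T => f z.1) by exact: measurableT_comp mf measurable_fst.
have m2 : measurable_fun setT (fun z : T * T => - f z.2).
  by apply: measurable_funN; exact: measurableT_comp mf measurable_snd.
apply: (le_trans (sqID square_prob m1 m2)).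
rewrite (_ : sqI square_prob (fun z => - f z.2) = sqI square_prob (fun z => f z.2)); last first.
  by rewrite /sqI; under eq_integral do rewrite sqrrN.
rewrite sqI_fst// sqI_snd//; move: (sqI_ge0 P f); move: (sqI P f) => y y0.
by rewrite -ge0_muleDl// -EFinD; apply: lee_wpmul2r => //; rewrite lee_fin; lra.
Qed.

Lemma measurable_snd_integral (U : T * T -> \bar R) : measurable_fun setT U ->
  (forall z, (0 <= U z)%E) -> measurable_fun setT (fun w => \int[P]_w' U (w, w'))%E.
Proof. by move=> mU U0; exact: (@measurable_fun_fubini_tonelli_F _ _ _ _ _ P U). Qed.

Lemma integral_square (U : T * T -> \bar R) : measurable_fun setT U ->
  (forall z, (0 <= U z)%E) ->
  (\int[square_prob]_z U z = \int[P]_w \int[P]_w' U (w, w'))%E.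
Proof. by move=> mU U0; rewrite (@fubini_tonelli1 _ _ _ _ _ P P U). Qed.

End square_probability.

Section integral_block.
Context d (T : measurableType d) (R : realType) (P : probability T R).

Lemma integral_block (Z : nat -> T -> R) n :
  (forall i, (0 < i <= n)%N -> P.-integrable setT (EFin \o Z i)) ->
  P.-integrable setT (EFin \o (fun w => block (fun i => Z i w) 0 n)) /\
  fine (\int[P]_w (block (fun i => Z i w) 0 n)%:E)%E =
  block (fun i => fine (\int[P]_w (Z i w)%:E)%E) 0 n.
Proof.
elim: n => [|n ih] iZ.
  rewrite block0 (_ : (fun w => block _ 0 0) = cst 0); last first.
    by apply/funext => w; rewrite block0.
  split; first exact: finite_measure_integrable_cst.
  under eq_integral do rewrite block0.
  by rewrite integral0.
have [|i1 e1] := ih.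
  by move=> i /andP[i0 i_n]; apply: iZ; rewrite i0 leqW.
have {}iZ : P.-integrable setT (EFin \o Z n.+1) by apply: iZ; rewrite ltnSn.
have BE z : block z 0 n.+1 = block z 0 n + z n.+1 :> R by rewrite -[in LHS]addn1 blockD block1.
rewrite (_ : (fun w => block _ 0 n.+1) = (fun w => block (fun i => Z i w) 0 n + Z n.+1 w)); last first.
  by apply/funext => w; exact: BE.
split; first by have := integrableD measurableT i1 iZ.
under eq_integral do rewrite BE.
by rewrite [RHS]BE -e1; exact: (RintegralD measurableT i1 iZ).
Qed.

End integral_block.

(** * The smooth part over a box, and the score at zero *)

Section smooth_part.
Context d (T : measurableType d) (R : realType) (P : probability T R)
  dS (S : measurableType dS) (eps eps' : int -> T -> S).
Hypothesis iidE : iid P (joint eps eps').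
Let mu := past_law iidE.
Let nu := letter_law iidE.
Local Notation mean := (past_mean iidE).

Lemma integral_past_mean (u : seqT S -> R) i : measurable_fun setT u ->
  fine (\int[P]_w (u (Fpast eps i w))%:E)%E = mean u.
Proof.
move=> mf; congr fine; apply: (integral_famT iidE (@past_ix_inj i) (f := EFin \o u)).
exact/measurable_EFinP.
Qed.

(** The box argument is run on the difference of two independent copies, which needs no derivative
    of the mean. In [C] the [4] is the price of symmetrisation, and the sum over [l] replaces a
    maximum over the orders of derivative. *)
Lemma smooth_majorant (psi1 : R -> (nat -> S) -> R) (L : nat) (e0 b : R)
    (Delta : nat -> R) (x : nat -> nat -> R) k (a : nat -> R) :
  (forall s, seq_measurable_fun (psi1 s)) -> 0 <= e0 -> 0 <= b ->
  (forall l (i : int) w, (l <= L)%N -> Ck l (fun s => psi1 s (Fpast eps i w))) ->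
  (forall l, (l <= L)%N -> summable_dep iidE e0 (hder psi1 l) (Delta l)) ->
  (forall i, (0 < i <= 2 ^ k)%N -> b * absx x L i <= e0) ->
  let C := 4 * \sum_(l < L.+1) Delta l ^+ 2 in
  exists V : T -> \bar R, [/\ measurable_fun setT V, (forall w, (0 <= V w)%E),
    (\int[P]_w V w <= (L%:R * (4 * b ^+ 2 *
       (Kcst e0 ^+ L * \sum_(j < L) cost C k (fun i => a i * x i j)%R)))%:E)%E &
    forall w beta n, (forall j, (j < L)%N -> `|beta j| <= b) -> (n <= 2 ^ k)%N ->
      ((block (fun i => a i *
         ((psi1 (- shiftx x L i beta) (Fpast eps (i%:Z - 1) w) - psi1 0 (Fpast eps (i%:Z - 1) w)) -
          (mean (psi1 (- shiftx x L i beta)) - mean (psi1 0)))) 0 n ^+ 2)%:E <= V w)%E].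
Proof.
move=> mpsi e00 b0 Cpsi sd Hx C.
have mp1 s : measurable_fun setT (psi1 s : seqT S -> R) by exact: measurable_seqT_fun.
have hE l i t w : (l <= L)%N ->
    hder psi1 l t (Fpast eps i w) = derive1n l (fun s => psi1 s (Fpast eps i w)) t.
  by move=> lL; apply: hderE; have [] := Cpsi l i w lL.
pose H l (i : nat) t (z : T * T) :=
  hder psi1 l t (Fpast eps (i%:Z - 1) z.1) - hder psi1 l t (Fpast eps (i%:Z - 1) z.2).
have mh l i t : measurable_fun setT (fun w => hder psi1 l t (Fpast eps i w)).
  exact: measurableT_comp (measurable_hder mp1 l t) (measurable_Fpast iidE i).
have mH l i t : measurable_fun setT (H l i t).
  by apply: measurable_funB;
    [exact: measurableT_comp (mh _ _ _) measurable_fst|exact: measurableT_comp (mh _ _ _) measurable_snd].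
have dh l i w t : (l < L)%N ->
    is_derive t (1:R) (fun t => hder psi1 l t (Fpast eps i w)) (hder psi1 l.+1 t (Fpast eps i w)).
  move=> lL; rewrite hE// (_ : (fun t => hder psi1 l t (Fpast eps i w)) = derive1n l (fun s => psi1 s (Fpast eps i w))); last first.
    by apply/funext => s; rewrite hE// ltnW.
  have [dl _] := Cpsi l.+1 i w lL.
  by apply: DeriveDef; [exact: dl|rewrite derive1nS derive1E].
have dH l i z t : (l < L)%N -> is_derive t (1:R) (fun t => H l i t z) (H l.+1 i t z).
  by move=> lL; apply: is_deriveB; exact: dh.
have ch l i w : (l <= L)%N -> continuous (fun t => hder psi1 l t (Fpast eps i w)).
  move=> lL; rewrite (_ : (fun t => hder psi1 l t (Fpast eps i w)) = derive1n l (fun s => psi1 s (Fpast eps i w))); last first.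
    by apply/funext => s; rewrite hE.
  by have [] := Cpsi l i w lL.
have cH l i z : (l <= L)%N -> continuous (fun t => H l i t z).
  by move=> lL t; apply: continuousB; exact: ch.
have C0 : 0 <= C by rewrite mulr_ge0// sumr_ge0// => l _; exact: sqr_ge0.
have H2 l o n a' tau : (l <= L)%N -> (forall i, (o < i <= o + n)%N -> `|tau i| <= e0) ->
  (sqI (square_prob P) (fun w => block (fun i => a' i * H l i (tau i) w)%R o n) <=
   (block (fun i => C * a' i ^+ 2)%R o n)%:E)%E.
  move=> lL ti.
  pose f w := block (fun i => a' i * (hder psi1 l (tau i) (Fpast eps (i%:Z - 1) w) - mean (hder psi1 l (tau i)))) o n.
  rewrite (_ : (fun w => block _ o n) = fun z => f z.1 - f z.2); last first.
    apply/funext => z; rewrite /f /block -sumrB; apply: eq_bigr => i _.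
    by rewrite -mulrBr /H; congr (_ * _); ring.
  apply: le_trans (sqI_sub_le P _) _.
    by apply: measurable_block => i; apply: measurable_funM => //; apply: measurable_funB.
  apply: (@le_trans _ _ (4%:E * (block (fun i => Delta l ^+ 2 * a' i ^+ 2)%R o n)%:E)%E).
    by apply: lee_wpmul2l => //; exact: (sqI_block_le 1 a' (sd l lL) ti).
  rewrite -EFinM lee_fin /block mulr_sumr; apply: ler_sum => i _.
  rewrite mulrA; apply: ler_wpM2r; first exact: sqr_ge0.
  apply: ler_wpM2l => //; have lL' : (l < L.+1)%N by [].
  rewrite (bigD1 (Ordinal lL'))//= lerDl sumr_ge0// => j _; exact: sqr_ge0.
have [U [mU U0 IU HU]] := box_increment_majorant (x := x) e00 C0 b0 mH dH cH H2 a (leqnn L) Hx.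
exists (fun w => \int[P]_w' U (w, w'))%E; split.
- exact: measurable_snd_integral.
- by move=> w; apply: integral_ge0.
- by rewrite -integral_square.
move=> w beta n beta_b n2.
pose g w := block (fun i => a i *
   (psi1 (- shiftx x L i beta) (Fpast eps (i%:Z - 1) w) - psi1 0 (Fpast eps (i%:Z - 1) w))) 0 n.
have mg : measurable_fun setT g.
  apply: measurable_block => i; apply: measurable_funM => //.
  by apply: measurable_funB; exact: (mh 0%N).
have e0i i : (0 < i <= n)%N -> `|- shiftx x L i beta| <= e0.
  move=> /andP[i0 i_n]; apply: le_trans (Hx i _); last by rewrite i0 (leq_trans i_n).
  rewrite normrN /absx mulr_sumr; apply: (le_trans (ler_norm_sum _ _ _)).
  apply: ler_sum => j _; rewrite normrM mulrC; apply: ler_wpM2r => //.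
  exact: beta_b.
have iP t i : `|t| <= e0 -> P.-integrable setT (EFin \o (fun w => psi1 t (Fpast eps i w))).
  move=> t0; apply/(integrable_fam iidE (@past_ix_inj i) (u := psi1 t)) => //.
  have [_ + _] := sd 0%N (leq0n L); move=> /(_ t t0) oo.
  by apply: sqI_integrable.
have meang : fine (\int[P]_w (g w)%:E)%E = block (fun i => a i *
     (mean (psi1 (- shiftx x L i beta)) - mean (psi1 0))) 0 n.
  rewrite /g /block.
  have t0 : `|(0:R)| <= e0 by rewrite normr0.
  have ig i : (1 <= i < n.+1)%N -> P.-integrable setT (EFin \o (fun w => a i *
   (psi1 (- shiftx x L i beta) (Fpast eps (i%:Z - 1) w) - psi1 0 (Fpast eps (i%:Z - 1) w)))).
    move=> i1; have iB := integrableB measurableT (iP _ (i%:Z - 1) (e0i i i1)) (iP _ (i%:Z - 1) t0).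
    by have := integrableZl measurableT (a i) iB.
  have [_ ->] := integral_block ig; apply: eq_big_nat => i i1.
  rewrite -(integral_past_mean (i%:Z - 1) (mp1 (- shiftx x L i beta))).
  rewrite -(integral_past_mean (i%:Z - 1) (mp1 0)).
  have iB := integrableB measurableT (iP _ (i%:Z - 1) (e0i i i1)) (iP _ (i%:Z - 1) t0).
  transitivity (a i * fine (\int[P]_w0 (psi1 (- shiftx x L i beta) (Fpast eps (i%:Z - 1) w0) -
      psi1 0 (Fpast eps (i%:Z - 1) w0))%:E)%E); first exact: (RintegralZl (a i) measurableT iB).
  congr (_ * _).
  exact: (RintegralB measurableT (iP _ (i%:Z - 1) (e0i i i1)) (iP _ (i%:Z - 1) t0)).
rewrite (_ : block _ 0 n = g w - fine (\int[P]_w (g w)%:E)%E); last first.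
  by rewrite meang /g /block -sumrB; apply: eq_bigr => i _; rewrite mulrBr.
(* Jensen in the second copy: the squared distance of [g w] to the mean of [g] is at most the mean
   of the squared difference of the copies. *)
rewrite -sqrrN opprB; apply: (le_trans (mean_shift_sq_le P (g w) mg)).
apply: ge0_le_integral => //.
- by move=> w' _; rewrite lee_fin sqr_ge0.
- by apply: measurable_sqE; exact: measurable_funB.
- exact: measurableT_comp mU (pair1_measurable w).
move=> w' _; have := HU (w, w') beta n beta_b n2.
rewrite (_ : _ - _ = g w - g w'); first by rewrite -sqrrN opprB.
rewrite /g /boxsum /block -!sumrB; apply: eq_bigr => i _.
have -> : shiftx x 0 i beta = 0 by rewrite /shiftx big_ord0.
rewrite /H /= !sub0r oppr0; ring.
Qed.

(* Since Q v = u 0, the coefficient of v at lag k + 1 is that of u 0 at lag k. *)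
Lemma summable_dep_root (v : seqT S -> R) (e0 : R) (u : R -> seqT S -> R) (Delta : R) :
  0 <= e0 -> summable_dep iidE e0 u Delta -> measurable_fun setT v ->
  (sqI mu v < +oo)%E -> {ae mu, forall F, trans nu v F = u 0 F} ->
  exists Delta', summable_dep iidE e0 (fun=> v) Delta'.
Proof.
move=> e00 [mu_ uoo [delta [d0 dD Hd]]] mv voo vu.
have md : measurable_fun setT (mdiff nu v) by exact: measurable_mdiff.
have mtv : measurable_fun setT (trans nu v) by exact: measurable_trans.
have doo : (sqI mu (mdiff nu v) < +oo)%E.
  have m2 : measurable_fun setT (fun F : seqT S => - trans nu v (shift F)).
    by apply: measurable_funN; exact: measurableT_comp mtv (@measurable_shift _ S).
  apply: le_lt_trans (sqID mu mv m2) _.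
  rewrite (_ : sqI mu (fun F => - trans nu v (shift F)) = sqI mu (trans nu v)); last first.
    rewrite -[RHS](sqI_shift (past_scons iidE) mtv).
    by rewrite /sqI; under eq_integral do rewrite sqrrN.
  have too := le_lt_trans (sqI_trans_le (past_scons iidE) mv) voo.
  by rewrite lte_add_pinfty// lte_mul_pinfty.
pose r := Num.sqrt (fine (sqI mu (mdiff nu v))).
have r2 : (sqI mu (mdiff nu v) <= (r ^+ 2)%:E)%E.
  rewrite sqr_sqrtr ?fine_ge0 ?sqI_ge0// fineK// ge0_fin_numE ?sqI_ge0//.
exists (r + Delta); split => //.
exists (fun k => if k is k'.+1 then delta k' else r); split.
- by move=> [|k]; rewrite ?sqrtr_ge0.
- move=> [|K]; first by rewrite big_ord0 addr_ge0 ?sqrtr_ge0//; have := dD 0%N; rewrite big_ord0.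
  by rewrite big_ord_recl lerD2l; apply: dD.
- move=> t [|k] t0; first exact: r2.
  have z0 : `|(0:R)| <= e0 by rewrite normr0.
  apply: le_trans (Hd 0 k z0).
  have aek : {ae mu, forall F, iter k.+1 (trans nu) v F = iter k (trans nu) (u 0) F}.
    elim: k => [|k ih]; first exact: vu.
    by apply: (trans_ae_eq (past_scons iidE)) ih; exact: measurable_iter_trans.
  rewrite (sqI_ae_eq _ _ (mdiff_ae_eq _ _ aek))//.
  all: try apply: measurable_mdiff; exact: measurable_iter_trans.
Qed.

(** At [beta = 0] there is no box to cover, so the dyadic maximal inequality alone suffices and only
    time is maximised. *)
Lemma score_majorant (v : seqT S -> R) (e0 Delta : R) k (a : nat -> R) :
  0 <= e0 -> summable_dep iidE e0 (fun=> v) Delta ->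
  exists V : T -> \bar R, [/\ measurable_fun setT V, (forall w, (0 <= V w)%E),
    (\int[P]_w V w <= (cost (Delta ^+ 2) k a)%:E)%E &
    forall w n, (n <= 2 ^ k)%N ->
      ((block (fun i => a i * (v (Fpast eps i%:Z w) - mean v)) 0 n ^+ 2)%:E <= V w)%E].
Proof.
move=> e00 sd; have [mv _ _] := sd.
pose Z i w := a i * (v (Fpast eps i%:Z w) - mean v).
have mZ i : measurable_fun setT (Z i).
  apply: measurable_funM => //; apply: measurable_funB => //.
  exact: measurableT_comp (mv 0) (measurable_Fpast iidE i).
exists (fun w => (k.+1%:R * dyadW (fun i => Z i w) 0 k)%:E); split.
- apply/measurable_EFinP; apply: measurable_funM => //; exact: measurable_dyadW.
- by move=> w; rewrite lee_fin mulr_ge0// dyadW_ge0.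
- under eq_integral do rewrite EFinM.
  rewrite ge0_integralZl//; last 2 first.
  + by apply/measurable_EFinP; exact: measurable_dyadW.
  + by move=> w _; rewrite lee_fin dyadW_ge0.
  rewrite /cost expr2 -mulrA EFinM; apply: lee_wpmul2l; first by rewrite lee_fin.
  apply: (integral_dyadW (m := P) (Z := Z) (c := fun i => Delta ^+ 2 * a i ^+ 2)) => // o n _ _.
  have := @sqI_block_le _ _ _ _ _ _ _ _ iidE e0 (fun=> v) Delta 0 o n a (fun=> 0) sd.
  rewrite normr0 => /(_ (fun _ _ => e00)).
  by under [X in (sqI P X <= _)%E]eq_fun do under eq_fun do rewrite subr0.
- by move=> w n n2; rewrite lee_fin; exact: sqr_block_le.
Qed.

End smooth_part.

(** * Euclidean vectors *)

Section vectors.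
Context (R : realType) (p : nat).
Implicit Types (u v : 'cV[R]_p).

Lemma dotvC u v : dotv u v = dotv v u.
Proof. by apply: eq_bigr => k _; rewrite mulrC. Qed.

Lemma dotvDl u v w : dotv (u + v) w = dotv u w + dotv v w.
Proof. by rewrite -big_split; apply: eq_bigr => k _; rewrite mxE mulrDl. Qed.

Lemma dotvZl a u v : dotv (a *: u) v = a * dotv u v.
Proof. by rewrite mulr_sumr; apply: eq_bigr => k _; rewrite mxE mulrA. Qed.

Lemma dotvDr u v w : dotv u (v + w) = dotv u v + dotv u w.
Proof. by rewrite dotvC dotvDl !(dotvC _ u). Qed.

Lemma dotvZr a u v : dotv u (a *: v) = a * dotv u v.
Proof. by rewrite dotvC dotvZl dotvC. Qed.

Lemma dotvNl u v : dotv (- u) v = - dotv u v.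
Proof. by rewrite -scaleN1r dotvZl mulN1r. Qed.

Lemma dotvNr u v : dotv u (- v) = - dotv u v.
Proof. by rewrite -scaleN1r dotvZr mulN1r. Qed.

Lemma dotv0r u : dotv u 0 = 0.
Proof. by rewrite -(scale0r (0 : 'cV[R]_p)) dotvZr mul0r. Qed.

Lemma dotv_sumr u (I : Type) (s : seq I) (f : I -> 'cV[R]_p) :
  dotv u (\sum_(i <- s) f i) = \sum_(i <- s) dotv u (f i).
Proof.
elim: s => [|i s ih]; first by rewrite !big_nil dotv0r.
by rewrite !big_cons dotvDr ih.
Qed.

Lemma dotvv_ge0 u : 0 <= dotv u u.
Proof. by apply: sumr_ge0 => k _; rewrite -expr2 sqr_ge0. Qed.

Lemma normv_ge0 u : 0 <= normv u. Proof. exact: sqrtr_ge0. Qed.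

Lemma normv_sqr u : normv u ^+ 2 = dotv u u.
Proof. by rewrite sqr_sqrtr// dotvv_ge0. Qed.

Lemma normvZ a u : normv (a *: u) = `|a| * normv u.
Proof.
by rewrite /normv dotvZl dotvZr mulrA -expr2 sqrtrM ?sqr_ge0// sqrtr_sqr.
Qed.

Lemma normvN u : normv (- u) = normv u.
Proof. by rewrite -scaleN1r normvZ normrN1 mul1r. Qed.

Lemma normv0 : normv (0 : 'cV[R]_p) = 0.
Proof. by rewrite /normv dotv0r sqrtr0. Qed.

Lemma normr_coord u k : `|u k 0| <= normv u.
Proof.
rewrite -(@ler_pXn2r _ 2) ?nnegrE ?normv_ge0// normv_sqr real_normK ?num_real//.
rewrite /dotv (bigD1 k)//= -expr2 lerDl sumr_ge0// => j _.
by rewrite -expr2 sqr_ge0.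
Qed.

Lemma normv_eq0 u : normv u = 0 -> u = 0.
Proof.
move=> u0; apply/matrixP => k j; rewrite ord1 mxE.
by apply/eqP; rewrite -normr_le0 -u0 normr_coord.
Qed.

Lemma cauchy_schwarz u v : `|dotv u v| <= normv u * normv v.
Proof.
have [/eqP v0|v0] := boolP (normv v == 0).
  by rewrite (normv_eq0 v0) dotv0r normr0 normv0 mulr0.
have vv : 0 < dotv v v by rewrite -normv_sqr exprn_gt0// lt_def v0 normv_ge0.
rewrite -(@ler_pXn2r _ 2) ?nnegrE ?mulr_ge0 ?normv_ge0//.
rewrite real_normK ?num_real// exprMn !normv_sqr.
have := dotvv_ge0 (u - (dotv u v / dotv v v) *: v).
rewrite dotvDl !dotvDr !dotvNl !dotvNr !dotvZl !dotvZr (dotvC v u).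
set a := dotv u v; set b := dotv v v in vv *; set c := dotv u u.
have -> : c - a / b * a + (- (a / b * a) - - (a / b * (a / b * b))) = c - a ^+ 2 / b.
  by field; rewrite gt_eqF.
by rewrite subr_ge0 ler_pdivrMr.
Qed.

Lemma normvD u v : normv (u + v) <= normv u + normv v.
Proof.
rewrite -(@ler_pXn2r _ 2) ?nnegrE ?addr_ge0 ?normv_ge0//.
rewrite normv_sqr dotvDl !dotvDr (dotvC v u) sqrrD !normv_sqr.
have := le_trans (ler_norm _) (cauchy_schwarz u v).
by rewrite -mulr_natl => ?; lra.
Qed.

Lemma normv_sum (I : Type) (s : seq I) (f : I -> 'cV[R]_p) :
  normv (\sum_(i <- s) f i) <= \sum_(i <- s) normv (f i).
Proof.
elim: s => [|i s ih]; first by rewrite !big_nil normv0.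
by rewrite !big_cons (le_trans (normvD _ _))// lerD2l.
Qed.

Lemma normv_le_sum u : normv u <= \sum_(k < p) `|u k 0|.
Proof.
have s0 : 0 <= \sum_(k < p) `|u k 0| by apply: sumr_ge0.
rewrite -(@ler_pXn2r _ 2) ?nnegrE ?normv_ge0// normv_sqr expr2 mulr_suml.
apply: ler_sum => k _; rewrite -expr2 -real_normK ?num_real// expr2.
apply: ler_wpM2l => //; rewrite (bigD1 k)//= lerDl.
exact: sumr_ge0.
Qed.

Lemma normv_le_coord u (c : R) : (forall k, `|u k 0| <= c) -> normv u <= p%:R * c.
Proof.
move=> uc; apply: (le_trans (normv_le_sum u)).
apply: (@le_trans _ _ (\sum_(k < p) c)); first exact: ler_sum.
by rewrite sumr_const card_ord mulr_natl.
Qed.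

Lemma dotv_le_coord u v (c : R) : (forall k, `|v k 0| <= c) ->
  `|dotv u v| <= normv u * (p%:R * c).
Proof.
move=> vc; apply: (le_trans (cauchy_schwarz u v)).
by apply: ler_wpM2l; [exact: normv_ge0|exact: normv_le_coord].
Qed.

Lemma outer_mulmx u v : (u *m u^T) *m v = dotv u v *: u.
Proof.
apply/matrixP => k j; rewrite ord1 -mulmxA !mxE big_ord1 mulrC mxE.
by congr (_ * _); apply: eq_bigr => i _; rewrite mxE.
Qed.

Lemma Sigma_mulmx (x : nat -> 'cV[R]_p) n v :
  Sigma x n *m v = \sum_(1 <= i < n.+1) dotv (x i) v *: x i.
Proof.
by rewrite /Sigma mulmx_suml; apply: eq_bigr => i _; rewrite outer_mulmx.
Qed.

Lemma rtilde_ge0 (x : nat -> 'cV[R]_p) n : 0 <= rtilde x n.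
Proof.
rewrite /rtilde; elim/big_rec: _ => // i y _ y0.
by rewrite le_max y0 orbT.
Qed.

Lemma le_rtilde (x : nat -> 'cV[R]_p) n i : (0 < i <= n)%N ->
  normv (x i) <= rtilde x n.
Proof.
move=> i0; rewrite /rtilde.
have : i \in index_iota 1 n.+1 by rewrite mem_index_iota.
elim: (index_iota 1 n.+1) => // j s ih; rewrite inE big_cons le_max => /orP[/eqP ->|/ih ->].
  by rewrite lexx.
by rewrite orbT.
Qed.

Lemma xin_ge0 (x : nat -> 'cV[R]_p) n q : 0 <= xin x n q.
Proof. by apply: sumr_ge0 => i _; rewrite exprn_ge0// normv_ge0. Qed.

End vectors.

(** * The martingale part over a ball *)

Lemma ae_forall_count d (T : measurableType d) (R : realType)
    (m : {measure set T -> \bar R}) (C : countType) (q : C -> T -> Prop) :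
  (forall c, {ae m, forall x, q c x}) -> {ae m, forall x, forall c, q c x}.
Proof.
move=> H.
have : {ae m, forall x, forall n, if unpickle n is Some c then q c x else True}.
  by apply: ae_foralln => n; case: unpickle => [c|]; [exact: H|exact: aeW].
by apply: filterS => x Hx c; have := Hx (pickle c); rewrite pickleK.
Qed.

Lemma subz_subn (m n : nat) : (n <= m)%N -> m%:Z - (m - n)%N%:Z = n%:Z.
Proof. lia. Qed.

Section grid.
Context (R : realType).

Lemma grid_approx (r b : R) (M : nat) : 0 < r -> (0 < M)%N -> `|b| <= r ->
  exists j : 'I_M.+1, `|b - (- r + 2 * r / M%:R * j%:R)| <= 2 * r / M%:R.
Proof.
move=> r0 M0; rewrite ler_norml => /andP[b1 b2].
have M0' : 0 < M%:R :> R by rewrite ltr0n.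
pose y := (b + r) * M%:R / (2 * r).
have y0 : 0 <= y by rewrite divr_ge0 ?mulr_ge0//; lra.
have h := truncn_itv y0; move/andP: h => [h1 h2].
have jM : (Num.truncn y < M.+1)%N.
  rewrite ltnS -(ler_nat R); apply: (le_trans h1).
  rewrite /y ler_pdivrMr; last by lra.
  by rewrite mulrC; apply: ler_wpM2l; lra.
exists (Ordinal jM) => /=.
have -> : b = - r + 2 * r / M%:R * y.
  rewrite /y; move: M0'; move: (M%:R) => m m0; field.
  by rewrite !gt_eqF.
rewrite -natr1 in h2.
have h3 : 0 <= 2 * r / M%:R by rewrite divr_ge0//; lra.
rewrite ler_norml; apply/andP; split; nra.
Qed.

(** Brings a corner value back into the range where the envelope and [psi1_trans] apply, preserving
    its order relative to any [s] in range ([le_clamp], [clamp_le_of]) and never increasing the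
    distance ([clamp_dist]). *)
Definition clamp (c t : R) : R := Num.max (- c) (Num.min c t).

Lemma clamp_le (c t : R) : 0 <= c -> `|clamp c t| <= c.
Proof.
move=> c0; rewrite ler_norml /clamp le_max lexx /= ge_max ge_min lexx /= andbT.
lra.
Qed.

Lemma le_clamp (c s t : R) : `|s| <= c -> s <= t -> s <= clamp c t.
Proof.
rewrite ler_norml => /andP[s1 s2] st; rewrite /clamp le_max le_min s2 st orbT//.
Qed.

Lemma clamp_le_of (c s t : R) : `|s| <= c -> t <= s -> clamp c t <= s.
Proof.
rewrite ler_norml => /andP[s1 s2] st; rewrite /clamp ge_max ge_min st s1 orbT//.
Qed.

Lemma clamp_dist (c s t : R) : `|s| <= c -> `|clamp c t - s| <= `|t - s|.
Proof.
rewrite ler_norml => /andP[s1 s2]; rewrite /clamp.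
case: (leP c t) => ct; case: (leP (- c) _) => h;
  rewrite !ler_norml; have := ler_norm (t - s); have := ler_norm (- (t - s)); rewrite normrN => ? ?;
  apply/andP; split; lra.
Qed.

Lemma shifted_dist (u v z : R) (b : bool) : `|u - v| <= z ->
  `|- v + (if b then 1 else -1) * z - - u| <= 2 * z.
Proof.
rewrite !ler_norml => /andP[d1 d2].
by case: b; apply/andP; split; lra.
Qed.

End grid.

Section martingale_part.
Context d (T : measurableType d) (R : realType) (P : probability T R)
  dS (S : measurableType dS) (eps eps' : int -> T -> S).
Hypothesis iidE : iid P (joint eps eps').
Let mu := past_law iidE.
Let nu := letter_law iidE.
Variables (psi : R -> R) (G : seqT S -> R) (psi1 : R -> seqT S -> R)
  (Lam : seqT S -> \bar R) (s0 : R).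
Hypothesis psi_homo : {homo psi : s t / s <= t}.
Hypothesis mpsi : measurable_fun setT psi.
Hypothesis mG : measurable_fun setT G.
Hypothesis s00 : 0 < s0.
Hypothesis psi1_trans : forall s, `|s| < s0 ->
  mu.-integrable setT (EFin \o (fun F => psi (G F + s))) /\
  {ae mu, forall F, trans nu (fun F => psi (G F + s)) F = psi1 s F}.
Hypothesis mLam : measurable_fun setT Lam.
Hypothesis Lam0 : forall F, (0 <= Lam F)%E.
Hypothesis iLam : mu.-integrable setT Lam.
Hypothesis lipLam : forall i w, (Lam (Fpast eps i w) < +oo)%E ->
  forall s t, `|s| < s0 -> `|t| < s0 ->
  `|psi1 s (Fpast eps i w) - psi1 t (Fpast eps i w)| <= fine (Lam (Fpast eps i w)) * `|s - t|.

Lemma trans_psi_incr (w t : R) : `|t| < s0 ->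
  {ae mu, forall F, trans nu (fun F' => w * psi_incr psi G t F') F = w * (psi1 t F - psi1 0 F)}.
Proof.
move=> ts0.
have z0 : `|(0:R)| < s0 by rewrite normr0.
have [i1 e1] := psi1_trans ts0; have [i2 e2] := psi1_trans z0.
have ps := past_scons iidE.
have i3 : mu.-integrable setT (EFin \o (fun F => w * psi (G F + t))).
  by have := integrableZl measurableT w i1.
have i4 : mu.-integrable setT (EFin \o (fun=> 0 : R)) by exact: finite_measure_integrable_cst.
have i5 : mu.-integrable setT (EFin \o (fun F => (- w) * psi (G F + 0) + 0)).
  have := integrableD measurableT (integrableZl measurableT (- w) i2) i4.
  by [].
have l1 := trans_lin_ae ps w i1 i5.
have l2 := trans_lin_ae ps (- w) i2 i4.
apply: filterS3 e1 e2 (filterI l1 l2) => F h1 h2 [h3 h4].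
have -> : (fun F' => w * psi_incr psi G t F') =
    (fun F => w * psi (G F + t) + (- w * psi (G F + 0) + 0)).
  by apply/funext => F'; rewrite /psi_incr addr0 addr0; ring.
rewrite h3 h4 h1 h2 /trans integral0 /=; ring.
Qed.

(* [M] is the number of grid cells per coordinate. *)
Lemma martingale_majorant (p N M : nat) (x : nat -> 'cV[R]_p) (r tr kappa : R) :
  0 < tr -> 0 <= kappa -> 0 < r -> (0 < M)%N ->
  (forall i, (0 < i <= N)%N -> normv (x i) * r < s0) ->
  exists X : T -> \bar R, [/\ measurable_fun setT X, forall w, (0 <= X w)%E,
   (\int[P]_w X w <=
      (2 * tr ^- 2)%:E * (\sum_(1 <= i < N.+1) sqI mu (psi_range psi G (normv (x i)) r)) +
      (expR (- kappa) * (M.+1 ^ p * p * 2)%:R * N.+1%:R)%:E +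
      (4 * p%:R * r / M%:R * xin x N 2)%:E * (\int[mu]_F Lam F))%E &
   {ae P, forall w, (X w <= 1)%E -> forall n beta k, (n <= N)%N -> normv beta <= r ->
    `|\sum_(1 <= i < n.+1) x i k 0 * (psi_incr psi G (- dotv (x i) beta) (Fpast eps i%:Z w) -
      (psi1 (- dotv (x i) beta) (Fpast eps (i%:Z - 1) w) - psi1 0 (Fpast eps (i%:Z - 1) w)))|
    <= 2 * tr * (kappa + 1) + 1}].
Proof.
move=> tr0 k0 r0 M0 xs0.
pose a i := normv (x i).
have a0 i : 0 <= a i by exact: normv_ge0.
(* A configuration is a grid point, an output coordinate and a sign; both signs together bound the
   absolute value. *)
pose C := ({ffun 'I_p -> 'I_M.+1} * 'I_p * bool)%type.
pose h : R := p%:R * (2 * r / M%:R).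
have h0 : 0 <= h by rewrite mulr_ge0// divr_ge0// mulr_ge0// ltW.
pose bg (g : {ffun 'I_p -> 'I_M.+1}) : 'cV[R]_p := \col_k (- r + 2 * r / M%:R * (g k)%:R).
pose sg (b : bool) : R := if b then 1 else -1.
pose W (c : C) i : R := sg c.2 * x i c.1.2 0.
(* The argument is moved by the cell error [a i * h] in the direction given by the sign of the
   weight. By monotonicity of [psi], the weighted term at [t c i] is then at least the one at any
   [beta] of the cell. *)
pose t (c : C) i : R := clamp (a i * r)
  (- dotv (x i) (bg c.1.1) + (if 0 <= W c i then 1 else -1) * (a i * h)).
have Wa c i : `|W c i| <= a i.
  rewrite normrM; have -> : `|sg c.2| = 1 by rewrite /sg; case: c.2; rewrite ?normrN1 ?normr1.
  by rewrite mul1r; exact: normr_coord.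
have ta c i : `|t c i| <= a i * r by apply: clamp_le; rewrite mulr_ge0// ltW.
have [Xc [mXc Xc0 IXc HXc]] := mart_majorant (past_scons iidE) psi_homo mpsi mG N tr0 k0 Wa ta.
(* Controls the compensators: the weight is at most [a i], the argument moves by at most
   [a i * (2 * h)], once for the cell and once for the correction, and [Lam] is a Lipschitz
   constant. *)
pose X4 w := (\sum_(1 <= i < N.+1) (a i ^+ 2 * (2 * h))%:E * Lam (Fpast eps (i%:Z - 1) w))%E.
have c40 i : (0 <= (a i ^+ 2 * (2 * h))%:E)%E.
  by rewrite lee_fin mulr_ge0 ?sqr_ge0// mulr_ge0.
have mL i : measurable_fun setT (fun w => Lam (Fpast eps i w)).
  exact: measurableT_comp mLam (measurable_Fpast iidE i).
have mX4 : measurable_fun setT X4.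
  by apply: emeasurable_sum => i; apply: measurable_funeM.
have X40 w : (0 <= X4 w)%E by apply: sume_ge0 => i _; rewrite mule_ge0.
have mXN : measurable_fun setT (fun w => Xc (Fpast eps N%:Z w)).
  exact: measurableT_comp mXc (measurable_Fpast iidE N%:Z).
exists (fun w => Xc (Fpast eps N%:Z w) + X4 w)%E; split.
- exact: emeasurable_funD.
- by move=> w; rewrite adde_ge0.
- rewrite ge0_integralD//; apply: leeD.
    rewrite (integral_famT iidE (@past_ix_inj N%:Z) mXc); apply: (le_trans IXc).
    rewrite leeD2l// lee_fin.
    by rewrite /C !card_prod card_ffun !card_ord card_bool.
  rewrite ge0_integral_sum//; last 2 first.
  + by move=> i; apply: measurable_funeM.
  + by move=> i w _; rewrite mule_ge0.
  rewrite (eq_bigr (fun i => (a i ^+ 2 * (2 * h))%:E * \int[mu]_F Lam F)%E); last first.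
    move=> i _; rewrite ge0_integralZl//; congr (_ * _)%E.
    exact: (integral_famT iidE (@past_ix_inj (i%:Z - 1)) mLam).
  rewrite -ge0_sume_distrl// sumEFin -mulr_suml.
  rewrite (_ : _ * (2 * h) = 4 * p%:R * r / M%:R * xin x N 2); first exact: lexx.
  by rewrite /h /xin /a; ring.
have aeL : {ae P, forall w, forall i : nat, (Lam (Fpast eps (i%:Z - 1) w) < +oo)%E}.
  apply: ae_foralln => i.
  have := integrable_ae measurableT iLam.
  move=> /(ae_fam (@past_ix_inj (i%:Z - 1))); apply: filterS => w /(_ I).
  by rewrite ge0_fin_numE.
have aeT : {ae P, forall w, forall c : C, forall i : nat, (0 < i <= N)%N ->
    trans nu (fun F' => W c i * psi_incr psi G (t c i) F') (Fpast eps (i%:Z - 1) w) =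
    W c i * (psi1 (t c i) (Fpast eps (i%:Z - 1) w) - psi1 0 (Fpast eps (i%:Z - 1) w))}.
  apply: ae_forall_count => c; apply: ae_foralln => i.
  case: (boolP (0 < i <= N)%N) => [iN|_]; last exact: aeW.
  have tc : `|t c i| < s0 by apply: le_lt_trans (ta c i) (xs0 i iN).
  have := trans_psi_incr (W c i) tc.
  by move=> /(ae_fam (@past_ix_inj (i%:Z - 1))); apply: filterS => w + _.
apply: filterS2 aeL aeT => w Lfin Htr Xle n beta k nN brn.
have X1 : (Xc (Fpast eps N%:Z w) <= 1)%E by apply: le_trans Xle; rewrite leeDl.
have X2 : (X4 w <= 1)%E by apply: le_trans Xle; rewrite leeDr.
pose lam i := fine (Lam (Fpast eps (i%:Z - 1) w)).
have lam0 i : 0 <= lam i by exact: fine_ge0.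
have sl : \sum_(1 <= i < n.+1) a i ^+ 2 * (2 * h) * lam i <= 1.
  rewrite -lee_fin -sumEFin; apply: le_trans X2.
  rewrite /X4 [leRHS](@big_cat_nat _ _ _ n.+1)//=.
  rewrite (eq_bigr (fun i => (a i ^+ 2 * (2 * h))%:E * Lam (Fpast eps (i%:Z - 1) w))%E); last first.
    by move=> i _; rewrite EFinM /lam fineK// ge0_fin_numE.
  by rewrite leeDl// sume_ge0// => i _; rewrite mule_ge0.
have bk j : `|beta j 0| <= r by apply: le_trans (normr_coord _ _) brn.
have [g Hg] : exists g : {ffun 'I_p -> 'I_M.+1}, forall j,
    `|beta j 0 - (- r + 2 * r / M%:R * (g j)%:R)| <= 2 * r / M%:R.
  have H j := grid_approx r0 M0 (bk j).
  have [g Hg] := choice H; exists (finfun g) => j; rewrite ffunE; exact: Hg.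
have dg i : `|dotv (x i) beta - dotv (x i) (bg g)| <= a i * h.
  rewrite -dotvNr -dotvDr; apply: dotv_le_coord => j.
  by rewrite !mxE; exact: Hg.
have db i : `|- dotv (x i) beta| <= a i * r.
  rewrite normrN; apply: (le_trans (cauchy_schwarz _ _)).
  by apply: ler_wpM2l => //; exact: a0.
pose Z i := psi_incr psi G (- dotv (x i) beta) (Fpast eps i%:Z w) -
      (psi1 (- dotv (x i) beta) (Fpast eps (i%:Z - 1) w) - psi1 0 (Fpast eps (i%:Z - 1) w)).
have key b : \sum_(1 <= i < n.+1) sg b * x i k 0 * Z i <= 2 * tr * (kappa + 1) + 1.
  pose c : C := (g, k, b).
  apply: (@le_trans _ _ (\sum_(1 <= i < n.+1)
     ((W c i * psi_incr psi G (t c i) (iter (N - i) (@shift _ S) (Fpast eps N%:Z w)) -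
       trans nu (fun F' => W c i * psi_incr psi G (t c i) F')
         (shift (iter (N - i) (@shift _ S) (Fpast eps N%:Z w)))) + a i ^+ 2 * (2 * h) * lam i))); last first.
    by rewrite big_split /=; apply: lerD => //; exact: HXc.
  rewrite big_nat [leRHS]big_nat; apply: ler_sum => i /andP[i0 i_n].
  have iN : (0 < i <= N)%N by rewrite i0 (leq_trans _ nN).
  rewrite iter_shift_Fpast.
  rewrite subz_subn ?(leq_trans _ nN)//.
  rewrite shift_Fpast Htr// -/(W c i) /Z.
  have L1 : `|W c i * (psi1 (t c i) (Fpast eps (i%:Z - 1) w) -
      psi1 (- dotv (x i) beta) (Fpast eps (i%:Z - 1) w))| <= a i ^+ 2 * (2 * h) * lam i.
    rewrite normrM.
    have l1 := lipLam (Lfin i) (le_lt_trans (ta c i) (xs0 i iN)) (le_lt_trans (db i) (xs0 i iN)).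
    have l2 : `|t c i - - dotv (x i) beta| <= a i * (2 * h).
      apply: (le_trans (clamp_dist _ (db i))).
      by apply: (le_trans (shifted_dist _ (dg i))); rewrite mulrCA.
    have -> : a i ^+ 2 * (2 * h) * lam i = a i * (lam i * (a i * (2 * h))) by ring.
    apply: ler_pM => //; apply: (le_trans l1); apply: ler_wpM2l; [exact: lam0|exact: l2].
  have L2 : W c i * psi (G (Fpast eps i%:Z w) + - dotv (x i) beta) <=
            W c i * psi (G (Fpast eps i%:Z w) + t c i).
    have := dg i; rewrite ler_norml => /andP[d1 d2].
    rewrite /t; case: (lerP 0 (W c i)) => W0.
      apply: ler_wpM2l => //; apply: psi_homo; rewrite lerD2l; apply: le_clamp => //.
      rewrite /=; lra.
    apply: ler_wnM2l; first exact: ltW.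
    apply: psi_homo; rewrite lerD2l; apply: clamp_le_of => //.
    by rewrite /=; lra.
  move: L1; rewrite ler_norml => /andP[_ L1].
  rewrite /psi_incr !mulrBr; rewrite !mulrBr in L1; lra.
rewrite ler_norml; apply/andP; split.
  have := key false; rewrite /sg.
  rewrite (eq_bigr (fun i => - (x i k 0 * Z i))); last by move=> i _; ring.
  by rewrite sumrN; lra.
have := key true; rewrite /sg.
by rewrite (eq_bigr (fun i => x i k 0 * Z i)); last by move=> i _; ring.
Qed.

End martingale_part.

(** * Lipschitz constants *)

Section rational_lipschitz.
Context (R : realType).

Lemma nonneg_of_rat (g : R -> R) (a b : R) : continuous g ->
  (forall q : rat, a < ratr q < b -> 0 <= g (ratr q)) ->
  forall s, a < s < b -> 0 <= g s.
Proof.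
move=> cg Hq s /andP[sa sb]; rewrite leNgt; apply/negP => gs.
have : \forall t \near s, g t < 0 by exact: (cvgr_lt (g s)) (cg s) 0 gs.
move=> /nbhs_ballP[e /= e0 He].
pose lo := Num.max a (s - e); pose hi := Num.min b (s + e).
have lohi : lo < hi.
  by rewrite /lo /hi lt_min !gt_max; apply/andP; split; apply/andP; split; lra.
have [q] := rat_in_itvoo lohi; rewrite in_itv /= /lo /hi lt_min gt_max => /andP[/andP[q1 q2] /andP[q3 q4]].
have := Hq q; rewrite q1 q3 => /(_ isT); rewrite leNgt => /negP; apply.
apply: He; rewrite /ball /= ltr_norml; apply/andP; split; lra.
Qed.

Context dS (S : measurableType dS) (f : R -> seqT S -> R) (e0 : R).
Hypothesis mf : forall s, measurable_fun setT (f s).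
Hypothesis e00 : 0 < e0.

Definition rat_quotient (n : nat) (F : seqT S) : \bar R :=
  if unpickle n is Some (q, r) then
    if [&& `|ratr q : R| <= e0, `|ratr r : R| <= e0 & (q != r :> rat)]
    then (`|f (ratr q) F - f (ratr r) F| / `|ratr q - ratr r|)%:E else 0%E
  else 0%E.

(* Rational arguments keep the supremum of (A5) measurable on the path space. *)
Definition rat_lip (F : seqT S) : \bar R := esups (rat_quotient ^~ F) 0%N.

Lemma measurable_rat_lip : measurable_fun setT rat_lip.
Proof.
apply: measurable_fun_esups => n; rewrite /rat_quotient.
case: (unpickle n) => [[q r]|]; last exact: measurable_cst.
case: [&& `|ratr q : R| <= e0, `|ratr r : R| <= e0 & q != r]; last exact: measurable_cst.
apply/measurable_EFinP; apply: measurable_funM => //.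
by apply: measurableT_comp => //; exact: measurable_funB.
Qed.

Lemma le_rat_lip n F : (rat_quotient n F <= rat_lip F)%E.
Proof. by apply: ereal_sup_ubound; exists n. Qed.

Lemma rat_quotient_ge0 n F : (0 <= rat_quotient n F)%E.
Proof.
rewrite /rat_quotient; case: (unpickle n) => [[q r]|//].
by case: ifP => // _; rewrite lee_fin divr_ge0.
Qed.

Lemma rat_lip_ge0 F : (0 <= rat_lip F)%E.
Proof. exact: le_trans (rat_quotient_ge0 0 F) (le_rat_lip 0 F). Qed.

Lemma rat_lip_le_sup F :
  (rat_lip F <= ereal_sup [set z | exists s t : R, [/\ (`|s| <= e0)%R, (`|t| <= e0)%R, s != t &
     z = (`|f s F - f t F| / `|s - t|)%:E]])%E.
Proof.
apply: ge_ereal_sup => _ [n _ <-]; rewrite /rat_quotient.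
set E := (E in ereal_sup E).
have E0 : (0 <= ereal_sup E)%E.
  apply: (@le_trans _ _ (`|f e0 F - f 0 F| / `|e0 - 0|)%:E).
    by rewrite lee_fin divr_ge0.
  apply: ereal_sup_ubound; exists e0, 0; split => //.
  - by rewrite ger0_norm// ltW.
  - by rewrite normr0 ltW.
  - by rewrite gt_eqF.
case: (unpickle n) => [[q r]|//]; case: ifP => // /and3P[q0 r0 qr].
apply: ereal_sup_ubound; exists (ratr q), (ratr r); split => //.
by rewrite (inj_eq (fmorph_inj _)).
Qed.

(** Continuity carries the Lipschitz bound from rational to real arguments, one argument at a
    time. *)
Lemma rat_lipP F : continuous (f ^~ F) -> (rat_lip F < +oo)%E ->
  forall s t, `|s| < e0 -> `|t| < e0 -> `|f s F - f t F| <= fine (rat_lip F) * `|s - t|.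
Proof.
move=> cf Foo; set lam := fine _.
have lamE : (lam%:E = rat_lip F)%E by rewrite /lam fineK// ge0_fin_numE// rat_lip_ge0.
have H1 (q r : rat) : `|ratr q : R| < e0 -> `|ratr r : R| < e0 ->
    `|f (ratr q) F - f (ratr r) F| <= lam * `|ratr q - ratr r|.
  move=> q0 r0; have [->|qr] := eqVneq q r; first by rewrite !subrr normr0 mulr0.
  have := le_rat_lip (pickle (q, r)) F.
  rewrite /rat_quotient pickleK qr (ltW q0) (ltW r0) /= -lamE lee_fin.
  by rewrite ler_pdivrMr// normr_gt0 subr_eq0 (inj_eq (fmorph_inj _)).
have cc (t : R) : continuous (fun s => lam * `|s - t| - `|f s F - f t F|).
  move=> s; apply: cvgB.
    apply: cvgMr; apply: cvg_norm; apply: cvgB; [exact: cvg_id|exact: cvg_cst].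
  apply: cvg_norm; apply: cvgB; [exact: cf|exact: cvg_cst].
have H2 (s : R) (r : rat) : `|s| < e0 -> `|ratr r : R| < e0 ->
    `|f s F - f (ratr r) F| <= lam * `|s - ratr r|.
  move=> s0 r0; rewrite -subr_ge0.
  apply: (nonneg_of_rat (cc (ratr r)) (a := - e0) (b := e0)); last by rewrite -ltr_norml.
  by move=> q; rewrite -ltr_norml => q0; rewrite subr_ge0; exact: H1.
move=> s t s0 t0; rewrite distrC [X in _ * X]distrC -subr_ge0.
apply: (nonneg_of_rat (cc s) (a := - e0) (b := e0)); last by rewrite -ltr_norml.
by move=> q; rewrite -ltr_norml => q0; rewrite subr_ge0 distrC [X in _ * X]distrC; exact: H2.
Qed.

End rational_lipschitz.

(** * Minimum eigenvalue *)

Lemma linear_term_eq0 (R : realFieldType) (a b : R) :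
  (forall t, 0 <= 2 * t * b + t ^+ 2 * a) -> b = 0.
Proof.
move=> H; apply/eqP/negPn/negP => b0.
have A0 : 0 < `|a| + 1 by rewrite ltr_wpDl.
(* Near [0] the linear term prevails; at this [t] the expression would be negative unless
   [b = 0]. *)
have := H (- b / (`|a| + 1)).
have -> : 2 * (- b / (`|a| + 1)) * b + (- b / (`|a| + 1)) ^+ 2 * a =
    (b / (`|a| + 1)) ^+ 2 * (a - 2 * (`|a| + 1)).
  by field; rewrite gt_eqF.
have p0 : 0 < (b / (`|a| + 1)) ^+ 2.
  by rewrite exprn_even_gt0//= mulf_neq0// invr_eq0 gt_eqF.
rewrite pmulr_rge0//; have := ler_norm a; have := normr_ge0 a; lra.
Qed.

Section rayleigh.
Context (R : realType) (p : nat) (x : nat -> 'cV[R]_p) (n : nat).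

Definition gram_form (v : 'cV[R]_p) : R := \sum_(1 <= i < n.+1) dotv (x i) v ^+ 2.

Lemma gram_formZ a v : gram_form (a *: v) = a ^+ 2 * gram_form v.
Proof. by rewrite mulr_sumr; apply: eq_bigr => i _; rewrite dotvZr exprMn. Qed.

Lemma gram_formD (u w : 'cV[R]_p) (t : R) : gram_form (u + t *: w) =
  gram_form u + 2 * t * dotv w (Sigma x n *m u) + t ^+ 2 * gram_form w.
Proof.
rewrite Sigma_mulmx dotv_sumr /gram_form !mulr_sumr -!big_split /=.
apply: eq_bigr => i _; rewrite dotvDr !dotvZr (dotvC w); ring.
Qed.

Lemma trmx_Sigma : (Sigma x n)^T = Sigma x n.
Proof.
rewrite /Sigma raddf_sum /=; apply: eq_bigr => i _.
by rewrite trmx_mul trmxK.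
Qed.

Lemma continuous_sum_rV (I : Type) (s : seq I) (f : I -> 'rV[R]_p -> R) :
  (forall i, continuous (f i)) -> continuous (fun v => \sum_(i <- s) f i v).
Proof.
move=> cf; elim: s => [|i s ih] v.
  rewrite (_ : (fun v => _) = cst 0); first exact: cst_continuous.
  by apply/funext => w; rewrite big_nil.
rewrite (_ : (fun v => _) = (fun v => f i v + \sum_(j <- s) f j v)); last first.
  by apply/funext => w; rewrite big_cons.
by apply: continuousD; [exact: cf|exact: ih].
Qed.

Lemma gram_form_min : (0 < p)%N -> exists2 u : 'cV[R]_p, dotv u u = 1 &
  forall v, dotv v v = 1 -> gram_form u <= gram_form v.
Proof.
move=> p0.
have cdot (y : 'cV[R]_p) : continuous (fun v : 'rV[R]_p => dotv y v^T).
  apply: continuous_sum_rV => k v.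
  rewrite (_ : (fun w : 'rV[R]_p => y k 0 * w^T k 0) =
    (cst (y k 0) : 'rV[R]_p -> R) \* (fun w : 'rV[R]_p => w 0 k)); last first.
    by apply/funext => w; rewrite /= mxE.
  by apply: continuousM; [exact: cst_continuous|exact: coord_continuous].
have cdd : continuous (fun v : 'rV[R]_p => dotv v^T v^T).
  apply: continuous_sum_rV => k v.
  rewrite (_ : (fun w : 'rV[R]_p => w^T k 0 * w^T k 0) = (fun w : 'rV[R]_p => w 0 k) \* (fun w : 'rV[R]_p => w 0 k)); last first.
    by apply/funext => w; rewrite /= mxE.
  by apply: continuousM; exact: coord_continuous.
have cq : continuous (fun v : 'rV[R]_p => gram_form v^T).
  apply: continuous_sum_rV => i v.
  rewrite (_ : (fun w : 'rV[R]_p => _) = (fun w : 'rV[R]_p => dotv (x i) w^T) \* (fun w : 'rV[R]_p => dotv (x i) w^T)); last first.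
    by apply/funext => w; rewrite /= expr2.
  by apply: continuousM; exact: cdot.
pose A := [set v : 'rV[R]_p | dotv v^T v^T = 1].
have cA : compact A.
  apply: (@subclosed_compact _ _ [set v : 'rV[R]_p | forall i, `[-1, 1]%classic (v 0 i)]).
  - rewrite (_ : A = (fun v : 'rV[R]_p => dotv v^T v^T) @^-1` [set 1])//.
    apply: closed_comp; [by move=> v _; exact: cdd|exact: closed_eq].
  - by apply: (@rV_compact R p (fun=> `[-1, 1]%classic)) => i; exact: segment_compact.
  - move=> v /= v1 k; rewrite /= in_itv /= -ler_norml.
    have := normr_coord v^T k; rewrite mxE /normv v1 sqrtr1; by [].
have A0 : A !=set0.
  exists (delta_mx 0 (Ordinal p0)); rewrite /A /= /dotv (bigD1 (Ordinal p0))//= big1 => [|k kp].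
    by rewrite !mxE !eqxx mulr1 addr0.
  by rewrite !mxE (negbTE kp) andbF mulr0.
have [u uA umin] := EVT_min_rV A0 cA (continuous_subspaceT cq).
exists u^T; first exact: set_mem uA.
by move=> v v1; have := umin v^T; rewrite trmxK; apply; apply/mem_set; rewrite /A /= trmxK.
Qed.

(* A minimiser of the form on the unit sphere is stationary, hence an eigenvector. *)
Lemma lambda_min_rayleigh (c : R) : (0 < p)%N -> (c%:E <= lambda_min (Sigma x n))%E ->
  forall v, c * dotv v v <= gram_form v.
Proof.
move=> p0 cl; have [u u1 umin] := gram_form_min p0.
pose m := gram_form u.
have mle v : m * dotv v v <= gram_form v.
  have [v0|v0] := eqVneq (normv v) 0.
    rewrite (normv_eq0 v0) dotv0r mulr0.
    by apply: sumr_ge0 => i _; exact: sqr_ge0.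
  have vv0 : dotv v v != 0 by rewrite -normv_sqr expf_neq0.
  have := umin ((normv v)^-1 *: v); rewrite dotvZl dotvZr mulrA -expr2 exprVn normv_sqr.
  rewrite mulVf// => /(_ erefl); rewrite gram_formZ exprVn normv_sqr mulrC.
  by rewrite ler_pdivlMr// lt_def vv0 dotvv_ge0.
have lin w : dotv w (Sigma x n *m u) - m * dotv w u = 0.
  apply: (@linear_term_eq0 _ (gram_form w - m * dotv w w)) => t.
  have := mle (u + t *: w); rewrite gram_formD !dotvDl !dotvDr !dotvZl !dotvZr (dotvC u w) u1.
  rewrite -/m; lra.
have Au : Sigma x n *m u = m *: u.
  apply/eqP; rewrite -subr_eq0; apply/eqP/normv_eq0/eqP.
  by rewrite -sqrf_eq0 normv_sqr dotvDr dotvNr dotvZr lin.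
have ev : eigenvalue (Sigma x n) m.
  apply/eigenvalueP; exists u^T.
    by rewrite -[X in _ *m X]trmx_Sigma -trmx_mul Au linearZ.
  apply/eqP => /(congr1 trmx); rewrite trmxK trmx0 => u0.
  by move: u1; rewrite u0 dotv0r => /eqP; rewrite eq_sym oner_eq0.
have cm : c <= m.
  by rewrite -lee_fin; apply: (le_trans cl); apply: ereal_inf_lbound; exists m.
by move=> v; apply: le_trans (mle v); apply: ler_wpM2r => //; exact: dotvv_ge0.
Qed.

End rayleigh.

Lemma eventually_coercive (R : realType) (p : nat) (x : nat -> 'cV[R]_p) : (0 < p)%N ->
  (0 < limn_einf (fun n : nat => lambda_min (Sigma x n) * (n%:R^-1)%:E))%E ->
  exists2 c : R, 0 < c & \forall n \near \oo, forall v, c * n%:R * dotv v v <= gram_form x n v.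
Proof.
move=> p0; set u := (fun n : nat => _); move=> lpos.
have [c c0 cl] : exists2 c : R, 0 < c & (c%:E < limn_einf u)%E.
  case: (limn_einf u) lpos => [l| |]//; rewrite ?lte_fin => l0.
    by exists (l / 2); rewrite ?lte_fin; lra.
  by exists 1 => //; rewrite ltry.
exists c => //.
move: cl; rewrite limn_einfE => /ereal_sup_gt[_ [N _ <-] cN].
exists N.+1 => // n /= Nn v.
have n0 : 0 < n%:R :> R by rewrite ltr0n (leq_ltn_trans _ Nn).
apply: lambda_min_rayleigh => //.
have : (c%:E <= u n)%E.
  apply/ltW/(lt_le_trans cN); apply: ereal_inf_lbound; exists n => //=.
  exact: ltnW.
rewrite /u => h; rewrite EFinM.
have := lee_wpmul2r (_ : 0 <= n%:R%:E)%E h; rewrite lee_fin ltW// => /(_ isT).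
by rewrite -muleA -(EFinM n%:R^-1) mulVf ?gt_eqF// mule1.
Qed.

(** * Growth rates *)

(** The tolerance [c / (K + 1)] lets a bound that is multiplied later by a constant [K], possibly
    zero, end up below [c]. *)
Lemma mulr_fraction_le (R : realFieldType) (K c : R) :
  0 <= K -> 0 <= c -> K * (c / (K + 1)) <= c.
Proof.
by move=> K0 c0; rewrite mulrA ler_pdivrMr ?ltr_wpDl// mulrC ler_wpM2l// lerDl.
Qed.

Section log_growth.
Context (R : realType).
Implicit Types n N : nat.

Local Notation l n := (ln (n%:R : R)).
Local Notation y n := (ln (ln (n%:R : R))).

(** [16 = 2 ^ 4] is the threshold used throughout: with [ln 2 > 1/2] it gives [ln n >= 2] and
    [ln (ln n) > 1/2], so all bases of powers in [bn] and [Bn] are positive. *)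
Lemma ln_ge2 n : (16 <= n)%N -> 2 <= l n.
Proof.
move=> n16.
have h : ln (2 ^+ 4 : R) <= l n.
  by rewrite ler_ln ?posrE ?exprn_gt0 ?ltr0n ?(leq_trans _ n16)// -natrX ler_nat.
by apply: le_trans h; rewrite ln_exp2; have := ln2_gt_half R; lra.
Qed.

Lemma ln_gt0' n : (16 <= n)%N -> 0 < l n.
Proof. by move=> /ln_ge2; lra. Qed.

Lemma lnln_gt n : (16 <= n)%N -> 2^-1 < y n.
Proof.
move=> n16; apply: (lt_le_trans (ln2_gt_half R)).
by rewrite ler_ln ?posrE ?ln_gt0'// ln_ge2.
Qed.

Lemma lnln_gt0 n : (16 <= n)%N -> 0 < y n.
Proof. by move=> /lnln_gt; apply: lt_trans; rewrite invr_gt0. Qed.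

Lemma natr_gt0_16 n : (16 <= n)%N -> 0 < n%:R :> R.
Proof. by move=> n16; rewrite ltr0n (leq_trans _ n16). Qed.

Lemma near_ge16 : \forall n \near \oo, (16 <= n)%N.
Proof. by exists 16%N. Qed.

Lemma lnln_unbounded (K : R) : \forall n \near \oo, K <= y n.
Proof.
near=> n.
have n16 : (16 <= n)%N by near: n; exact: near_ge16.
have h : expR (expR K) <= n%:R.
  have : ((Num.truncn (expR (expR K))).+1 <= n)%N by near: n; exact: nbhs_infty_ge.
  rewrite -(ler_nat R); apply: le_trans; exact: ltW (truncnS_gt _).
have h1 : expR K <= l n.
  by rewrite -[leLHS]expRK ler_ln ?posrE ?expR_gt0 ?natr_gt0_16.
by rewrite -[leLHS]expRK ler_ln ?posrE ?expR_gt0 ?ln_gt0'.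
Unshelve. all: by end_near. Qed.

(** In the variable [ln (ln n)] this is a power against a decaying exponential. *)
Lemma ln_lnln_small (a c e : R) : c < 0 -> 0 < e ->
  \forall n \near \oo, l n `^ c * y n `^ a <= e.
Proof.
move=> c0 e0.
have c0' : 0 < - c by rewrite oppr_gt0.
have [y0 [y00 Hy]] := expR_dominates a c0' e0.
near=> n.
have n16 : (16 <= n)%N by near: n; exact: near_ge16.
have yn : y0 <= y n by near: n; exact: lnln_unbounded.
have h := Hy _ yn.
have -> : l n `^ c = (expR (- c * y n))^-1.
  by rewrite -expRN mulNr opprK /powR gt_eqF ?ln_gt0'.
by rewrite mulrC ler_pdivrMr ?expR_gt0.
Unshelve. all: by end_near. Qed.

Lemma powR_sqr (a b : R) : 0 <= a -> (a `^ b) ^+ 2 = a `^ (b * 2).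
Proof. by move=> a0; rewrite -powR_mulrn ?powR_ge0// -powRrM. Qed.

Lemma powR_half_sqr (a : R) : 0 <= a -> (a `^ (1 / 2)) ^+ 2 = a.
Proof. by move=> a0; rewrite powR_sqr// mul1r mulVf// powRr1. Qed.

Lemma powR_mono (a b c : R) : 0 <= c -> 0 <= a -> a <= b -> a `^ c <= b `^ c.
Proof.
by move=> c0 a0 ab; apply: ge0_ler_powR; rewrite ?nnegrE// (le_trans a0).
Qed.

Lemma powR_ge1 (a c : R) : 1 <= a -> 0 <= c -> 1 <= a `^ c.
Proof. by move=> a1 c0; rewrite -[leLHS](powRr0 a) ler_powR. Qed.

Lemma powRDp (a b c : R) : 0 < a -> a `^ b * a `^ c = a `^ (b + c).
Proof. by move=> a0; rewrite powRD// (gt_eqF a0) implybT. Qed.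

Section band.
Variable iota : R.
Hypothesis iota0 : 0 < iota.

Lemma half_iota_ge0 : 0 <= 1/2 + iota.
Proof. by rewrite addr_ge0 ?(ltW iota0)// divr_ge0. Qed.

Lemma bn_gt0 n : (16 <= n)%N -> 0 < bn iota n.
Proof.
by move=> n16; rewrite /bn !mulr_gt0// powR_gt0 ?natr_gt0_16 ?ln_gt0' ?lnln_gt0.
Qed.

Lemma bn_ge0 n : 0 <= bn iota n.
Proof. by rewrite /bn !mulr_ge0// powR_ge0. Qed.

Lemma bn_sqrt n : (16 <= n)%N ->
  bn iota n * n%:R `^ (1 / 2) = l n `^ (3/2) * y n `^ (1/2 + iota).
Proof.
move=> n16; have n0 := natr_gt0_16 n16.
rewrite /bn powRN; field; rewrite gt_eqF// powR_gt0//.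
Qed.

Lemma ln_mono n N : (16 <= n)%N -> (n <= N)%N -> l n <= l N.
Proof.
move=> n16 nN; rewrite ler_ln ?posrE ?natr_gt0_16// ?(leq_trans n16)//.
by rewrite ler_nat.
Qed.

Lemma lnln_mono n N : (16 <= n)%N -> (n <= N)%N -> y n <= y N.
Proof.
move=> n16 nN; rewrite ler_ln ?posrE ?ln_gt0'// ?(leq_trans n16)//.
exact: ln_mono.
Qed.

(** The ball of radius [b_n] lies in that of radius [2 * b_N] for the dyadic [N] next to [n]: the
    origin of the [2 * bn] in the argument of [taut]. *)
Lemma bn_le_double n N : (16 <= n)%N -> (n <= N <= 2 * n)%N -> bn iota n <= 2 * bn iota N.
Proof.
move=> n16 /andP[nN N2]; have N16 : (16 <= N)%N by exact: leq_trans nN.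
have n0 := natr_gt0_16 n16; have N0 := natr_gt0_16 N16.
rewrite /bn !mulrA; apply: ler_pM; rewrite ?mulr_ge0 ?powR_ge0//; last first.
  apply: powR_mono; [exact: half_iota_ge0|by rewrite ltW// lnln_gt0|exact: lnln_mono].
apply: ler_pM; rewrite ?mulr_ge0 ?powR_ge0//; last first.
  apply: powR_mono; [lra|by rewrite ltW// ln_gt0'|exact: ln_mono].
rewrite !powRN ler_pdivlMr ?powR_gt0// mulrC ler_pdivrMr ?powR_gt0//.
rewrite -(@ler_pXn2r _ 2) ?nnegrE ?mulr_ge0 ?powR_ge0// exprMn !powR_half_sqr ?ltW//.
have : N%:R <= 2 * n%:R :> R by rewrite -natrM ler_nat.
lra.
Qed.

(** Both logarithms at most double from [n] to [N]: [4] bounds [2^(3/2)] for the first, and the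
    second gives [2^(1/2 + iota)]. *)
Lemma bn_le_half n N : (16 <= n)%N -> (n <= N <= 2 * n)%N ->
  bn iota N <= 4 * 2 `^ (1/2 + iota) * bn iota n.
Proof.
move=> n16 /andP[nN N2]; have N16 : (16 <= N)%N by exact: leq_trans nN.
have n0 := natr_gt0_16 n16; have N0 := natr_gt0_16 N16.
have l2 : l N <= 2 * l n.
  apply: (@le_trans _ _ (ln (2 * n%:R))).
    by rewrite ler_ln ?posrE ?mulr_gt0// -natrM ler_nat.
  rewrite lnM ?posrE//; have := ln_ge2 n16.
  have : ln 2 <= 1 :> R by have := @le_ln1Dx R 1; rewrite (_ : 1 + 1 = 2)//; apply; lra.
  lra.
have y2 : y N <= 2 * y n.
  apply: (@le_trans _ _ (ln (2 * l n))).
    by rewrite ler_ln ?posrE ?mulr_gt0 ?ln_gt0'.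
  rewrite lnM ?posrE ?ln_gt0'//.
  have : ln 2 <= y n by rewrite ler_ln ?posrE ?ln_gt0'// ln_ge2.
  lra.
rewrite (_ : _ * bn iota n = n%:R `^ (- (1/2)) * (4 * l n `^ (3/2)) * (2 `^ (1/2 + iota) * y n `^ (1/2 + iota))); last first.
  by rewrite /bn; ring.
rewrite /bn; apply: ler_pM; rewrite ?mulr_ge0 ?powR_ge0//; last first.
  rewrite -powRM ?(ltW (lnln_gt0 _))//.
  by apply: powR_mono => //; [exact: half_iota_ge0|rewrite ltW// lnln_gt0].
apply: ler_pM; rewrite ?mulr_ge0 ?powR_ge0//.
  rewrite !powRN lef_pV2 ?posrE ?powR_gt0//.
  by apply: powR_mono; [lra|exact: ltW|rewrite ler_nat].
apply: (@le_trans _ _ ((2 * l n) `^ (3/2))).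
  by apply: powR_mono => //; rewrite ltW// ln_gt0'.
rewrite powRM ?(ltW (ln_gt0' n16))//; apply: ler_wpM2r; first exact: powR_ge0.
apply: (@le_trans _ _ (2 `^ 2)); last by rewrite -[X in 2 `^ X]/(2%:R) powR_mulrn//; lra.
by apply: ler_powR; lra.
Qed.

(** Here the power [3/2] of the logarithm in [bn] and in [Bn] is spent: its square against the
    Rademacher-Menshov factor leaves [1 / k]. *)
Lemma bertrand_ratio k : (0 < k)%N ->
  k.+1%:R ^+ 2 / (k%:R * ln 2) ^+ 3 <= 4 / ln 2 ^+ 3 * k%:R^-1 :> R.
Proof.
move=> k0; have k1 : 1 <= k%:R :> R by rewrite ler1n.
have l2 := ln2_gt0 R; rewrite -natr1.
rewrite ler_pdivrMr ?exprn_gt0 ?mulr_gt0//; last lra.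
have -> : 4 / ln 2 ^+ 3 * k%:R^-1 * (k%:R * ln 2) ^+ 3 = 4 * k%:R ^+ 2 :> R.
  by field; rewrite !gt_eqF//; lra.
nra.
Qed.

Lemma bn_small (c : R) : 0 < c -> \forall n \near \oo, bn iota n <= c.
Proof.
move=> c0; have [l0 [l00 Hl]] := @expR_dominates R (3/2 + (1/2 + iota)) (1/2) c (divr_gt0 ltr01 (ltr0n _ 2)) c0.
near=> n.
have n16 : (16 <= n)%N by near: n; exact: near_ge16.
have n0 := natr_gt0_16 n16; have ln0 := ln_gt0' n16; have y0 := lnln_gt0 n16.
have yl : y n <= l n.
  have := ln_ge2 n16 => l2.
  have h : ln (1 + (l n - 1)) <= l n - 1 by apply: le_ln1Dx; lra.
  by rewrite (_ : 1 + (l n - 1) = l n) in h; [lra|ring].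
have ll : l0 <= l n by apply: le_trans yl; near: n; exact: lnln_unbounded.
have h := Hl _ ll.
have -> : bn iota n = l n `^ (3/2) * y n `^ (1/2 + iota) / n%:R `^ (1/2).
  by rewrite /bn powRN; ring.
rewrite ler_pdivrMr ?powR_gt0//.
have -> : n%:R `^ (1/2) = expR (1/2 * l n) by rewrite /powR gt_eqF.
apply: le_trans h; rewrite -(powRDp (3/2) (1/2 + iota) ln0); apply: ler_wpM2l; first exact: powR_ge0.
by apply: powR_mono => //; [exact: half_iota_ge0|exact: ltW].
Unshelve. all: by end_near. Qed.

Lemma bn_sqr n : (16 <= n)%N ->
  bn iota n ^+ 2 * n%:R = l n ^+ 3 * y n `^ (1 + 2 * iota).
Proof.
move=> n16; have n0 := natr_gt0_16 n16; have l0 := ln_gt0' n16; have y0 := lnln_gt0 n16.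
transitivity ((bn iota n * n%:R `^ (1 / 2)) ^+ 2).
  by rewrite [RHS]exprMn powR_half_sqr// ltW.
rewrite bn_sqrt// exprMn !powR_sqr ?(ltW l0) ?(ltW y0)//.
rewrite mulfVK// -[in l n `^ 3]/(3%:R) powR_mulrn ?(ltW l0)//.
by congr (_ * _ `^ _); field.
Qed.

Variables (p : nat) (x : nat -> 'cV[R]_p).

Lemma xin_addn n j q : xin x n (q + j) <= rtilde x n ^+ j * xin x n q.
Proof.
rewrite /xin mulr_sumr big_nat [leRHS]big_nat; apply: ler_sum => i i0.
rewrite exprD mulrC; apply: ler_wpM2r; first by rewrite exprn_ge0// normv_ge0.
by apply: lerXn2r; rewrite ?nnegrE ?normv_ge0 ?rtilde_ge0// le_rtilde.
Qed.

(** Sum [a^4 >= 2 c a^2 - c^2], that is [(a^2 - c)^2 >= 0], over the design. *)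
Lemma xin4_ge (c : R) n : 0 <= c -> c * n%:R <= xin x n 2 -> c ^+ 2 * n%:R <= xin x n 4.
Proof.
move=> c0 h.
have : \sum_(1 <= i < n.+1) (2 * c * normv (x i) ^+ 2 - c ^+ 2) <= xin x n 4.
  apply: ler_sum => i _; set a := normv _.
  have := sqr_ge0 (a ^+ 2 - c); have -> : a ^+ 4 = (a ^+ 2) ^+ 2 by rewrite -exprM.
  rewrite sqrrB; lra.
rewrite sumrB -mulr_sumr sumr_const_nat subn1 /= -/(xin x n 2) => h2.
apply: le_trans h2; rewrite -mulr_natr.
have : 2 * c * (c * n%:R) <= 2 * c * xin x n 2 by apply: ler_wpM2l => //; lra.
lra.
Qed.

Lemma Bn_ge0 n : 0 <= Bn x iota n.
Proof. by rewrite /Bn !mulr_ge0 ?powR_ge0 ?bn_ge0 ?sqrtr_ge0. Qed.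

Lemma Bn_sqr n : (16 <= n)%N -> Bn x iota n ^+ 2 =
  bn iota n ^+ 2 * xin x n 4 * l n ^+ 3 * y n `^ (1 + iota).
Proof.
move=> n16; have l0 := ln_gt0' n16; have y0 := lnln_gt0 n16.
rewrite /Bn !exprMn sqr_sqrtr ?xin_ge0// !powR_sqr ?(ltW l0) ?(ltW y0)//.
rewrite !mulfVK// -[in l n `^ 3]/(3%:R) powR_mulrn ?(ltW l0)//.
Qed.

(** The martingale bound carries a separate [ln n], due to the [+ 1] in the truncation level; this
    is what lets [Bn] absorb it. *)
Lemma Bn_ge_ln (c : R) : 0 < c -> (\forall n \near \oo, c * n%:R <= xin x n 4) ->
  \forall n \near \oo, l n <= (Num.sqrt c)^-1 * Bn x iota n.
Proof.
move=> c0 Hx; near=> n.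
have n16 : (16 <= n)%N by near: n; exact: near_ge16.
have y1 : 1 <= y n by near: n; exact: lnln_unbounded.
have xn : c * n%:R <= xin x n 4 by near: n.
have l2 := ln_ge2 n16; have n0 := natr_gt0_16 n16.
have c0' : 0 < Num.sqrt c by rewrite sqrtr_gt0.
rewrite mulrC ler_pdivlMr//.
have l0 : 0 <= l n by lra.
rewrite -(@ler_pXn2r _ 2) ?nnegrE ?Bn_ge0 ?(mulr_ge0 l0 (ltW c0'))//.
rewrite Bn_sqr// exprMn sqr_sqrtr ?(ltW c0)//.
have b2 := bn_sqr n16.
have P1 : 1 <= y n `^ (1 + 2 * iota).
  by rewrite powR_ge1// addr_ge0// mulr_ge0// ltW.
have P2 : 1 <= y n `^ (1 + iota) by rewrite powR_ge1// addr_ge0// ltW.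
have L1 : 1 <= l n ^+ 2 by rewrite exprn_ege1//; lra.
have L3 : 1 <= l n ^+ 3 by rewrite exprn_ege1//; lra.
apply: (@le_trans _ _ (bn iota n ^+ 2 * (c * n%:R) * l n ^+ 3 * y n `^ (1 + iota))); last first.
  do 2 (apply: ler_wpM2r; first by rewrite ?powR_ge0// exprn_ge0//; lra).
  by apply: ler_wpM2l => //; exact: sqr_ge0.
have -> : bn iota n ^+ 2 * (c * n%:R) * l n ^+ 3 * y n `^ (1 + iota) =
  c * (bn iota n ^+ 2 * n%:R * l n ^+ 3 * y n `^ (1 + iota)) by ring.
rewrite b2 mulrC; apply: ler_wpM2l; first exact: ltW.
have -> : l n ^+ 3 = l n ^+ 2 * l n by rewrite exprSr.
set Y1 := y n `^ _ in P1 *; set Y2 := y n `^ _ in P2 *.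
have -> : l n ^+ 2 * l n * Y1 * (l n ^+ 2 * l n) * Y2 =
  (l n ^+ 2 * (l n ^+ 2 * (l n ^+ 2 * (Y1 * Y2)))) by ring.
rewrite ler_peMr ?exprn_ge0//.
exact: mulr_ege1 L1 (mulr_ege1 L1 (mulr_ege1 P1 P2)).
Unshelve. all: by end_near. Qed.

End band.

(** * Error terms against the drift *)

Section design.
Variables (iota : R) (p : nat) (x : nat -> 'cV[R]_p) (C1 C2 : R).
Hypothesis C10 : 0 <= C1.
Hypothesis C20 : 0 <= C2.
Hypothesis xi2 : \forall n \near \oo, xin x n 2 <= C1 * n%:R.
Hypothesis xmax : \forall n \near \oo,
  rtilde x n <= C2 * (n%:R `^ (1/2) * ln (n%:R) `^ (-2)).

(** The product has order [(ln n)^(-1/2)] up to iterated logarithms, so the arguments [x_i' beta]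
    over the ball eventually enter every neighbourhood of [0] where the local hypotheses hold. *)
Lemma rtilde_bn_small (e : R) : 0 < e -> \forall n \near \oo, rtilde x n * bn iota n <= e.
Proof.
move=> e0.
have e1 : 0 < e / (C2 + 1) by rewrite divr_gt0// ltr_wpDl.
have h := ln_lnln_small (1/2 + iota) (_ : - (1/2) < 0) e1.
near=> n.
have n16 : (16 <= n)%N by near: n; exact: near_ge16.
have n0 := natr_gt0_16 n16; have l0 := ln_gt0' n16.
have rn : rtilde x n <= C2 * (n%:R `^ (1/2) * l n `^ (-2)) by near: n.
have hn : l n `^ (- (1/2)) * y n `^ (1/2 + iota) <= e / (C2 + 1).
  by near: n; apply: h; lra.
apply: (@le_trans _ _ (C2 * (n%:R `^ (1/2) * l n `^ (-2)) * bn iota n)).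
  by apply: ler_wpM2r => //; exact: bn_ge0.
have -> : C2 * (n%:R `^ (1/2) * l n `^ (-2)) * bn iota n =
    C2 * (l n `^ (- (1/2)) * y n `^ (1/2 + iota)).
  have -> : - (1/2) = -2 + 3/2 :> R by field.
  have E := bn_sqrt iota n16.
  rewrite -(powRDp (-2) (3/2) l0).
  transitivity (C2 * (l n `^ (-2) * (bn iota n * n%:R `^ (1 / 2)))); first by ring.
  by rewrite E; ring.
apply: (@le_trans _ _ (C2 * (e / (C2 + 1)))); first exact: ler_wpM2l.
by apply: mulr_fraction_le; rewrite // ltW.
Unshelve. all: by end_near. Qed.

(** This and the following bounds compare error terms with [n * b_n], the size of the drift on the
    sphere of radius [b_n]. *)
Lemma rtilde_small (e : R) : 0 < e -> \forall n \near \oo, rtilde x n <= e * (n%:R * bn iota n).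
Proof.
move=> e0.
have e1 : 0 < e / (C2 + 1) by rewrite divr_gt0// ltr_wpDl.
have h := ln_lnln_small (- (1/2 + iota)) (_ : - (7/2) < 0) e1.
near=> n.
have n16 : (16 <= n)%N by near: n; exact: near_ge16.
have n0 := natr_gt0_16 n16; have l0 := ln_gt0' n16; have y0 := lnln_gt0 n16.
have rn : rtilde x n <= C2 * (n%:R `^ (1/2) * l n `^ (-2)) by near: n.
have hn : l n `^ (- (7/2)) * y n `^ (- (1/2 + iota)) <= e / (C2 + 1).
  by near: n; apply: h; lra.
apply: (le_trans rn).
have s0 : 0 < n%:R `^ (1/2) :> R by rewrite powR_gt0.
have -> : n%:R * bn iota n = n%:R `^ (1/2) * (l n `^ (3/2) * y n `^ (1/2 + iota)).
  by rewrite -{1}(powR_half_sqr (ltW n0)) -bn_sqrt// expr2; ring.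
rewrite mulrCA [leRHS]mulrCA; apply: ler_wpM2l; first exact: ltW.
have z0 : 0 < l n `^ (3/2) * y n `^ (1/2 + iota) by rewrite mulr_gt0// powR_gt0.
rewrite -ler_pdivrMr//.
have -> : C2 * l n `^ (-2) / (l n `^ (3/2) * y n `^ (1/2 + iota)) =
    C2 * (l n `^ (- (7/2)) * y n `^ (- (1/2 + iota))).
  have -> : - (7/2) = -2 - 3/2 :> R by field.
  rewrite -(powRDp (-2) (- (3/2)) l0) !powRN; field.
  by rewrite !gt_eqF// powR_gt0.
apply: (@le_trans _ _ (C2 * (e / (C2 + 1)))); first exact: ler_wpM2l.
by apply: mulr_fraction_le; rewrite // ltW.
Unshelve. all: by end_near. Qed.

Lemma xin3_small (e : R) : 0 < e -> \forall n \near \oo,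
  xin x n 3 * bn iota n ^+ 2 <= e * (n%:R * bn iota n).
Proof.
move=> e0.
have e1 : 0 < e / (C1 + 1) by rewrite divr_gt0// ltr_wpDl.
near=> n.
have h : rtilde x n * bn iota n <= e / (C1 + 1) by near: n; exact: rtilde_bn_small.
have x2 : xin x n 2 <= C1 * n%:R by near: n.
have x3 : xin x n 3 <= rtilde x n * xin x n 2 by exact: (xin_addn x n 1 2).
have b0 := bn_ge0 iota n.
apply: (@le_trans _ _ (rtilde x n * xin x n 2 * bn iota n ^+ 2)).
  by apply: ler_wpM2r => //; exact: sqr_ge0.
have -> : rtilde x n * xin x n 2 * bn iota n ^+ 2 = (rtilde x n * bn iota n) * xin x n 2 * bn iota n by ring.
rewrite mulrA; apply: ler_wpM2r => //.
apply: (@le_trans _ _ (e / (C1 + 1) * (C1 * n%:R))).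
  by apply: ler_pM; rewrite ?xin_ge0// mulr_ge0// rtilde_ge0.
rewrite mulrA; apply: ler_wpM2r => //.
by rewrite mulrC; apply: mulr_fraction_le; rewrite // ltW.
Unshelve. all: by end_near. Qed.

Lemma xin4_le : \forall n \near \oo, xin x n 4 <= C1 * C2 ^+ 2 * n%:R ^+ 2 * ln n%:R `^ (-4).
Proof.
near=> n.
have n16 : (16 <= n)%N by near: n; exact: near_ge16.
have n0 := natr_gt0_16 n16; have l0 := ln_gt0' n16.
have rn : rtilde x n <= C2 * (n%:R `^ (1/2) * l n `^ (-2)) by near: n.
have x2 : xin x n 2 <= C1 * n%:R by near: n.
apply: (le_trans (xin_addn x n 2 2)).
apply: (@le_trans _ _ ((C2 * (n%:R `^ (1/2) * l n `^ (-2))) ^+ 2 * (C1 * n%:R))).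
  apply: ler_pM; rewrite ?sqr_ge0 ?xin_ge0//.
  by apply: lerXn2r; rewrite ?nnegrE ?rtilde_ge0// !mulr_ge0// powR_ge0.
rewrite !exprMn powR_half_sqr ?(ltW n0)// powR_sqr ?(ltW l0)//.
have -> : -2 * 2 = -4 :> R by ring.
by rewrite le_eqVlt; apply/orP; left; apply/eqP; ring.
Unshelve. all: by end_near. Qed.

Lemma Bn_small (e : R) : 0 < e -> \forall n \near \oo, Bn x iota n <= e * (n%:R * bn iota n).
Proof.
move=> e0.
have D0 : 0 <= C1 * C2 ^+ 2 by rewrite mulr_ge0// sqr_ge0.
have e1 : 0 < e ^+ 2 / (C1 * C2 ^+ 2 + 1) by rewrite divr_gt0 ?exprn_gt0// ltr_wpDl.
have h := ln_lnln_small (1 + iota) (_ : -1 < 0) e1.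
near=> n.
have n16 : (16 <= n)%N by near: n; exact: near_ge16.
have n0 := natr_gt0_16 n16; have l0 := ln_gt0' n16.
have hn : l n `^ (-1) * y n `^ (1 + iota) <= e ^+ 2 / (C1 * C2 ^+ 2 + 1).
  by near: n; apply: h; lra.
have x4 : xin x n 4 <= C1 * C2 ^+ 2 * n%:R ^+ 2 * l n `^ (-4) by near: n; exact: xin4_le.
have b0 := bn_ge0 iota n.
have p0 : 0 <= e * (n%:R * bn iota n) by rewrite mulr_ge0 ?(ltW e0)// mulr_ge0.
rewrite -(@ler_pXn2r _ 2) ?nnegrE ?Bn_ge0// Bn_sqr//.
apply: (@le_trans _ _ (bn iota n ^+ 2 * (C1 * C2 ^+ 2 * n%:R ^+ 2 * l n `^ (-4)) * l n ^+ 3 * y n `^ (1 + iota))).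
  do 2 (apply: ler_wpM2r; first by rewrite ?powR_ge0// exprn_ge0// ltW).
  by apply: ler_wpM2l => //; exact: sqr_ge0.
have -> : bn iota n ^+ 2 * (C1 * C2 ^+ 2 * n%:R ^+ 2 * l n `^ (-4)) * l n ^+ 3 * y n `^ (1 + iota) =
   (n%:R * bn iota n) ^+ 2 * (C1 * C2 ^+ 2 * (l n `^ (-1) * y n `^ (1 + iota))).
  have -> : -1 = -4 + 3 :> R by ring.
  rewrite -(powRDp (-4) 3 l0) -[in l n `^ 3]/(3%:R) powR_mulrn ?(ltW l0)//; ring.
rewrite [leRHS]exprMn [leRHS]mulrC; apply: ler_wpM2l; first exact: sqr_ge0.
apply: (@le_trans _ _ (C1 * C2 ^+ 2 * (e ^+ 2 / (C1 * C2 ^+ 2 + 1)))); first exact: ler_wpM2l.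
by apply: mulr_fraction_le; rewrite ?sqr_ge0.
Unshelve. all: by end_near. Qed.

End design.

End log_growth.

(** * Almost sure bounds *)

Section majorant_criterion.
Context d (T : measurableType d) (R : realType) (P : probability T R).

(** The properties [A k] quantify over all [beta] and need not be measurable events; it suffices
    that a measurable variable at most 1 implies them. *)
Lemma ae_eventually_of_majorants (A : nat -> T -> Prop) (u : nat -> R) :
  bounded_sums u -> (forall k, 0 <= u k) ->
  (\forall k \near \oo, exists X : T -> \bar R, [/\ measurable_fun setT X,
     forall w, (0 <= X w)%E, (\int[P]_w X w <= (u k)%:E)%E &
     {ae P, forall w, (X w <= 1)%E -> A k w}]) ->
  {ae P, forall w, \forall k \near \oo, A k w}.
Proof.
move=> su u0 [k0 _ H].
have H' k : exists X : T -> \bar R, [/\ measurable_fun setT X, forall w, (0 <= X w)%E,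
    (\int[P]_w X w <= (u k)%:E)%E &
    {ae P, forall w, (k0 <= k)%N -> (X w <= 1)%E -> A k w}].
  case: (leqP k0 k) => kk0.
    have [X [mX X0 IX HX]] := H k kk0; exists X; split => //.
    by apply: filterS HX => w + _.
  exists (cst 0%E); split => //.
  - by rewrite integral0 lee_fin.
  - by apply: aeW => w.
have [X HX] := choice H'.
have a1 : {ae P, forall w, \forall k \near \oo, (X k w <= 1)%E}.
  apply: (ae_eventually_le1 _ _ su u0).
  - by move=> k; have [] := HX k.
  - by move=> k w; have [] := HX k.
  - by apply: nearW => k; have [] := HX k.
have a2 : {ae P, forall w, forall k, (k0 <= k)%N -> (X k w <= 1)%E -> A k w}.
  by apply: ae_foralln => k; have [] := HX k.
apply: filterS2 a1 a2 => w h1 h2.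
near=> k; apply: h2; last by near: k.
by near: k; exact: nbhs_infty_ge.
Unshelve. all: by end_near. Qed.

Lemma majorant_family (J : finType) (V : J -> T -> \bar R) (v B : R) : 0 < B ->
  (forall j, [/\ measurable_fun setT (V j), forall w, (0 <= V j w)%E &
     (\int[P]_w V j w <= v%:E)%E]) ->
  exists X : T -> \bar R, [/\ measurable_fun setT X, forall w, (0 <= X w)%E,
     (\int[P]_w X w <= (#|J|%:R * v / B ^+ 2)%:E)%E &
     forall w, (X w <= 1)%E -> forall j, (V j w <= (B ^+ 2)%:E)%E].
Proof.
move=> B0 HV.
have c0 : (0 <= (B ^- 2)%:E)%E by rewrite lee_fin invr_ge0 sqr_ge0.
have mV j : measurable_fun setT (fun w => (B ^- 2)%:E * V j w)%E.
  by apply: measurable_funeM; have [] := HV j.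
have V0 j w : (0 <= V j w)%E by have [] := HV j.
have pV j w : (0 <= (B ^- 2)%:E * V j w)%E by rewrite mule_ge0.
exists (fun w => \sum_j (B ^- 2)%:E * V j w)%E; split.
- exact: emeasurable_sum.
- by move=> w; exact: sume_ge0.
- rewrite ge0_integral_sum//.
  apply: (@le_trans _ _ (\sum_(j : J) (v / B ^+ 2)%:E)%E).
    apply: lee_sum => j _; have [mVj _ Iv] := HV j; rewrite ge0_integralZl//.
    by rewrite mulrC EFinM; apply: lee_wpmul2l.
  by rewrite sumEFin sumr_const lee_fin -mulrA mulr_natl.
- move=> w Xw j; have : ((B ^- 2)%:E * V j w <= 1)%E.
    by apply: le_trans Xw; exact: (le_sume_term (f := fun j => (B ^- 2)%:E * V j w)%E).
  move=> h; have := lee_wpmul2l (_ : 0 <= (B ^+ 2)%:E)%E h.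
  rewrite lee_fin sqr_ge0 => /(_ isT).
  by rewrite muleA -EFinM mulfV ?sqrf_eq0 ?gt_eqF// mul1e mule1.
Qed.

End majorant_criterion.

(** With [N * N] cells per coordinate there are about [N^(2p)] configurations and [N + 1] times; the
    rate [(2p + 2) ln N] outweighs both and leaves [1 / N]. *)
Lemma config_bound (R : realType) (p N : nat) : (0 < N)%N ->
  expR (- ((2 * p + 2)%:R * ln N%:R)) * ((N * N).+1 ^ p * p * 2)%:R * N.+1%:R <=
  (2 ^ p * p * 4)%:R * (N%:R : R)^-1.
Proof.
move=> N0; have N0' : 0 < N%:R :> R by rewrite ltr0n.
rewrite expRN expRM_natl lnK ?posrE// -mulrA mulrC ler_pdivrMr ?exprn_gt0//.
rewrite mulrAC ler_pdivlMr// -natrX -!natrM ler_nat.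
have h1 : ((N * N).+1 ^ p <= 2 ^ p * N ^ (2 * p))%N.
  rewrite expnM -expnMn; case: (p) => [|q]; first by rewrite !expn0.
  rewrite leq_exp2r//; lia.
have h2 : (N.+1 <= 2 * N)%N by lia.
apply: (@leq_trans (2 ^ p * N ^ (2 * p) * p * 2 * (2 * N) * N)).
  by rewrite !leq_mul.
rewrite expnD -mulnn; move: (2 ^ p)%N (N ^ (2 * p))%N => a b.
by rewrite leq_eqVlt; apply/orP; left; apply/eqP; ring.
Qed.

(** [s] may vanish, so the truncation level needs its [+ 1]; the variance over the squared level is
    still at most of order [1 / z^2]. *)
Lemma trunc_ratio (R : realFieldType) (s z : R) : 0 <= s -> 0 < z ->
  2 * (s * z + 1) ^- 2 * (2 * s ^+ 2) <= 4 * (z ^+ 2)^-1.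
Proof.
move=> s_ge0 z0; have t0 : 0 < s * z + 1 by rewrite ltr_wpDl// mulr_ge0// ltW.
have -> : 2 * (s * z + 1) ^- 2 * (2 * s ^+ 2) = 4 * s ^+ 2 / (s * z + 1) ^+ 2.
  by field; rewrite gt_eqF.
rewrite ler_pdivrMr ?exprn_gt0//.
have -> : 4 * (z ^+ 2)^-1 * (s * z + 1) ^+ 2 = 4 * (s + z^-1) ^+ 2.
  by field; rewrite gt_eqF.
have z1 : 0 < z^-1 by rewrite invr_gt0.
nra.
Qed.

Lemma mart_bound_arith (R : realFieldType) (c z l : R) : 0 <= c -> 0 <= z -> 2 <= l ->
  2 * (z + 1) * (c * l + 1) + 1 <= (2 * (c + 1) + 1) * (z * l + l).
Proof.
move=> c0 z0 l2; have h1 : c * l + 1 <= (c + 1) * l by lra.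
have h2 : 2 * (z + 1) * (c * l + 1) <= 2 * (z + 1) * ((c + 1) * l).
  by apply: ler_wpM2l => //; lra.
have h3 : 0 <= z * l by rewrite mulr_ge0//; lra.
lra.
Qed.

Lemma equicontinuity_arith (R : realFieldType) (K c s l B : R) : 0 <= K -> 0 <= c ->
  0 <= s -> 0 <= B -> l <= c * B -> K * (s + l) + B <= (K + K * c + 1) * (s + B).
Proof.
move=> K0 c0 s0 B0 lB.
have h1 : K * (s + l) <= K * (s + c * B) by apply: ler_wpM2l => //; rewrite lerD2l.
have h2 : 0 <= K * c * s by rewrite !mulr_ge0.
have h3 : 0 <= K * B by rewrite mulr_ge0.
lra.
Qed.

(** This is why the grid has [N * N] cells: the compensator error, of order [xi_N(2)] over the
    number of cells, becomes [O(1 / N)], summable along powers of two. *)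
Lemma grid_error_arith (R : realFieldType) (c r xi N C E : R) : 0 <= c -> 0 <= r -> r <= 1 ->
  0 <= xi -> xi <= C * N -> 0 < N -> 0 <= E ->
  4 * c * r / (N * N) * xi * E <= 4 * c * C * E * N^-1.
Proof.
move=> c0 r0 r1 xi0 xiC N0 E0.
have -> : 4 * c * r / (N * N) * xi * E = 4 * c * E * (r * xi) / (N * N).
  by field; rewrite gt_eqF.
rewrite ler_pdivrMr ?mulr_gt0//.
have -> : 4 * c * C * E * N^-1 * (N * N) = 4 * c * E * (C * N).
  by field; rewrite gt_eqF.
apply: ler_wpM2l; first by rewrite !mulr_ge0.
by apply: le_trans xiC; rewrite ler_piMl.
Qed.

Lemma nbar_bounds n : (2 <= n)%N -> (n <= nbar n <= 2 * n)%N.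
Proof.
move=> n2; have := up_log_bounds (ltnSn 1) n2; rewrite /nbar => /andP[h1 ->] /=.
have k0 : (0 < up_log 2 n)%N by rewrite up_log_gt0.
by rewrite -(prednK k0) expnS leq_mul2l /= ltnW.
Qed.

Lemma near_up_log (Q : nat -> Prop) : (\forall k \near \oo, Q k) ->
  \forall n \near \oo, Q (up_log 2 n).
Proof.
move=> [K _ HK]; exists (2 ^ K).+2 => // n /= Kn; apply: HK => /=.
have n2 : (1 < n)%N by apply: leq_trans Kn.
have := up_log_bounds (ltnSn 1) n2 => /andP[_ h].
rewrite -(leq_exp2l _ _ (ltnSn 1)); apply: leq_trans h.
by do 2 apply: ltnW.
Qed.

Lemma ray_contradiction (R : realFieldType) (d X o a b c : R) : - d * X <= o ->
  o <= a + b + c -> a <= d * X -> b <= d * X -> c <= d * X - 8 * d * X -> 0 < d * X -> False.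
Proof. by rewrite -mulrA mulNr; move: (d * X) => D; lra. Qed.

Lemma bahadur_arith (R : realFieldType) (a b c s B X r : R) : 0 <= a -> 0 <= b -> 0 <= c ->
  0 <= s -> 0 <= B -> 0 <= X -> 0 <= r ->
  a * (s + B) + c * X + b * r <= (a + b + c) * (s + (B + X + r)).
Proof.
move=> a0 b0 c0 s0 B0 X0 r0.
have h1 : a * (s + B) <= a * (s + (B + X + r)) by apply: ler_wpM2l => //; lra.
have h2 : c * X <= c * (s + (B + X + r)) by apply: ler_wpM2l => //; lra.
have h3 : b * r <= b * (s + (B + X + r)) by apply: ler_wpM2l => //; lra.
lra.
Qed.

(** * Equicontinuity, consistency and linear expansion *)

Section core.
Context d (T : measurableType d) (R : realType) (P : probability T R)
  dS (S : measurableType dS) (eps eps' : int -> T -> S).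
Hypothesis iidE : iid P (joint eps eps').
Local Notation mu := (past_law iidE).
Local Notation nu := (letter_law iidE).
Local Notation mean := (past_mean iidE).
Variables (psi : R -> R) (G : (nat -> S) -> R) (psi1 : R -> (nat -> S) -> R) (s0 : R).
Hypothesis psi_homo : {homo psi : s t / s <= t}.
Hypothesis mpsi : measurable_fun setT psi.
Hypothesis mG : measurable_fun setT (G : seqT S -> R).
Hypothesis mpsi1 : forall s, seq_measurable_fun (psi1 s).
Hypothesis s00 : 0 < s0.
Hypothesis psi1_trans : forall s, `|s| < s0 ->
  mu.-integrable setT (EFin \o (fun F : seqT S => psi (G F + s))) /\
  {ae mu, forall F, trans nu (fun F => psi (G F + s)) F = psi1 s F}.
Hypothesis mfin : forall t, `|t| < s0 -> (mnorm P psi (err G eps) t < +oo)%E.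
Variables (p : nat) (x : nat -> 'cV[R]_p) (iota : R).
Hypothesis p0 : (0 < p)%N.
Hypothesis iota0 : 0 < iota.
Local Notation e := (err G eps).
Local Notation incr := (psi_incr psi (G : seqT S -> R)).

Lemma mnorm_sqr t : (mnorm P psi e t * mnorm P psi e t = sqI mu (incr t))%E.
Proof.
have m1 : measurable_fun setT (incr t) by exact: measurable_psi_incr.
rewrite -(sqI_fam iidE (@past_ix_inj 1) m1).
exact: (nrmM P (fun w => incr t (Fpast eps 1 w))).
Qed.

Lemma mean_psi1 s : `|s| < s0 -> mean (fun F => psi (G F + s)) = mean (psi1 s).
Proof.
move=> ss0; have [ip ep] := psi1_trans ss0.
have [_ h] := integral_trans (past_scons iidE) ip; rewrite /past_mean -h => {h}.
have m1 : measurable_fun setT (fun F : seqT S => psi (G F + s)) by exact: measurable_psiG.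
congr fine; apply: ae_eq_integral => //.
- by apply/measurable_EFinP; exact: measurable_trans.
- by apply/measurable_EFinP; exact: measurable_seqT_fun.
- by apply: filterS ep => F -> _.
Qed.

Lemma Omegat_coord n beta w k : Omegat psi x e n beta w k 0 =
  block (fun i => x i k 0 * psi (G (Fpast eps i%:Z w) + - dotv (x i) beta)) 0 n.
Proof.
by rewrite /Omegat summxE /block; apply: eq_bigr => i _; rewrite mxE mulrC.
Qed.

Lemma EOmegat_coord n beta k :
  (forall i, (0 < i <= n)%N -> `|dotv (x i) beta| < s0) ->
  EOmegat P psi x e n beta k 0 = block (fun i => x i k 0 * mean (psi1 (- dotv (x i) beta))) 0 n.
Proof.
move=> Hx; rewrite mxE unlock.
under eq_integral do rewrite Omegat_coord.
have ii i : (0 < i <= n)%N -> P.-integrable setT (EFin \o (fun w =>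
    psi (G (Fpast eps i%:Z w) + - dotv (x i) beta))).
  move=> i0; have si : `|- dotv (x i) beta| < s0 by rewrite normrN Hx.
  have [ip _] := psi1_trans si.
  apply/(integrable_fam iidE (@past_ix_inj i%:Z) (u := fun F => psi (G F + - dotv (x i) beta))) => //.
  exact: measurable_psiG.
have ia i : (0 < i <= n)%N -> P.-integrable setT (EFin \o (fun w => x i k 0 *
    psi (G (Fpast eps i%:Z w) + - dotv (x i) beta))).
  by move=> i0; have := integrableZl measurableT (x i k 0) (ii i i0).
have [_ ->] := integral_block ia; apply: eq_big_nat => i i0.
transitivity (x i k 0 * fine (\int[P]_w (psi (G (Fpast eps i%:Z w) + - dotv (x i) beta))%:E)%E).
  exact: (RintegralZl (x i k 0) measurableT (ii i i0)).
congr (_ * _); rewrite -mean_psi1; last by rewrite normrN Hx.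
apply: (integral_past_mean iidE i%:Z (u := fun F => psi (G F + - dotv (x i) beta))).
exact: measurable_psiG.
Qed.

Definition mart_part n (beta : 'cV[R]_p) (k : 'I_p) (w : T) : R :=
  \sum_(1 <= i < n.+1) x i k 0 * (incr (- dotv (x i) beta) (Fpast eps i%:Z w) -
      (psi1 (- dotv (x i) beta) (Fpast eps (i%:Z - 1) w) - psi1 0 (Fpast eps (i%:Z - 1) w))).

Definition smooth_part n (beta : 'cV[R]_p) (k : 'I_p) (w : T) : R :=
  block (fun i => x i k 0 *
    ((psi1 (- dotv (x i) beta) (Fpast eps (i%:Z - 1) w) - psi1 0 (Fpast eps (i%:Z - 1) w)) -
     (mean (psi1 (- dotv (x i) beta)) - mean (psi1 0)))) 0 n.

Lemma Kt_diff_coord n beta w k :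
  (forall i, (0 < i <= n)%N -> `|dotv (x i) beta| < s0) ->
  (Kt P psi x e n beta w - Kt P psi x e n 0 w) k 0 = mart_part n beta k w + smooth_part n beta k w.
Proof.
move=> Hx.
have H0 i : (0 < i <= n)%N -> `|dotv (x i) 0| < s0 by rewrite dotv0r normr0.
have sub (u v : 'cV[R]_p) : (u - v) k 0 = u k 0 - v k 0 by rewrite !mxE.
rewrite /Kt !sub !Omegat_coord !EOmegat_coord// /mart_part /smooth_part /block.
rewrite -!sumrB -big_split /=; apply: eq_bigr => i _.
rewrite dotv0r oppr0 addr0 /psi_incr; ring.
Qed.

(** Taking [fine] loses nothing for large [k]: by [taut_fin] the value is finite once all
    [|x_i| * 2 b_n] are below [s0]. *)
Definition tau_dyadic k : R := fine (taut P psi e x (2 ^ k) (2 * bn iota (2 ^ k))).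

Local Notation lnd k := (ln ((2 ^ k)%N%:R : R)).

Lemma lnd_natr k : lnd k = k%:R * ln 2.
Proof. by rewrite natrX ln_exp2. Qed.

Lemma taut_ge0 n delta : (0 <= taut P psi e x n delta)%E.
Proof.
apply: sume_ge0 => i _; apply: mule_ge0; first by rewrite lee_fin sqr_ge0.
by rewrite adde_ge0// mule_ge0// Lnorm_ge0.
Qed.

Lemma taut_fin n delta : 0 <= delta ->
  (forall i, (0 < i <= n)%N -> normv (x i) * delta < s0) ->
  taut P psi e x n delta \is a fin_num.
Proof.
move=> d0 Hx; rewrite /taut big_nat_cond; apply/sum_fin_numP => i _ /andP[i0 _].
have a0 : 0 <= normv (x i) * delta by rewrite mulr_ge0// normv_ge0.
have f t : `|t| < s0 -> mnorm P psi e t \is a fin_num.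
  by move=> ts; rewrite ge0_fin_numE ?mfin// Lnorm_ge0.
have := Hx i i0 => ai.
by rewrite fin_numM// fin_numD !fin_numM// f// ?normrN ger0_norm.
Qed.

Lemma sum_psi_range_le n delta :
  (\sum_(1 <= i < n.+1) sqI mu (psi_range psi (G : seqT S -> R) (normv (x i)) delta) <=
   2%:E * taut P psi e x n delta)%E.
Proof.
rewrite /taut ge0_sume_distrr; last first.
  move=> i _; apply: mule_ge0; first by rewrite lee_fin sqr_ge0.
  by rewrite adde_ge0// mule_ge0// Lnorm_ge0.
apply: lee_sum => i _; rewrite !mnorm_sqr muleA -EFinM.
by apply: sqI_psi_range_le => //; exact: normv_ge0.
Qed.

Variables (Lam : seqT S -> \bar R) (C1 C2 : R).
Hypothesis mLam : measurable_fun setT Lam.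
Hypothesis Lam0 : forall F, (0 <= Lam F)%E.
Hypothesis iLam : mu.-integrable setT Lam.
Hypothesis lipLam : forall i w, (Lam (Fpast eps i w) < +oo)%E ->
  forall s t, `|s| < s0 -> `|t| < s0 ->
  `|psi1 s (Fpast eps i w) - psi1 t (Fpast eps i w)| <= fine (Lam (Fpast eps i w)) * `|s - t|.
Hypothesis C10 : 0 <= C1.
Hypothesis C20 : 0 <= C2.
Hypothesis xi2 : \forall n \near \oo, xin x n 2 <= C1 * n%:R.
Hypothesis xmax : \forall n \near \oo,
  rtilde x n <= C2 * (n%:R `^ (1/2) * ln (n%:R) `^ (-2)).

Lemma near_dyadic (Q : nat -> Prop) : (\forall n \near \oo, Q n) ->
  \forall k \near \oo, Q (2 ^ k)%N.
Proof.
move=> [N _ HN]; exists N => // k /= Nk; apply: HN => /=.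
by apply: (leq_trans Nk); apply: ltnW; exact: ltn_expl.
Qed.

Lemma near_radius (s : R) : 0 < s ->
  \forall n \near \oo, forall i, (0 < i <= n)%N -> normv (x i) * (2 * bn iota n) < s.
Proof.
move=> sp; have s4 : 0 < s / 4 by rewrite divr_gt0.
have := rtilde_bn_small iota C20 xmax s4.
apply: filterS => n h i i0; apply: (@le_lt_trans _ _ (2 * (rtilde x n * bn iota n))).
  rewrite mulrCA; apply: ler_wpM2l => //; apply: ler_wpM2r; first exact: bn_ge0.
  exact: le_rtilde.
lra.
Qed.

Lemma mart_ae (q : R) : 3/2 < q -> exists2 K : R, 0 <= K &
  {ae P, forall w, \forall k \near \oo, forall n beta j,
    (n <= 2 ^ k)%N -> normv beta <= 2 * bn iota (2 ^ k) ->
    `|mart_part n beta j w| <= K * (Num.sqrt (tau_dyadic k) * lnd k `^ q + lnd k)}.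
Proof.
move=> q32; pose K : R := 2 * (2 * p + 3)%:R + 1.
exists K; first by rewrite addr_ge0.
pose EL : R := fine (\int[mu]_F Lam F)%E.
have ELE : (\int[mu]_F Lam F = EL%:E)%E.
  by rewrite /EL fineK// integrable_fin_num.
have EL0 : 0 <= EL by rewrite fine_ge0// integral_ge0.
pose c0 : R := (2 ^ p * p * 4)%:R + 4 * p%:R * C1 * EL.
have c00 : 0 <= c0 by rewrite addr_ge0// !mulr_ge0.
pose u (k : nat) : R := 4 * (ln 2) `^ (- (2 * (q - 1))) * k%:R `^ (- (2 * (q - 1))) + c0 * (2^-1) ^+ k.
have l2 := ln2_gt0 R.
apply: (ae_eventually_of_majorants (u := u)).
- apply: bounded_sumsD.
    apply: bounded_sumsZ; first by rewrite mulr_ge0// powR_ge0.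
    by apply: bounded_sums_powR; lra.
  by apply: bounded_sumsZ => //; apply: bounded_sums_geo; apply/andP; split; lra.
- move=> k; rewrite addr_ge0// !mulr_ge0// ?powR_ge0// exprn_ge0//.
have bh : \forall n \near \oo, bn iota n <= 1/2 :> R by apply: bn_small.
near=> k.
have N16 : (16 <= 2 ^ k)%N by near: k; exact: (near_dyadic near_ge16).
have k0 : (0 < k)%N by near: k; exact: nbhs_infty_ge.
have rad : forall i, (0 < i <= 2 ^ k)%N -> normv (x i) * (2 * bn iota (2 ^ k)) < s0.
  by near: k; exact: (near_dyadic (near_radius s00)).
have x2 : xin x (2 ^ k) 2 <= C1 * (2 ^ k)%N%:R.
  by near: k; exact: (near_dyadic xi2).
have r1 : 2 * bn iota (2 ^ k) <= 1.
  have : bn iota (2 ^ k) <= 1 / 2 by near: k; exact: (near_dyadic bh).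
  lra.
set N := (2 ^ k)%N in N16 rad x2 r1 *.
have r0 : 0 < 2 * bn iota N by rewrite mulr_gt0// bn_gt0.
have N0 := natr_gt0_16 R N16; have N0' : (0 < N)%N by rewrite (leq_trans _ N16).
have l0 := ln_gt0' R N16; have lge2 := ln_ge2 R N16.
set r := 2 * bn iota N in rad r1 r0.
set l := ln N%:R in l0 lge2.
set s := Num.sqrt (tau_dyadic k).
have s_ge0 : 0 <= s by exact: sqrtr_ge0.
have tauE : (taut P psi e x N r = (s ^+ 2)%:E)%E.
  rewrite /s sqr_sqrtr; last by rewrite fine_ge0// taut_ge0.
  by rewrite /tau_dyadic fineK// taut_fin// ltW.
(* The power [q] of the logarithm in [Ln] is shared: [q - 1] here, where Markov leaves the series of
   [k^(-2 (q - 1))], summable since [q > 3/2], and [1] in [kappa]. *)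
pose tr := s * l `^ (q - 1) + 1.
have lq0 : 0 < l `^ (q - 1) by rewrite powR_gt0.
have tr0 : 0 < tr by rewrite ltr_wpDl// mulr_ge0// ltW.
(* The rate demanded by [config_bound]. *)
pose kappa := (2 * p + 2)%:R * l.
have kap0 : 0 <= kappa by rewrite mulr_ge0// ltW.
have NN0 : (0 < N * N)%N by rewrite muln_gt0 N0'.
have [X [mX X0 IX HX]] := martingale_majorant psi_homo mpsi mG
  s00 psi1_trans mLam Lam0 iLam lipLam tr0 kap0 r0 NN0 rad.
exists X; split => //; last first.
  apply: filterS HX => w HX /HX {}HX n beta j nN br; apply: (le_trans (HX n beta j nN br)).
  have lqE : l `^ q = l `^ (q - 1) * l.
    by rewrite -{3}(powRr1 (ltW l0)) powRDp// subrK.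
  rewrite lqE /tr /kappa /K.
  have -> : (2 * p + 3)%:R = (2 * p + 2)%:R + 1 :> R by rewrite natr1 -addnS.
  rewrite (mulrA s); apply: mart_bound_arith => //.
  by rewrite mulr_ge0// ltW.
apply: (le_trans IX).
have lqk : l `^ (- (2 * (q - 1))) = (ln 2) `^ (- (2 * (q - 1))) * k%:R `^ (- (2 * (q - 1))).
  by rewrite /l lnd_natr mulrC powRM// ltW.
have Nk : N%:R^-1 = (2^-1) ^+ k :> R by rewrite /N natrX exprVn.
have t1 : ((2 * tr ^- 2)%:E * (\sum_(1 <= i < N.+1) sqI mu (psi_range psi (G : seqT S -> R) (normv (x i)) r)) <=
    (4 * (ln 2) `^ (- (2 * (q - 1))) * k%:R `^ (- (2 * (q - 1))))%:E)%E.
  have tp : 0 <= 2 * tr ^- 2 by rewrite mulr_ge0// invr_ge0 sqr_ge0.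
  apply: (le_trans (lee_wpmul2l (_ : 0 <= (2 * tr ^- 2)%:E)%E (sum_psi_range_le N r))); first by rewrite lee_fin.
  rewrite tauE -!EFinM lee_fin -mulrA -lqk powRN [2 * (q - 1)]mulrC -powR_sqr ?(ltW l0)//.
  exact: trunc_ratio.
have t2 : expR (- kappa) * ((N * N).+1 ^ p * p * 2)%:R * N.+1%:R <= (2 ^ p * p * 4)%:R * (2^-1) ^+ k.
  by rewrite -Nk; exact: config_bound.
have t3 : 4 * p%:R * r / (N * N)%:R * xin x N 2 * EL <= 4 * p%:R * C1 * EL * (2^-1) ^+ k.
  rewrite -Nk natrM; apply: grid_error_arith => //; first exact: ltW.
  exact: xin_ge0.
rewrite ELE -EFinM; apply: (@le_trans _ _ ((4 * (ln 2) `^ (- (2 * (q - 1))) * k%:R `^ (- (2 * (q - 1))))%:E +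
   ((2 ^ p * p * 4)%:R * (2^-1) ^+ k)%:E + (4 * p%:R * C1 * EL * (2^-1) ^+ k)%:E)%E).
  by apply: leeD; [apply: leeD => //; rewrite lee_fin|rewrite lee_fin].
by rewrite -!EFinD lee_fin /u [c0 * _]mulrDl addrA.
Unshelve. all: by end_near. Qed.

(** The box argument numbers coordinates by [nat]; those beyond [p] are set to [0] and are never
    summed. *)
Definition coord_seq (v : 'cV[R]_p) (j : nat) : R := oapp (fun k : 'I_p => v k 0) 0 (insub j).

Lemma coord_seqE v (k : 'I_p) : coord_seq v k = v k 0.
Proof. by rewrite /coord_seq valK. Qed.

Lemma normr_coord_seq v j : `|coord_seq v j| <= normv v.
Proof.
rewrite /coord_seq; case: insub => [k|] /=; first exact: normr_coord.
by rewrite normr0 normv_ge0.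
Qed.

Lemma shiftx_dotv i beta :
  shiftx (fun i => coord_seq (x i)) p i (coord_seq beta) = dotv (x i) beta.
Proof. by apply: eq_bigr => j _; rewrite !coord_seqE. Qed.

Variables (Delta : nat -> R) (DeltaS c4 : R).
Hypothesis Cpsi : forall l (i : int) w, (l <= p)%N -> Ck l (fun s => psi1 s (Fpast eps i w)).
Hypothesis Hsd : forall l, (l <= p)%N -> summable_dep iidE s0 (hder psi1 l) (Delta l).
Hypothesis Hscore : summable_dep iidE s0 (fun=> psi \o G) DeltaS.
Hypothesis mean0 : mean (psi \o G) = 0.
Hypothesis c40 : 0 < c4.
Hypothesis xi4 : \forall n \near \oo, c4 * n%:R <= xin x n 4.

Lemma near_absx : \forall n \near \oo, forall i, (0 < i <= n)%N ->
  2 * bn iota n * absx (fun i => coord_seq (x i)) p i <= s0.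
Proof.
have p0' : 0 < p%:R :> R by rewrite ltr0n.
have := near_radius (divr_gt0 s00 p0'); apply: filterS => n h i i0.
have b0 := bn_ge0 iota n.
apply: (@le_trans _ _ (2 * bn iota n * (p%:R * normv (x i)))).
  apply: ler_wpM2l; first by rewrite mulr_ge0.
  apply: (@le_trans _ _ (\sum_(j < p) normv (x i))).
    by apply: ler_sum => j _; exact: normr_coord_seq.
  by rewrite sumr_const card_ord mulr_natl.
have := ltW (h i i0); rewrite ler_pdivlMr// => h'.
by apply: le_trans h'; rewrite le_eqVlt; apply/orP; left; apply/eqP; ring.
Qed.

Lemma near_Bn_gt0 : \forall n \near \oo, 0 < Bn x iota n.
Proof.
near=> n; have n16 : (16 <= n)%N by near: n; exact: near_ge16.
have x4 : c4 * n%:R <= xin x n 4 by near: n.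
have n0 := natr_gt0_16 R n16.
rewrite /Bn !mulr_gt0 ?bn_gt0// ?powR_gt0 ?ln_gt0' ?lnln_gt0//.
by rewrite sqrtr_gt0 (lt_le_trans _ x4)// mulr_gt0.
Unshelve. all: by end_near. Qed.

Lemma smooth_ae : {ae P, forall w, \forall k \near \oo, forall n beta j,
    (n <= 2 ^ k)%N -> normv beta <= 2 * bn iota (2 ^ k) ->
    `|smooth_part n beta j w| <= Bn x iota (2 ^ k)}.
Proof.
have l2 := ln2_gt0 R.
pose C : R := 4 * \sum_(l < p.+1) Delta l ^+ 2.
have C0 : 0 <= C by rewrite mulr_ge0// sumr_ge0// => l _; exact: sqr_ge0.
have K0 : 0 <= Kcst s0 by rewrite /Kcst addr_ge0// mulr_ge0// sqr_ge0.
(* [16] is [4 * 2^2], from the radius [2 * bn]. The three factors [p] come from the telescoping over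
   coordinates, the sum of their costs and the output coordinates. *)
pose D : R := 16 * p%:R ^+ 3 * Kcst s0 ^+ p * C.
have Kp : 0 <= Kcst s0 ^+ p by exact: exprn_ge0.
have p3 : 0 <= p%:R ^+ 3 :> R by exact: exprn_ge0.
have D0 : 0 <= D by rewrite mulr_ge0// mulr_ge0// mulr_ge0.
pose u (k : nat) : R := D * (4 / ln 2 ^+ 3) * (k%:R^-1 * (ln (ln (2 ^+ k : R))) `^ (- (1 + iota))).
have D4 : 0 <= D * (4 / ln 2 ^+ 3) by rewrite mulr_ge0// divr_ge0// exprn_ge0// ltW.
apply: (ae_eventually_of_majorants (u := u)).
- by apply: bounded_sumsZ => //; apply: bounded_sums_bertrand; rewrite ltrDl.
- by move=> k; rewrite mulr_ge0// mulr_ge0 ?powR_ge0// invr_ge0.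
near=> k.
have N16 : (16 <= 2 ^ k)%N by near: k; exact: (near_dyadic near_ge16).
have k0 : (0 < k)%N by near: k; exact: nbhs_infty_ge.
have rad : forall i, (0 < i <= 2 ^ k)%N ->
    2 * bn iota (2 ^ k) * absx (fun i => coord_seq (x i)) p i <= s0.
  by near: k; exact: (near_dyadic near_absx).
have B0 : 0 < Bn x iota (2 ^ k) by near: k; exact: (near_dyadic near_Bn_gt0).
have b0 : 0 <= 2 * bn iota (2 ^ k) by rewrite mulr_ge0// bn_ge0.
pose v : R := p%:R * (4 * (2 * bn iota (2 ^ k)) ^+ 2 *
  (Kcst s0 ^+ p * (p%:R * (k.+1%:R ^+ 2 * (C * xin x (2 ^ k) 4))))).
have HV (j : 'I_p) : exists V : T -> \bar R, [/\ measurable_fun setT V, (forall w, (0 <= V w)%E),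
    (\int[P]_w V w <= v%:E)%E &
    forall w beta n, (n <= 2 ^ k)%N -> normv beta <= 2 * bn iota (2 ^ k) ->
      ((smooth_part n beta j w ^+ 2)%:E <= V w)%E].
  have [V [mV V0 IV HV]] := smooth_majorant (fun i => x i j 0) mpsi1 (ltW s00) b0 Cpsi Hsd rad.
  exists V; split => //.
  - apply: (le_trans IV); rewrite lee_fin /v; apply: ler_wpM2l => //.
    apply: ler_wpM2l; first by rewrite mulr_ge0// sqr_ge0.
    apply: ler_wpM2l; first exact: exprn_ge0.
    apply: (@le_trans _ _ (\sum_(j < p) k.+1%:R ^+ 2 * (C * xin x (2 ^ k) 4))); last first.
      by rewrite sumr_const card_ord mulr_natl.
    apply: ler_sum => j' _; rewrite /cost; apply: ler_wpM2l; first exact: sqr_ge0.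
    rewrite /block -mulr_sumr; apply: ler_wpM2l => //; apply: ler_sum => i _.
    have a0 := normv_ge0 (x i).
    rewrite exprMn (_ : normv (x i) ^+ 4 = normv (x i) ^+ 2 * normv (x i) ^+ 2); last by rewrite -exprD.
    apply: ler_pM; rewrite ?sqr_ge0//.
      by rewrite -real_normK ?num_real// lerXn2r ?nnegrE// normr_coord.
    by rewrite -real_normK ?num_real// lerXn2r ?nnegrE// normr_coord_seq.
  - move=> w beta n nN bb; have := HV w (coord_seq beta) n _ nN.
    rewrite /smooth_part; under eq_fun do rewrite shiftx_dotv; apply => j' _.
    by apply: le_trans bb; exact: normr_coord_seq.
have [V HV'] := choice HV.
have [X [mX X0 IX HX]] := majorant_family (P := P) (V := V) (v := v) B0 (fun j =>
  let: And4 a b c _ := HV' j in And3 a b c).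
exists X; split => //; last first.
  apply: aeW => w /HX {}HX n beta j nN bb.
  have [_ _ _ Vj] := HV' j; have := le_trans (Vj w beta n nN bb) (HX j).
  rewrite lee_fin -[X in X <= _]real_normK ?num_real// ler_sqr ?nnegrE// ltW//.
apply: (le_trans IX); rewrite lee_fin card_ord.
have Bs := Bn_sqr iota x N16.
have b2 : 0 < bn iota (2 ^ k) ^+ 2 * xin x (2 ^ k) 4.
  rewrite lt_def mulr_ge0 ?sqr_ge0 ?xin_ge0// andbT; apply/eqP => z0.
  by have := Bs; rewrite z0 !mul0r => /eqP; rewrite sqrf_eq0 gt_eqF.
have y0 : 0 < ln (ln (2 ^+ k : R)) by rewrite -natrX lnln_gt0.
have yp : 0 < ln (ln (2 ^+ k : R)) `^ (1 + iota) by rewrite powR_gt0.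
have br := @bertrand_ratio R k k0.
rewrite /u Bs powRN natrX.
set Y := _ `^ (1 + iota) in yp *; rewrite ln_exp2.
apply: (@le_trans _ _ (D * (k.+1%:R ^+ 2 / (k%:R * ln 2) ^+ 3) * Y^-1)).
  rewrite le_eqVlt; apply/orP; left; apply/eqP.
  have kl : k%:R * ln 2 != 0 :> R by rewrite mulf_neq0 ?gt_eqF// ltr0n.
  move: b2; rewrite /v /D; move: (xin x (2 ^ k) 4) (bn iota (2 ^ k)) kl yp => z b kl yp b2.
  have z0 : z != 0 by apply: contraTneq b2 => ->; rewrite mulr0 ltxx.
  have bz : b != 0 by apply: contraTneq b2 => ->; rewrite expr0n mul0r ltxx.
  move: (k%:R * ln 2) kl => kl kl0; field.
  by rewrite kl0 z0 bz gt_eqF.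
rewrite -[leLHS]mulrA -[leRHS]mulrA; apply: ler_wpM2l => //.
rewrite [leRHS]mulrA; apply: ler_wpM2r; first by rewrite invr_ge0 ltW.
exact: br.
Unshelve. all: by end_near. Qed.

(** A variance of order [n], times the squared number of levels, against [(n * b_n)^2] gives
    Bertrand's series with exponent [1 + 2 * iota]. Every [c > 0] is allowed, as the drift has to
    dominate. *)
Lemma score_ae (c : R) : 0 < c -> {ae P, forall w, \forall k \near \oo, forall n (j : 'I_p),
    (n <= 2 ^ k)%N ->
    `|\sum_(1 <= i < n.+1) x i j 0 * psi (e i%:Z w)| <= c * ((2 ^ k)%N%:R * bn iota (2 ^ k))}.
Proof.
move=> c0; have l2 := ln2_gt0 R.
pose D : R := c ^- 2 * p%:R * DeltaS ^+ 2 * C1.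
have ci0 : 0 <= c ^- 2 by rewrite invr_ge0 sqr_ge0.
have D0 : 0 <= D by rewrite mulr_ge0// mulr_ge0 ?sqr_ge0// mulr_ge0.
pose u (k : nat) : R := D * (4 / ln 2 ^+ 3) * (k%:R^-1 * (ln (ln (2 ^+ k : R))) `^ (- (1 + 2 * iota))).
have D4 : 0 <= D * (4 / ln 2 ^+ 3) by rewrite mulr_ge0// divr_ge0// exprn_ge0// ltW.
apply: (ae_eventually_of_majorants (u := u)).
- by apply: bounded_sumsZ => //; apply: bounded_sums_bertrand; rewrite ltrDl mulr_gt0.
- by move=> k; rewrite mulr_ge0// mulr_ge0 ?powR_ge0// invr_ge0.
near=> k.
have N16 : (16 <= 2 ^ k)%N by near: k; exact: (near_dyadic near_ge16).
have k0 : (0 < k)%N by near: k; exact: nbhs_infty_ge.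
have x2 : xin x (2 ^ k) 2 <= C1 * (2 ^ k)%N%:R by near: k; exact: (near_dyadic xi2).
have N0 := natr_gt0_16 R N16.
have b0 : 0 < bn iota (2 ^ k) by rewrite bn_gt0.
pose B := c * ((2 ^ k)%N%:R * bn iota (2 ^ k)).
have B0 : 0 < B by rewrite mulr_gt0// mulr_gt0.
pose v : R := k.+1%:R ^+ 2 * (DeltaS ^+ 2 * (C1 * (2 ^ k)%N%:R)).
have HV (j : 'I_p) : exists V : T -> \bar R, [/\ measurable_fun setT V, (forall w, (0 <= V w)%E),
    (\int[P]_w V w <= v%:E)%E &
    forall w n, (n <= 2 ^ k)%N ->
      (((\sum_(1 <= i < n.+1) x i j 0 * psi (e i%:Z w)) ^+ 2)%:E <= V w)%E].
  have [V [mV V0 IV HV]] := score_majorant k (fun i => x i j 0) (ltW s00) Hscore.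
  exists V; split => //.
  - apply: (le_trans IV); rewrite lee_fin /cost /v; apply: ler_wpM2l; first exact: sqr_ge0.
    rewrite /block -mulr_sumr; apply: ler_wpM2l; first exact: sqr_ge0.
    apply: le_trans x2; apply: ler_sum => i _.
    by rewrite -real_normK ?num_real// lerXn2r ?nnegrE ?normv_ge0// normr_coord.
  - move=> w n nN; have := HV w n nN; rewrite mean0 /block.
    by under eq_bigr do rewrite subr0.
have [V HV'] := choice HV.
have [X [mX X0 IX HX]] := majorant_family (P := P) (V := V) (v := v) B0 (fun j =>
  let: And4 a b c _ := HV' j in And3 a b c).
exists X; split => //; last first.
  apply: aeW => w /HX {}HX n j nN.
  have [_ _ _ Vj] := HV' j; have := le_trans (Vj w n nN) (HX j).
  rewrite lee_fin -[X in X <= _]real_normK ?num_real// ler_sqr ?nnegrE// ltW//.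
apply: (le_trans IX); rewrite lee_fin card_ord.
have bs := bn_sqr iota N16.
have y0 : 0 < ln (ln (2 ^+ k : R)) by rewrite -natrX lnln_gt0.
have yp : 0 < ln (ln (2 ^+ k : R)) `^ (1 + 2 * iota) by rewrite powR_gt0.
have br := @bertrand_ratio R k k0.
have E : p%:R * v / B ^+ 2 = D * (k.+1%:R ^+ 2 / (bn iota (2 ^ k) ^+ 2 * (2 ^ k)%N%:R)).
  rewrite /v /D /B; move: (bn iota (2 ^ k)) ((2 ^ k)%N%:R : R) b0 N0 => b z b0' z0'; field.
  by rewrite !gt_eqF.
rewrite E /u bs powRN natrX.
set Y := _ `^ (1 + 2 * iota) in yp *; rewrite ln_exp2.
rewrite -mulrA; apply: ler_wpM2l => //.
rewrite invfM mulrA [leRHS]mulrA; apply: ler_wpM2r; first by rewrite invr_ge0 ltW.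
exact: br.
Unshelve. all: by end_near. Qed.

Lemma mean_psi10 : mean (psi1 0) = 0.
Proof.
have z0 : `|(0:R)| < s0 by rewrite normr0.
by rewrite -(mean_psi1 z0) -[RHS]mean0; congr past_mean; apply/funext => F; rewrite addr0.
Qed.

(** The dyadic bounds hold for all times up to [2 ^ k] and on the doubled ball, so the bound at
    [nbar n] already covers [n]. *)
Lemma stochastic_equicontinuity (q : R) : 3/2 < q -> exists2 C : R, 0 < C &
  {ae P, forall w, \forall n \near \oo, forall beta, normv beta <= bn iota n ->
    normv (Kt P psi x e n beta w - Kt P psi x e n 0 w) <=
    C * (Num.sqrt (tau_dyadic (up_log 2 n)) * ln ((nbar n)%:R) `^ q + Bn x iota (nbar n))}.
Proof.
move=> q32; have [K K0 HM] := mart_ae q32.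
have BL := Bn_ge_ln iota0 c40 xi4.
pose C5 : R := (Num.sqrt c4)^-1.
have C50 : 0 <= C5 by rewrite invr_ge0 sqrtr_ge0.
pose C := p%:R * (K + K * C5 + 1).
have p0' : 0 < p%:R :> R by rewrite ltr0n.
have KC : 0 <= K * C5 by rewrite mulr_ge0.
exists C; first by rewrite mulr_gt0// ltr_wpDl// addr_ge0.
apply: filterS2 HM smooth_ae => w HM HS.
have HM' := near_up_log HM; have HS' := near_up_log HS.
have HR := near_up_log (near_dyadic (near_radius s00)).
have HB := near_up_log (near_dyadic BL).
near=> n.
have n16 : (16 <= n)%N by near: n; exact: near_ge16.
have /andP[nN N2n] := nbar_bounds (leq_trans (isT : (2 <= 16)%N) n16).
have HM'n : forall m beta j, (m <= nbar n)%N -> normv beta <= 2 * bn iota (nbar n) ->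
    `|mart_part m beta j w| <= K * (Num.sqrt (tau_dyadic (up_log 2 n)) * ln (nbar n)%:R `^ q + ln (nbar n)%:R).
  by near: n; exact: HM'.
have HS'n : forall m beta j, (m <= nbar n)%N -> normv beta <= 2 * bn iota (nbar n) ->
    `|smooth_part m beta j w| <= Bn x iota (nbar n).
  by near: n; exact: HS'.
have HRn : forall i, (0 < i <= nbar n)%N -> normv (x i) * (2 * bn iota (nbar n)) < s0.
  by near: n; exact: HR.
have HBn : ln (nbar n)%:R <= C5 * Bn x iota (nbar n) by near: n; exact: HB.
move=> beta bb.
have b2 : normv beta <= 2 * bn iota (nbar n).
  by apply: (le_trans bb); apply: (bn_le_double iota0 n16); rewrite nN N2n.
have rad i : (0 < i <= n)%N -> `|dotv (x i) beta| < s0.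
  move=> /andP[i0 i_n]; apply: (@le_lt_trans _ _ (normv (x i) * (2 * bn iota (nbar n)))).
    apply: (le_trans (cauchy_schwarz _ _)); apply: ler_wpM2l => //; exact: normv_ge0.
  by apply: HRn; rewrite i0 (leq_trans i_n).
set B := Bn x iota (nbar n) in HS'n HBn *.
have B0 : 0 <= B by exact: Bn_ge0.
set sl := Num.sqrt _ * _ in HM'n *.
have sl0 : 0 <= sl by rewrite mulr_ge0 ?sqrtr_ge0 ?powR_ge0.
rewrite /C -mulrA; apply: normv_le_coord => j; rewrite Kt_diff_coord//.
apply: (le_trans (ler_normD _ _)).
apply: (le_trans (lerD (HM'n n beta j nN b2) (HS'n n beta j nN b2))).
exact: equicontinuity_arith.
Unshelve. all: by end_near. Qed.

(** * The square-root modulus, consistency and expansion *)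

Section small_increments.
Variables (Cm dm : R).
Hypothesis dm0 : 0 < dm.
Hypothesis Cm0 : 0 <= Cm.
Hypothesis msqrt : forall t, `|t| < dm -> (mnorm P psi e t <= (Cm * Num.sqrt `|t|)%:E)%E.

Lemma taut_le n delta : 0 <= delta ->
  (forall i, (0 < i <= n)%N -> normv (x i) * delta < dm) ->
  (taut P psi e x n delta <= (2 * Cm ^+ 2 * delta * xin x n 3)%:E)%E.
Proof.
move=> d0 Hx.
have h t : `|t| < dm -> (mnorm P psi e t * mnorm P psi e t <= (Cm ^+ 2 * `|t|)%:E)%E.
  move=> td; rewrite -[X in (_ <= (_ * X)%:E)%E](sqr_sqrtr (normr_ge0 t)) -exprMn expr2 EFinM.
  by apply: lee_pmul; rewrite ?Lnorm_ge0// msqrt.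
rewrite /taut /xin mulr_sumr -sumEFin big_nat_cond [leRHS]big_nat_cond.
apply: lee_sum => i /andP[i0 _].
have a0 : 0 <= normv (x i) by exact: normv_ge0.
have ad : `|normv (x i) * delta| < dm by rewrite ger0_norm ?mulr_ge0// Hx.
have -> : (2 * Cm ^+ 2 * delta * normv (x i) ^+ 3)%:E =
    ((normv (x i) ^+ 2)%:E * ((Cm ^+ 2 * (normv (x i) * delta))%:E + (Cm ^+ 2 * (normv (x i) * delta))%:E))%E.
  by rewrite -EFinD -EFinM; congr (_%:E); ring.
apply: lee_wpmul2l; first by rewrite lee_fin sqr_ge0.
have E : normv (x i) * delta = `|normv (x i) * delta| by rewrite ger0_norm ?mulr_ge0.
apply: leeD; rewrite [X in (_ <= (_ * X)%:E)%E]E; first exact: h.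
by rewrite -normrN; apply: h; rewrite normrN.
Qed.

(** With [xi_n(3) <= r~_n * xi_n(2)], the square of the left side over [(n * b_n)^2] has order
    [(ln n)^(2 q - 2 - 3/2)] up to iterated logarithms; at [q = 8/5] the exponent is [-3/10]. *)
Lemma tau_small (c : R) : 0 < c -> \forall k \near \oo,
  Num.sqrt (tau_dyadic k) * lnd k `^ (8/5) <= c * ((2 ^ k)%N%:R * bn iota (2 ^ k)).
Proof.
move=> c0; pose D := 4 * Cm ^+ 2 * C1 * C2.
have D0 : 0 <= D by rewrite mulr_ge0// mulr_ge0// mulr_ge0// sqr_ge0.
have e0 : 0 < c ^+ 2 / (D + 1) by rewrite divr_gt0 ?exprn_gt0// ltr_wpDl.
have h1 : - (3/10) < 0 :> R by lra.
have h := near_dyadic (ln_lnln_small (- (1/2 + iota)) h1 e0).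
have hr := near_dyadic (near_radius dm0).
have hm := near_dyadic xmax; have h2 := near_dyadic xi2.
near=> k.
have N16 : (16 <= 2 ^ k)%N by near: k; exact: (near_dyadic near_ge16).
have hk : lnd k `^ (- (3/10)) * ln (lnd k) `^ (- (1/2 + iota)) <= c ^+ 2 / (D + 1) by near: k.
have hrk : forall i, (0 < i <= 2 ^ k)%N -> normv (x i) * (2 * bn iota (2 ^ k)) < dm by near: k.
have hmk : rtilde x (2 ^ k) <= C2 * ((2 ^ k)%N%:R `^ (1/2) * ln ((2 ^ k)%N%:R) `^ (-2)) by near: k.
have h2k : xin x (2 ^ k) 2 <= C1 * (2 ^ k)%N%:R by near: k.
have n0 := natr_gt0_16 R N16; have l0 := ln_gt0' R N16; have y0 := lnln_gt0 R N16.
have b0 : 0 < bn iota (2 ^ k) by rewrite bn_gt0.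
have tle : tau_dyadic k <= 2 * Cm ^+ 2 * (2 * bn iota (2 ^ k)) * xin x (2 ^ k) 3.
  rewrite -lee_fin /tau_dyadic; have := taut_le (ltW (mulr_gt0 (ltr0n _ 2) b0)) hrk.
  have := taut_ge0 (2 ^ k) (2 * bn iota (2 ^ k)).
  by case: (taut _ _ _ _ _ _) => [t| |].
have t0 : 0 <= tau_dyadic k by rewrite fine_ge0// taut_ge0.
have x3 : xin x (2 ^ k) 3 <= rtilde x (2 ^ k) * xin x (2 ^ k) 2 by exact: (xin_addn x _ 1 2).
have bs := bn_sqrt iota N16.
set N := (2 ^ k)%N in N16 hk hrk hmk h2k n0 l0 y0 b0 tle x3 bs *.
set l := ln N%:R in hk hmk l0 y0 bs *; set y := ln l in hk y0 bs *.
set b := bn iota N in b0 tle bs *.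
have lp (a : R) : 0 < l `^ a by exact: powR_gt0.
have yp (a : R) : 0 < y `^ a by exact: powR_gt0.
have s_p : 0 < N%:R `^ (1/2) :> R by exact: powR_gt0.
have ss : (N%:R `^ (1/2)) ^+ 2 = N%:R :> R by exact: powR_half_sqr (ltW n0).
have p1 : 0 <= c * (N%:R * b) by rewrite mulr_ge0 ?(ltW c0)// mulr_ge0// ltW.
rewrite -(@ler_pXn2r _ 2) ?nnegrE ?p1 ?(mulr_ge0 (sqrtr_ge0 _) (ltW (lp _)))//.
rewrite exprMn sqr_sqrtr// powR_sqr ?(ltW l0)//.
have x3' : xin x N 3 <= C2 * (N%:R `^ (1/2) * l `^ (-2)) * (C1 * N%:R).
  apply: (le_trans x3); apply: ler_pM; rewrite ?rtilde_ge0 ?xin_ge0//.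
have tle' : tau_dyadic k <= D * b * (N%:R `^ (1/2) * l `^ (-2) * N%:R).
  apply: (le_trans tle).
  have -> : D * b * (N%:R `^ (1/2) * l `^ (-2) * N%:R) =
     2 * Cm ^+ 2 * (2 * b) * (C2 * (N%:R `^ (1/2) * l `^ (-2)) * (C1 * N%:R)) by rewrite /D; ring.
  by apply: ler_wpM2l => //; rewrite mulr_ge0 ?mulr_ge0 ?sqr_ge0// ltW.
apply: (@le_trans _ _ (D * b * (N%:R `^ (1/2) * l `^ (-2) * N%:R) * l `^ (8 / 5 * 2))).
  by apply: ler_wpM2r => //; exact: ltW.
have lE : l `^ (-2) * l `^ (8/5*2) = l `^ (3/2) * l `^ (- (3/10)).
  by rewrite !powRDp//; congr (_ `^ _); field.
have yE : y `^ (1/2 + iota) * y `^ (- (1/2 + iota)) = 1.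
  by rewrite powRDp// subrr powRr0.
have -> : D * b * (N%:R `^ (1/2) * l `^ (-2) * N%:R) * l `^ (8 / 5 * 2) =
   N%:R * b * (D * (l `^ (- (3/10)) * y `^ (- (1/2 + iota)))) * (b * N%:R).
  transitivity (D * b * N%:R * N%:R `^ (1/2) * (l `^ (-2) * l `^ (8/5*2))); first by ring.
  rewrite lE.
  transitivity (N%:R * b * D * l `^ (- (3/10)) * y `^ (- (1/2 + iota)) * N%:R `^ (1/2) *
      (l `^ (3/2) * y `^ (1/2 + iota))); last first.
    rewrite -bs; transitivity (N%:R * b * (D * (l `^ (- (3/10)) * y `^ (- (1/2 + iota)))) *
      (b * (N%:R `^ (1/2)) ^+ 2)); first by ring.
    by rewrite ss.
  transitivity (N%:R * b * D * l `^ (- (3/10)) * N%:R `^ (1/2) * l `^ (3/2) *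
    (y `^ (1/2 + iota) * y `^ (- (1/2 + iota)))); last by ring.
  by rewrite yE; ring.
have -> : (c * (N%:R * b)) ^+ 2 = N%:R * b * c ^+ 2 * (b * N%:R) by ring.
apply: ler_wpM2r; first by rewrite mulr_ge0// ltW.
apply: ler_wpM2l; first by rewrite mulr_ge0// ltW.
apply: (@le_trans _ _ (D * (c ^+ 2 / (D + 1)))); first exact: ler_wpM2l.
by apply: mulr_fraction_le; rewrite ?sqr_ge0.
Unshelve. all: by end_near. Qed.

Section expansion.
Variables (f1 Cp dp c0 : R).
Hypothesis f10 : 0 < f1.
Hypothesis Cp0 : 0 <= Cp.
Hypothesis dp0 : 0 < dp.
Hypothesis c00 : 0 < c0.
Hypothesis Hphi : forall t, `|t| < dp -> `|phi P psi e t - t * f1| <= Cp * t ^+ 2.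
Hypothesis Hco : \forall n \near \oo, forall v, c0 * n%:R * dotv v v <= gram_form x n v.

Lemma phi_mean t : `|t| < s0 -> phi P psi e t = mean (psi1 t).
Proof.
move=> ts; rewrite -mean_psi1// /phi unlock.
apply: (integral_past_mean iidE 1 (u := fun F => psi (G F + t))).
exact: measurable_psiG.
Qed.

(** Each summand has a remainder quadratic in [x_i' beta], multiplied by one more [|x_i|]: hence
    [xi_n(3)]. *)
Lemma EOmegat_expansion n beta :
  (forall i, (0 < i <= n)%N -> `|dotv (x i) beta| < s0) ->
  (forall i, (0 < i <= n)%N -> `|dotv (x i) beta| < dp) ->
  normv (EOmegat P psi x e n beta + f1 *: (Sigma x n *m beta)) <=
  Cp * (xin x n 3 * normv beta ^+ 2).
Proof.
move=> Hs Hd.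
have -> : EOmegat P psi x e n beta + f1 *: (Sigma x n *m beta) =
    \sum_(1 <= i < n.+1) (mean (psi1 (- dotv (x i) beta)) + f1 * dotv (x i) beta) *: x i.
  apply/matrixP => k j; rewrite ord1 mxE EOmegat_coord// Sigma_mulmx mxE !summxE mulr_sumr.
  rewrite /block -big_split /=; apply: eq_bigr => i _; rewrite !mxE; ring.
apply: (le_trans (normv_sum _ _)); rewrite /xin mulr_suml mulr_sumr.
rewrite big_nat [leRHS]big_nat; apply: ler_sum => i i0.
have a0 := normv_ge0 (x i); have d1 := Hs i i0; have d2 := Hd i i0.
rewrite normvZ -phi_mean ?normrN//.
have := Hphi (_ : `|- dotv (x i) beta| < dp); rewrite normrN => /(_ d2).
rewrite mulNr opprK [_ * f1]mulrC sqrrN => h.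
have cs : dotv (x i) beta ^+ 2 <= (normv (x i) * normv beta) ^+ 2.
  by rewrite -real_normK ?num_real// lerXn2r ?nnegrE ?mulr_ge0 ?normv_ge0// cauchy_schwarz.
apply: (@le_trans _ _ (Cp * (normv (x i) * normv beta) ^+ 2 * normv (x i))).
  apply: ler_wpM2r => //; apply: (le_trans h); exact: ler_wpM2l.
by rewrite le_eqVlt; apply/orP; left; apply/eqP; ring.
Qed.

Lemma EOmegat0 n : EOmegat P psi x e n 0 = 0.
Proof.
apply/matrixP => k j; rewrite ord1 EOmegat_coord; last first.
  by move=> i _; rewrite dotv0r normr0.
rewrite mxE /block big1// => i _; by rewrite dotv0r oppr0 mean_psi10 mulr0.
Qed.

Lemma Omegat_decomp n beta w : Omegat psi x e n beta w =
  (Kt P psi x e n beta w - Kt P psi x e n 0 w) + Omegat psi x e n 0 w + EOmegat P psi x e n beta.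
Proof.
by apply/matrixP => k j; rewrite /Kt EOmegat0 !mxE; ring.
Qed.

(** The convexity of the criterion along rays, expressed through its gradient: the argument of [psi]
    moves against the sign of the weight [x_i' u]. *)
Lemma Omegat_ray_mono n u w (a b : R) : a <= b ->
  dotv u (Omegat psi x e n (b *: u) w) <= dotv u (Omegat psi x e n (a *: u) w).
Proof.
move=> ab; rewrite /Omegat !dotv_sumr; apply: ler_sum => i _.
rewrite !dotvZr (dotvC u); set z := dotv (x i) u.
case: (lerP 0 z) => z0.
  apply: ler_wpM2r => //; apply: psi_homo; rewrite lerD2l lerN2; exact: ler_wpM2r.
apply: ler_wnM2r; first exact: ltW.
by apply: psi_homo; rewrite lerD2l lerN2; apply: ler_wnM2r => //; exact: ltW.
Qed.

Lemma near_rad (s : R) : 0 < s -> \forall n \near \oo, forall i beta, (0 < i <= n)%N ->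
  normv beta <= bn iota n -> `|dotv (x i) beta| < s.
Proof.
move=> sp; have := near_radius sp; apply: filterS => n h i beta i0 bb.
apply: le_lt_trans (h i i0); apply: (le_trans (cauchy_schwarz _ _)).
apply: ler_wpM2l; first exact: normv_ge0.
by apply: (le_trans bb); rewrite ler_peMl ?bn_ge0//; lra.
Qed.

Variable bh : nat -> T -> 'cV[R]_p.

(** The score condition sits inside the [ae] statement because its constant may depend on the
    path. *)
Lemma consistency_ae : {ae P, forall w,
  (exists Cw : R, \forall n \near \oo, normv (Omegat psi x e n (bh n w) w) <= Cw * rtilde x n) ->
  \forall n \near \oo, normv (bh n w) <= bn iota n}.
Proof.
(* Any exponent in ]3/2, 7/4[ would do: [tau_small] needs the upper bound. *)
have q32 : 3/2 < 8/5 :> R by lra.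
have [C C0 HK] := stochastic_equicontinuity q32.
(* In units of [n * b_n] the drift is [8 * dl]. The score at the estimator, the increment of [Kt],
   the score at [0] and the expansion remainder get at most [dl] each, so that
   [-dl <= 3 * dl - 8 * dl] is absurd. *)
pose dl := f1 * c0 / 8; have dl0 : 0 < dl by rewrite divr_gt0// mulr_gt0.
(* The dyadic bounds are in terms of [nbar n * bn (nbar n)], at most [H * (n * bn n)]: [2] for
   [nbar n], the rest from [bn_le_half]. *)
pose H : R := 2 * (4 * 2 `^ (1/2 + iota)).
have H0 : 0 < H by rewrite !mulr_gt0// powR_gt0.
have p0' : 0 < p%:R :> R by rewrite ltr0n.
pose c1 := dl / (p%:R * H); have c10 : 0 < c1 by rewrite divr_gt0// mulr_gt0.
pose c2 := dl / (2 * C * H); have c20 : 0 < c2 by rewrite divr_gt0// !mulr_gt0.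
apply: filterS2 HK (score_ae c10) => w HK HS [Cw HW].
have HS' := near_up_log HS.
have HT := near_up_log (tau_small c20).
have HB := near_up_log (near_dyadic (Bn_small iota C10 C20 xi2 xmax c20)).
have e3 : 0 < dl / (Cp + 1) by rewrite divr_gt0// ltr_wpDl.
have [Q3 Q3P H3] : exists2 Q3 : nat -> Prop, (forall n, Q3 n ->
    xin x n 3 * bn iota n ^+ 2 <= dl / (Cp + 1) * (n%:R * bn iota n)) & \forall n \near \oo, Q3 n.
  by eexists; [|exact: (xin3_small iota C10 C20 xi2 xmax e3)].
have e4 : 0 < dl / (`|Cw| + 1) by rewrite divr_gt0// ltr_wpDl.
have [Q4 Q4P H4] : exists2 Q4 : nat -> Prop, (forall n, Q4 n ->
    rtilde x n <= dl / (`|Cw| + 1) * (n%:R * bn iota n)) & \forall n \near \oo, Q4 n.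
  by eexists; [|exact: (rtilde_small iota C20 xmax e4)].
have R1 := near_rad s00; have R2 := near_rad dp0.
near=> n.
have n16 : (16 <= n)%N by near: n; exact: near_ge16.
have /andP[nN N2n] := nbar_bounds (leq_trans (isT : (2 <= 16)%N) n16).
have N16 : (16 <= nbar n)%N by exact: leq_trans nN.
have n0 := natr_gt0_16 R n16.
have b0 : 0 < bn iota n by exact: bn_gt0.
have HKn : forall beta, normv beta <= bn iota n ->
    normv (Kt P psi x e n beta w - Kt P psi x e n 0 w) <=
    C * (Num.sqrt (tau_dyadic (up_log 2 n)) * ln ((nbar n)%:R) `^ (8/5) + Bn x iota (nbar n)).
  by near: n; exact: HK.
have HSn : forall m (j : 'I_p), (m <= nbar n)%N ->
    `|\sum_(1 <= i < m.+1) x i j 0 * psi (e i%:Z w)| <= c1 * ((nbar n)%:R * bn iota (nbar n)).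
  by near: n; exact: HS'.
have HTn : Num.sqrt (tau_dyadic (up_log 2 n)) * ln ((nbar n)%:R) `^ (8/5) <=
    c2 * ((nbar n)%:R * bn iota (nbar n)) by near: n; exact: HT.
have HBn : Bn x iota (nbar n) <= c2 * ((nbar n)%:R * bn iota (nbar n)) by near: n; exact: HB.
have H3n : xin x n 3 * bn iota n ^+ 2 <= dl / (Cp + 1) * (n%:R * bn iota n).
  by apply: Q3P; near: n; exact: H3.
have H4n : rtilde x n <= dl / (`|Cw| + 1) * (n%:R * bn iota n).
  by apply: Q4P; near: n; exact: H4.
have HWn : normv (Omegat psi x e n (bh n w) w) <= Cw * rtilde x n by near: n; exact: HW.
have R1n : forall i beta, (0 < i <= n)%N -> normv beta <= bn iota n -> `|dotv (x i) beta| < s0.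
  by near: n; exact: R1.
have R2n : forall i beta, (0 < i <= n)%N -> normv beta <= bn iota n -> `|dotv (x i) beta| < dp.
  by near: n; exact: R2.
have Hcn : forall v, c0 * n%:R * dotv v v <= gram_form x n v by near: n; exact: Hco.
rewrite leNgt; apply/negP => bhb.
set B := normv (bh n w) in bhb.
have B0 : 0 < B by exact: lt_trans bhb.
pose u := B^-1 *: bh n w.
have u1 : normv u = 1 by rewrite normvZ gtr0_norm ?invr_gt0// mulVf// gt_eqF.
have uu : dotv u u = 1 by rewrite -normv_sqr u1 expr1n.
have bhE : bh n w = B *: u by rewrite scalerA mulfV ?gt_eqF// scale1r.
pose beta := bn iota n *: u.
have nb : normv beta = bn iota n by rewrite normvZ u1 mulr1 gtr0_norm.
have nble : normv beta <= bn iota n by rewrite nb.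
have du v : dotv u v <= normv v.
  by apply: (le_trans (ler_norm _)); apply: (le_trans (cauchy_schwarz _ _)); rewrite u1 mul1r.
have du' v : - normv v <= dotv u v.
  by rewrite lerNl -dotvNr -[leRHS]normvN.
set Xn := n%:R * bn iota n in H3n H4n.
have Xn0 : 0 < Xn by rewrite mulr_gt0.
have NH : (nbar n)%:R * bn iota (nbar n) <= H * Xn.
  have -> : H * Xn = (2 * n%:R) * (4 * 2 `^ (1/2 + iota) * bn iota n) by rewrite /H /Xn; ring.
  apply: ler_pM; rewrite ?bn_ge0//; first by rewrite -natrM ler_nat.
  by apply: bn_le_half => //; rewrite nN N2n.
(* From the sphere out to the estimator the radial score can only decrease, so its upper bound on
   the sphere applies at the estimator. *)
have g1 : dotv u (Omegat psi x e n (bh n w) w) <= dotv u (Omegat psi x e n beta w).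
  by rewrite {1}bhE; apply: Omegat_ray_mono; exact: ltW.
have g2 : - dl * Xn <= dotv u (Omegat psi x e n (bh n w) w).
  apply: le_trans (du' _); rewrite mulNr lerN2; apply: (le_trans HWn).
  apply: (@le_trans _ _ (`|Cw| * (dl / (`|Cw| + 1) * Xn))); last first.
    by rewrite mulrA; apply: ler_wpM2r; [exact: ltW|apply: mulr_fraction_le; rewrite // ltW].
  apply: (@le_trans _ _ (`|Cw| * rtilde x n)); last exact: ler_wpM2l.
  by apply: ler_wpM2r; [exact: rtilde_ge0|exact: ler_norm].
have g3 : dotv u (Kt P psi x e n beta w - Kt P psi x e n 0 w) <= dl * Xn.
  apply: (le_trans (du _)); apply: (le_trans (HKn beta nble)).
  apply: (@le_trans _ _ (C * (2 * c2 * (H * Xn)))).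
    apply: ler_wpM2l; first exact: ltW.
    apply: (le_trans (lerD HTn HBn)).
    have -> : 2 * c2 * (H * Xn) = c2 * (H * Xn) + c2 * (H * Xn) by ring.
    by apply: lerD; apply: ler_wpM2l => //; exact: ltW.
  rewrite le_eqVlt; apply/orP; left; apply/eqP; rewrite /c2; field.
  by rewrite !gt_eqF.
have g4 : dotv u (Omegat psi x e n 0 w) <= dl * Xn.
  apply: (le_trans (du _)).
  apply: (@le_trans _ _ (p%:R * (c1 * (H * Xn)))).
    apply: normv_le_coord => j; rewrite Omegat_coord /block.
    under eq_bigr do rewrite dotv0r oppr0 addr0.
    apply: (le_trans (HSn n j nN)); apply: ler_wpM2l => //; exact: ltW.
  rewrite le_eqVlt; apply/orP; left; apply/eqP; rewrite /c1; field.
  by rewrite !gt_eqF.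
have g5 : dotv u (EOmegat P psi x e n beta) <= dl * Xn - 8 * dl * Xn.
  have -> : EOmegat P psi x e n beta =
     (EOmegat P psi x e n beta + f1 *: (Sigma x n *m beta)) + - (f1 *: (Sigma x n *m beta)).
    by rewrite addrK.
  rewrite dotvDr dotvNr; apply: lerB.
    apply: (le_trans (du _)).
    apply: (le_trans (EOmegat_expansion (fun i i0 => R1n i beta i0 nble) (fun i i0 => R2n i beta i0 nble))).
    rewrite nb; apply: (@le_trans _ _ (Cp * (dl / (Cp + 1) * Xn))); first exact: ler_wpM2l.
    by rewrite mulrA; apply: ler_wpM2r; [exact: ltW|apply: mulr_fraction_le; rewrite // ltW].
  have -> : 8 * dl * Xn = f1 * (bn iota n * (c0 * n%:R * 1)).
    by rewrite /dl /Xn; field.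
  rewrite dotvZr; apply: ler_wpM2l; first exact: ltW.
  rewrite /beta -scalemxAr dotvZr; apply: ler_wpM2l; first exact: ltW.
  apply: (@le_trans _ _ (gram_form x n u)); first by have := Hcn u; rewrite uu.
  rewrite Sigma_mulmx dotv_sumr /gram_form le_eqVlt; apply/orP; left; apply/eqP.
  by apply: eq_bigr => i _; rewrite dotvZr (dotvC u) expr2.
have g6 := Omegat_decomp n beta w.
rewrite g6 2!dotvDr in g1.
exact: (ray_contradiction g2 g1 g3 g4 g5 (mulr_gt0 dl0 Xn0)).
Unshelve. all: by end_near. Qed.

Lemma bahadur_ae (q : R) : 3/2 < q -> {ae P, forall w,
  (exists Cw : R, \forall n \near \oo, normv (Omegat psi x e n (bh n w) w) <= Cw * rtilde x n) ->
  exists2 C : R, 0 < C & \forall n \near \oo,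
    normv (f1 *: (Sigma x n *m bh n w) - \sum_(1 <= i < n.+1) (psi (e i%:Z w) *: x i)) <=
    C * (Num.sqrt (tau_dyadic (up_log 2 n)) * ln ((nbar n)%:R) `^ q +
         (Bn x iota (nbar n) + xin x n 3 * bn iota n ^+ 2 + rtilde x n))}.
Proof.
move=> q32; have [C C0 HK] := stochastic_equicontinuity q32.
apply: filterS2 HK consistency_ae => w HK Hii [Cw HW].
have Hb := Hii (ex_intro _ Cw HW).
exists (C + `|Cw| + Cp); first by rewrite ltr_wpDr// ltr_wpDr.
have R1 := near_rad s00; have R2 := near_rad dp0.
near=> n.
have HKn : forall beta, normv beta <= bn iota n ->
    normv (Kt P psi x e n beta w - Kt P psi x e n 0 w) <=
    C * (Num.sqrt (tau_dyadic (up_log 2 n)) * ln ((nbar n)%:R) `^ q + Bn x iota (nbar n)).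
  by near: n; exact: HK.
have HWn : normv (Omegat psi x e n (bh n w) w) <= Cw * rtilde x n by near: n; exact: HW.
have R1n : forall i beta, (0 < i <= n)%N -> normv beta <= bn iota n -> `|dotv (x i) beta| < s0.
  by near: n; exact: R1.
have R2n : forall i beta, (0 < i <= n)%N -> normv beta <= bn iota n -> `|dotv (x i) beta| < dp.
  by near: n; exact: R2.
have bb : normv (bh n w) <= bn iota n by near: n; exact: Hb.
have O0 : \sum_(1 <= i < n.+1) (psi (e i%:Z w) *: x i) = Omegat psi x e n 0 w.
  by apply: eq_bigr => i _; rewrite dotv0r subr0.
have D := Omegat_decomp n (bh n w) w.
set K := Kt P psi x e n (bh n w) w - Kt P psi x e n 0 w in D.
set E := EOmegat P psi x e n (bh n w) in D.
set O := Omegat psi x e n (bh n w) w in D HWn.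
set v := f1 *: (Sigma x n *m bh n w).
(* The error splits into the increment of [Kt], the remainder in the expansion of the mean score,
   and the score at the estimator. *)
have -> : v - \sum_(1 <= i < n.+1) (psi (e i%:Z w) *: x i) = K + (E + v) + - O.
  by rewrite O0 D; apply/matrixP => k j; rewrite !mxE; ring.
apply: (le_trans (normvD _ _)); rewrite normvN.
have h1 := normvD K (E + v).
have h2 := HKn (bh n w) bb; rewrite -/K in h2.
have h3 := EOmegat_expansion (fun i i0 => R1n i (bh n w) i0 bb) (fun i i0 => R2n i (bh n w) i0 bb).
rewrite -/E -/v in h3.
have h4 : Cp * (xin x n 3 * normv (bh n w) ^+ 2) <= Cp * (xin x n 3 * bn iota n ^+ 2).
  have sq : normv (bh n w) ^+ 2 <= bn iota n ^+ 2.
    by rewrite lerXn2r ?nnegrE ?normv_ge0 ?bn_ge0.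
  exact: (ler_wpM2l Cp0 (ler_wpM2l (xin_ge0 x n 3) sq)).
have h5 : Cw * rtilde x n <= `|Cw| * rtilde x n.
  by apply: ler_wpM2r; [exact: rtilde_ge0|exact: ler_norm].
set sl := Num.sqrt _ * _ in h2 *.
have sl0 : 0 <= sl by rewrite mulr_ge0 ?sqrtr_ge0 ?powR_ge0.
have B0 := Bn_ge0 iota x (nbar n).
have X0 : 0 <= xin x n 3 * bn iota n ^+ 2 by rewrite mulr_ge0 ?xin_ge0 ?sqr_ge0.
have r0 := rtilde_ge0 x n; have aC : 0 <= `|Cw| by [].
apply: (@le_trans _ _ (C * (sl + Bn x iota (nbar n)) + Cp * (xin x n 3 * bn iota n ^+ 2) + `|Cw| * rtilde x n)).
  by lra.
by apply: bahadur_arith => //; exact: ltW.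
Unshelve. all: by end_near. Qed.

End expansion.

End small_increments.

End core.

(** * Verification of the hypotheses *)

(** (A6) supplies a radius for each order of derivative; finitely many orders admit a common one. *)
Lemma uniform_radius (R : realFieldType) (Q : nat -> R -> Prop) (p : nat) :
  (forall l r s, 0 < s <= r -> Q l r -> Q l s) ->
  (forall l, (l <= p)%N -> exists2 r, 0 < r & Q l r) ->
  exists2 r, 0 < r & forall l, (l <= p)%N -> Q l r.
Proof.
move=> anti; elim: p => [|p ih] HQ.
  have [r r0 Qr] := HQ 0%N (leqnn 0); exists r => // l.
  by rewrite leqn0 => /eqP ->.
have [r r0 Qr] := ih (fun l lp => HQ l (leqW lp)).
have [s s0 Qs] := HQ p.+1 (leqnn _).
have m0 : 0 < Num.min r s by rewrite lt_min r0.
exists (Num.min r s) => // l; rewrite leq_eqVlt => /orP[/eqP ->|lp].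
  by apply: anti Qs; rewrite m0 ge_min lexx orbT.
by apply: anti (Qr l lp); rewrite m0 ge_min lexx.
Qed.

Lemma normv_dim0 (R : realType) (p : nat) (v : 'cV[R]_p) : p = 0%N -> normv v = 0.
Proof. by move=> p0; subst p; rewrite /normv /dotv big_ord0 sqrtr0. Qed.

Lemma abse_sup_le (R : realType) (I : Type) (A : set I) (f : I -> R) (i0 : I) (b : \bar R) :
  A i0 -> 0 <= f i0 -> (forall i, A i -> ((f i)%:E <= b)%E) ->
  (`|ereal_sup [set (f i)%:E | i in A]| <= b)%E.
Proof.
move=> Ai0 f0 fb; rewrite gee0_abs; last first.
  apply: (@le_trans _ _ (f i0)%:E); first by rewrite lee_fin.
  by apply: ereal_sup_ubound; exists i0.
by apply: ge_ereal_sup => _ [i Ai <-]; exact: fb.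
Qed.

Section hypotheses.
Context d (T : measurableType d) (R : realType) (P : probability T R)
  dS (S : measurableType dS) (eps eps' : int -> T -> S).
Hypothesis iidE : iid P (joint eps eps').
Local Notation mu := (past_law iidE).
Local Notation nu := (letter_law iidE).

Lemma summable_depS (e0 e1 : R) u D : e1 <= e0 -> summable_dep iidE e0 u D ->
  summable_dep iidE e1 u D.
Proof.
move=> e10 [mu' L2 [delta [d0 dD Hd]]]; split => //.
  by move=> t te; apply: L2; exact: le_trans e10.
by exists delta; split => // t k te; apply: Hd; exact: le_trans e10.
Qed.

Variables (psi : R -> R) (G : (nat -> S) -> R) (psi1 : R -> (nat -> S) -> R).
Local Notation e := (err G eps).
Hypothesis psi_homo : {homo psi : s t / s <= t}.
Hypothesis seqG : seq_measurable_fun G.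
Hypothesis mpsi1 : forall s, seq_measurable_fun (psi1 s).

Lemma measurable_score s : measurable_fun setT (fun F : seqT S => psi (G F + s)).
Proof.
have mpsi : measurable_fun setT psi by exact: nondecreasing_measurable.
apply: measurableT_comp => //; apply: measurable_funD => //.
exact: measurable_seqT_fun.
Qed.

Lemma mnorm_near_fin :
  mnorm P psi e t @[t --> 0] --> mnorm P psi e 0 ->
  exists2 r : R, 0 < r & forall t, `|t| < r -> (mnorm P psi e t < +oo)%E.
Proof.
have -> : mnorm P psi e 0 = 0%E.
  apply/eqP; rewrite eq_le Lnorm_ge0 andbT.
  have := @nrm_le _ _ _ P (fun w => psi (e 1 w + 0) - psi (e 1 w)) 0 (lexx 0).
  rewrite /nrm => ->; rewrite /sqI.
  under eq_integral do rewrite addr0 subrr expr0n /=.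
  by rewrite integral0 expr0n.
move=> /fine_cvgP[+ _] => /nbhs_ballP[r /= r0 Hr]; exists r => // t tr.
have := Hr t; rewrite /ball /= sub0r normrN => /(_ tr).
by rewrite ge0_fin_numE ?Lnorm_ge0.
Qed.

Lemma score_transition s :
  (forall (i : int), P.-integrable setT (EFin \o (fun w => psi (e (i + 1) w + s))) ->
     is_condexp P (sigmaF eps i) (fun w => psi (e (i + 1) w + s))
       (fun w => psi1 s (Fpast eps i w))) ->
  P.-integrable setT (EFin \o (fun w => psi (e 1 w + s))) ->
  mu.-integrable setT (EFin \o (fun F : seqT S => psi (G F + s))) /\
  {ae mu, forall F, trans nu (fun F => psi (G F + s)) F = psi1 s F}.
Proof.
move=> Hc i1; split.
  apply/(integrable_fam iidE (@past_ix_inj 1) (u := fun F => psi (G F + s))) => //.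
  exact: measurable_score.
apply: (condexp_past iidE (i := 0) (k := 1)).
- exact: measurable_score.
- exact: measurable_seqT_fun.
- by apply: Hc; rewrite add0r.
Qed.

Lemma rat_lip_integrable (e0 : R) : 0 < e0 ->
  P.-integrable setT (fun w => ereal_sup
    [set z | exists s t : R, [/\ `|s| <= e0, `|t| <= e0, s != t &
       z = (`|psi1 s (Fpast eps 0 w) - psi1 t (Fpast eps 0 w)| / `|s - t|)%:E]]) ->
  mu.-integrable setT (rat_lip (S:=S) psi1 e0).
Proof.
move=> e00 /integrableP[mZ Zoo].
have mL : measurable_fun setT (rat_lip (S:=S) psi1 e0).
  by apply: measurable_rat_lip => s; exact: measurable_seqT_fun.
have L0 := @rat_lip_ge0 R _ S psi1 e0.
apply/integrableP; split => //; under eq_integral do rewrite gee0_abs//.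
rewrite -(integral_famT iidE (@past_ix_inj 0) mL).
apply: le_lt_trans Zoo; apply: ge0_le_integral => //.
- have mF := measurable_Fpast iidE 0; exact: (measurableT_comp mL mF).
- exact: measurableT_comp.
- move=> w _; apply: le_trans (rat_lip_le_sup psi1 e00 (Fpast eps 0 w)) _.
  exact: lee_abs.
Qed.

End hypotheses.

Lemma xin2_coercive (R : realType) (p : nat) (x : nat -> 'cV[R]_p) (c : R) (n : nat) : (0 < p)%N ->
  (forall v, c * n%:R * dotv v v <= gram_form x n v) -> c * n%:R <= xin x n 2.
Proof.
move=> p0 H; pose v : 'cV[R]_p := delta_mx (Ordinal p0) 0.
have vv : dotv v v = 1.
  rewrite /dotv (bigD1 (Ordinal p0))//= big1 => [|i i0].
    by rewrite !mxE !eqxx mulr1 addr0.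
  by rewrite !mxE (negbTE i0) mul0r.
have := H v; rewrite vv mulr1 => /le_trans; apply.
rewrite /gram_form /xin; apply: ler_sum => i _.
have nv : normv v = 1 by rewrite /normv vv sqrtr1.
rewrite -real_normK ?num_real// lerXn2r ?nnegrE ?normv_ge0//.
by have := cauchy_schwarz (x i) v; rewrite nv mulr1.
Qed.

Section oas.
Context d (T : measurableType d) (R : realType) (P : probability T R).

(** [Ln] is known to be finite only for large [n], and [Oas] asks only about large [n], so the rate
    may be exchanged for a real one. *)
Lemma Oas_of_real (eta : nat -> T -> \bar R) (D : nat -> \bar R) (D' : nat -> R) :
  (\forall n \near \oo, D n = (D' n)%:E) ->
  {ae P, forall w, exists2 C : R, 0 < C & \forall n \near \oo, (`|eta n w| <= (C * D' n)%:E)%E} ->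
  Oas P eta D.
Proof.
move=> DE; apply: filterS => w [C C0 H]; exists C => //.
near=> n.
have -> : D n = (D' n)%:E by near: n.
by rewrite -EFinM; near: n.
Unshelve. all: by end_near. Qed.

End oas.

Lemma Ln_dyadic d (T : measurableType d) (R : realType) (P : probability T R)
  dS (S : measurableType dS) (eps : int -> T -> S) (psi : R -> R) (G : (nat -> S) -> R)
  (p : nat) (x : nat -> 'cV[R]_p) (iota q s0 C2 : R) : 0 < s0 ->
  (forall t, `|t| < s0 -> (mnorm P psi (err G eps) t < +oo)%E) -> 0 <= C2 ->
  (\forall n \near \oo, rtilde x n <= C2 * (n%:R `^ (1/2) * ln (n%:R) `^ (-2))) ->
  \forall n \near \oo, Ln P psi (err G eps) x iota q (nbar n) =
    (Num.sqrt (tau_dyadic P eps psi G x iota (up_log 2 n)) * ln ((nbar n)%:R) `^ q)%:E.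
Proof.
move=> s00 mfin C20 xmax.
have := near_up_log (near_dyadic (near_radius iota C20 xmax s00)).
apply: filterS => n H; rewrite /Ln /tau_dyadic -/(nbar n).
have := taut_fin mfin (_ : 0 <= 2 * bn iota (nbar n)) H.
rewrite mulr_ge0 ?bn_ge0// => /(_ isT).
by case: (taut _ _ _ _ _ _) => [t _ /=| |]//; rewrite EFinM.
Qed.

Theorem theorem3
  (dT : measure_display) (T : measurableType dT) (R : realType)
  (P : probability T R)
  (dS : measure_display) (S : measurableType dS)
  (eps eps' : int -> T -> S) (G : (nat -> S) -> R)
  (p : nat) (x : nat -> 'cV[R]_p)
  (rho psi : R -> R) (psi1 : R -> (nat -> S) -> R)
  (betahat : nat -> T -> 'cV[R]_p)
  (iota q : R) :
  (* setting: (eps_k), (eps'_k) jointly i.i.d.; G measurable *)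
  iid P (joint eps eps') ->
  seq_measurable_fun G ->
  (* psi_1(s; F_i) = E[psi(e_{i+1} + s) | F_i], psi_1(s; .) measurable *)
  (forall s, seq_measurable_fun (psi1 s)) ->
  (forall (i : int) (s : R),
     P.-integrable setT (EFin \o (fun w => psi (err G eps (i + 1) w + s))) ->
     is_condexp P (sigmaF eps i) (fun w => psi (err G eps (i + 1) w + s))
       (fun w => psi1 s (Fpast eps i w))) ->
  (* beta^_n is a minimizer of sum_{i<=n} rho(y_i - x_i' beta), y_i = e_i *)
  (forall n w,
     (exists b : 'cV[R]_p, forall b' : 'cV[R]_p,
        \sum_(1 <= i < n.+1) rho (err G eps i%:Z w - dotv (x i) b)
        <= \sum_(1 <= i < n.+1) rho (err G eps i%:Z w - dotv (x i) b')) ->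
     forall b' : 'cV[R]_p,
       \sum_(1 <= i < n.+1) rho (err G eps i%:Z w - dotv (x i) (betahat n w))
       <= \sum_(1 <= i < n.+1) rho (err G eps i%:Z w - dotv (x i) b')) ->
  (* (A1) *)
  (forall (s t l : R), 0 <= l <= 1 ->
     rho (l * s + (1 - l) * t) <= l * rho s + (1 - l) * rho t) ->
  (forall s t : R, rho t + psi t * (s - t) <= rho s) ->
  {homo psi : s t / s <= t} ->
  ('E_P[fun w => psi (err G eps 1 w)] = 0)%E ->
  (0 < Lnorm P 2%:E (fun w => (psi (err G eps 1 w))%:E) < +oo)%E ->
  (* (A2) *)
  (exists2 d : R, 0 < d & forall t : R, `|t| < d ->
     P.-integrable setT (EFin \o (fun w => psi (err G eps 1 w + t)))) ->
  derivable (phi P psi (err G eps)) 0 1 ->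
  0 < derive1 (phi P psi (err G eps)) 0 ->
  (* (A3) *)
  mnorm P psi (err G eps) t @[t --> 0] --> mnorm P psi (err G eps) 0 ->
  (* (A5) *)
  (exists2 e0 : R, 0 < e0 & forall i : int,
     P.-integrable setT (fun w => ereal_sup
       [set z | exists s t : R, [/\ `|s| <= e0, `|t| <= e0, s != t &
          z = (`|psi1 s (Fpast eps i w) - psi1 t (Fpast eps i w)| / `|s - t|)%:E]])) ->
  (* (A6) for l = 0, ..., p *)
  (forall l : nat, (l <= p)%N ->
     (forall (i : int) w, Ck l (fun s => psi1 s (Fpast eps i w))) /\
     exists2 e0 : R, 0 < e0 &
       (forall i : int, (ereal_sup [set Lnorm P 2%:E (fun w =>
            (derive1n l (fun s => psi1 s (Fpast eps i w)) ep)%:E) | ep in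
            [set ep : R | (`|ep| <= e0)%R]] < +oo)%E) /\
       exists Y Ys : nat -> R -> T -> R,
         (forall (i : nat) (ep : R), `|ep| <= e0 ->
            is_condexp P (sigmaF eps 0)
              (fun w => derive1n l (fun s => psi1 s (Fpast eps i%:Z w)) ep) (Y i ep) /\
            is_condexp P (sigmaF0star eps eps')
              (fun w => derive1n l (fun s => psi1 s (Fstar eps eps' i%:Z w)) ep)
              (Ys i ep)) /\
         (\sum_(0 <= i <oo) ereal_sup [set Lnorm P 2%:E (fun w =>
            (Y i ep w - Ys i ep w)%:E) | ep in [set ep : R | (`|ep| <= e0)%R]] < +oo)%E) ->
  (* (b) *)
  (0 < limn_einf (fun n : nat => lambda_min (Sigma x n) * (n%:R^-1)%:E))%E ->
  (exists C : R, \forall n \near \oo, xin x n 2 <= C * n%:R) ->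
  (exists C : R, \forall n \near \oo,
     rtilde x n <= C * (n%:R `^ (1/2) * ln (n%:R) `^ (-2))) ->
  0 < iota -> 3/2 < q ->
  (* (i) *)
  Oas P (fun n w => ereal_sup [set (normv (Kt P psi x (err G eps) n beta w
                                        - Kt P psi x (err G eps) n 0 w))%:E
                               | beta in [set beta | normv beta <= bn iota n]])
        (fun n => (Ln P psi (err G eps) x iota q (nbar n)
                   + (Bn x iota (nbar n))%:E)%E)
  /\
  ((exists2 C : R, 0 < C & exists2 d : R, 0 < d & forall t : R, `|t| < d ->
      `|phi P psi (err G eps) t - t * derive1 (phi P psi (err G eps)) 0| <= C * t ^+ 2) ->
   (exists2 C : R, 0 < C & exists2 d : R, 0 < d & forall t : R, `|t| < d ->
      (mnorm P psi (err G eps) t <= (C * Num.sqrt `|t|)%:E)%E) ->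
   Oas P (fun n w => (normv (Omegat psi x (err G eps) n (betahat n w) w))%:E)
         (fun n => (rtilde x n)%:E) ->
   (* (ii) *)
   Oas P (fun n w => (normv (betahat n w))%:E) (fun n => (bn iota n)%:E)
   /\
   (* (iii) *)
   Oas P (fun n w => (normv (derive1 (phi P psi (err G eps)) 0 *: (Sigma x n *m betahat n w)
                      - \sum_(1 <= i < n.+1) (psi (err G eps i%:Z w) *: x i)))%:E)
         (fun n => (Ln P psi (err G eps) x iota q (nbar n)
                    + (Bn x iota (nbar n) + xin x n 3 * bn iota n ^+ 2
                       + rtilde x n)%:E)%E)).
Proof.
move=> iidE seqG mpsi1 Hcond _ _ _ psi_homo mean0 /andP[_ score2] [dA dA0 HA] _ f10 m_cont.
move=> [e5 e50 H5] H6 Hlam [C1' xi2'] [C2' xmax'] iota0 q32.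
set e := err G eps; set f1 := derive1 (phi P psi e) 0 in f10 *.
have L0 n : (0 <= Ln P psi e x iota q n)%E.
  rewrite /Ln mule_ge0//; first exact: sqrte_ge0.
  by rewrite lee_fin powR_ge0.
have B0 n : 0 <= Bn x iota n by exact: Bn_ge0.
have r0 n : 0 <= rtilde x n by exact: rtilde_ge0.
have X0 n : 0 <= xin x n 3 * bn iota n ^+ 2 by rewrite mulr_ge0 ?xin_ge0 ?sqr_ge0.
(* In dimension [0] every norm vanishes; the eigenvalue argument below needs a unit vector. *)
case: (posnP p) => [p0|p0].
  split => [|_ _ _].
    apply: aeW => w; exists 1 => //; apply: nearW => n; rewrite mul1e.
    apply: (@abse_sup_le _ _ _ _ 0); rewrite ?normv_ge0//= ?normv0 ?bn_ge0// => beta _.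
    by rewrite normv_dim0// adde_ge0// lee_fin.
  split; apply: aeW => w; exists 1 => //; apply: nearW => n; rewrite mul1e normv_dim0// abse0.
    by rewrite lee_fin bn_ge0.
  by rewrite adde_ge0// lee_fin !addr_ge0.
have mpsi : measurable_fun setT psi by exact: nondecreasing_measurable.
have mG : measurable_fun setT (G : seqT S -> R) by exact: measurable_seqT_fun.
have [dm dm0 mfin'] := mnorm_near_fin m_cont.
have [e6 e60 H6'] : exists2 r, 0 < r & forall l, (l <= p)%N ->
    exists D, summable_dep iidE r (hder psi1 l) D.
  apply: uniform_radius => [l r s /andP[_ sr] [D HD]|l lp].
    by exists D; exact: summable_depS HD.
  have [Ckl [r r1 [Hsup HY]]] := H6 l lp; exists r => //.
  exact: summable_dep_psi1 mpsi1 Ckl r1 Hsup HY.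
(* One radius below those of local integrability, of (A5), of finiteness of [m] near [0], which (A3)
   provides, and of (A6). *)
pose s0 := Num.min (Num.min dA e5) (Num.min dm e6).
have s00 : 0 < s0 by rewrite !lt_min dA0 e50 dm0.
have [sA s5 sm s6] : [/\ s0 <= dA, s0 <= e5, s0 <= dm & s0 <= e6].
  by rewrite /s0 !ge_min !lexx !orbT.
have psi1_trans s : `|s| < s0 ->
    (past_law iidE).-integrable setT (EFin \o (fun F : seqT S => psi (G F + s))) /\
    {ae past_law iidE, forall F, trans (letter_law iidE) (fun F => psi (G F + s)) F = psi1 s F}.
  move=> ss; apply: score_transition => //; last by apply: HA; exact: lt_le_trans sA.
  by move=> i; exact: Hcond.
have mfin t : `|t| < s0 -> (mnorm P psi e t < +oo)%E.
  by move=> ts; apply: mfin'; exact: lt_le_trans sm.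
have Cpsi l (i : int) w : (l <= p)%N -> Ck l (fun s => psi1 s (Fpast eps i w)).
  by move=> lp; have [+ _] := H6 l lp; apply.
pose Lam : seqT S -> \bar R := rat_lip psi1 e5.
have mLam : measurable_fun setT Lam.
  by apply: measurable_rat_lip => s; exact: measurable_seqT_fun.
have Lam0 F : (0 <= Lam F)%E by exact: rat_lip_ge0.
have iLam : (past_law iidE).-integrable setT Lam by exact: (rat_lip_integrable iidE mpsi1 e50 (H5 0)).
have lipLam i w : (Lam (Fpast eps i w) < +oo)%E -> forall s t, `|s| < s0 -> `|t| < s0 ->
    `|psi1 s (Fpast eps i w) - psi1 t (Fpast eps i w)| <= fine (Lam (Fpast eps i w)) * `|s - t|.
  move=> Loo s t ss ts; have [_ ck] := Cpsi 0%N i w (leq0n p).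
  by apply: (rat_lipP ck Loo); exact: lt_le_trans s5.
have C10 : 0 <= `|C1'| by []. have C20 : 0 <= `|C2'| by [].
have xi2 : \forall n \near \oo, xin x n 2 <= `|C1'| * n%:R.
  by apply: filterS xi2' => n /le_trans; apply; rewrite ler_wpM2r// ler_norm.
have xmax : \forall n \near \oo, rtilde x n <= `|C2'| * (n%:R `^ (1/2) * ln (n%:R) `^ (-2)).
  apply: filterS xmax' => n /le_trans; apply.
  by rewrite ler_wpM2r ?ler_norm// mulr_ge0// powR_ge0.
have [Delta Hsd] : exists Delta : nat -> R, forall l, (l <= p)%N ->
    summable_dep iidE s0 (hder psi1 l) (Delta l).
  have /choice[D HD] : forall l, exists D, (l <= p)%N -> summable_dep iidE s0 (hder psi1 l) D.
    move=> l; case: (leqP l p) => [lp|_]; last by exists 0.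
    by have [D HD] := H6' l lp; exists D => _; exact: summable_depS HD.
  by exists D.
have mscore : measurable_fun setT (fun F : seqT S => psi (G F)) by exact: measurableT_comp.
have [DeltaS Hscore] : exists D, summable_dep iidE s0 (fun=> psi \o G) D.
  apply: (summable_dep_root (ltW s00) (Hsd 0%N (leq0n p))) => //.
    rewrite -(sqI_fam iidE (@past_ix_inj 1) mscore) -nrmM.
    by apply: lte_mul_pinfty; rewrite ?nrm_ge0// ge0_fin_numE ?nrm_ge0.
  have := (psi1_trans 0 _).2; rewrite normr0 => /(_ s00).
  apply: filterS => F; rewrite (_ : (fun F0 => psi (G F0 + 0)) = psi \o G)//.
  by apply/funext => F' /=; rewrite addr0.
have mean0' : past_mean iidE (psi \o G) = 0.
  rewrite -(integral_past_mean iidE 1 mscore).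
  by move: mean0; rewrite unlock => ->.
have [c c0 Hco] := eventually_coercive p0 Hlam.
have c20 : 0 < c ^+ 2 by rewrite exprn_gt0.
have xi4 : \forall n \near \oo, c ^+ 2 * n%:R <= xin x n 4.
  apply: filterS Hco => n H; apply: xin4_ge; first exact: ltW.
  exact: (xin2_coercive p0 H).
have HLn := Ln_dyadic iota q s00 mfin C20 xmax.
split.
  have [C C0 HK] := stochastic_equicontinuity psi_homo mpsi mG mpsi1 s00 psi1_trans mfin p0 iota0
    mLam Lam0 iLam lipLam C10 C20 xi2 xmax Cpsi Hsd c20 xi4 q32.
  apply: (Oas_of_real (D' := fun n => Num.sqrt (tau_dyadic P eps psi G x iota (up_log 2 n)) *
     ln ((nbar n)%:R) `^ q + Bn x iota (nbar n))).
    by apply: filterS HLn => n ->; rewrite EFinD.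
  apply: filterS HK => w HK; exists C => //; apply: filterS HK => n HK.
  apply: (@abse_sup_le _ _ _ _ 0); rewrite ?normv_ge0//= ?normv0 ?bn_ge0//.
move=> [Cp Cp0 [dp dp0 Hphi]] [Cm Cm0 [dm' dm'0 Hm]] HO.
have HO' : {ae P, forall w, exists Cw : R, \forall n \near \oo,
    normv (Omegat psi x e n (betahat n w) w) <= Cw * rtilde x n}.
  apply: filterS HO => w [Cw _ H]; exists Cw; apply: filterS H => n.
  by rewrite -EFinM gee0_abs ?lee_fin ?normv_ge0.
have cons := consistency_ae psi_homo mpsi mG mpsi1 s00 psi1_trans mfin p0 iota0
    mLam Lam0 iLam lipLam C10 C20 xi2 xmax Cpsi Hsd Hscore mean0' c20 xi4 dm'0 (ltW Cm0) Hm
    f10 (ltW Cp0) dp0 c0 Hphi Hco betahat.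
have bah := bahadur_ae psi_homo mpsi mG mpsi1 s00 psi1_trans mfin p0 iota0
    mLam Lam0 iLam lipLam C10 C20 xi2 xmax Cpsi Hsd Hscore mean0' c20 xi4 dm'0 (ltW Cm0) Hm
    f10 (ltW Cp0) dp0 c0 Hphi Hco betahat q32.
split.
  apply: (Oas_of_real (D' := bn iota)); first exact: nearW.
  apply: filterS2 cons HO' => w H1 H2; exists 1 => //.
  by apply: filterS (H1 H2) => n; rewrite mul1r gee0_abs ?lee_fin ?normv_ge0.
apply: (Oas_of_real (D' := fun n => Num.sqrt (tau_dyadic P eps psi G x iota (up_log 2 n)) *
   ln ((nbar n)%:R) `^ q + (Bn x iota (nbar n) + xin x n 3 * bn iota n ^+ 2 + rtilde x n))).
  by apply: filterS HLn => n ->; rewrite EFinD.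
apply: filterS2 bah HO' => w H1 H2; have [C C0 H] := H1 H2; exists C => //.
by apply: filterS H => n; rewrite gee0_abs ?lee_fin ?normv_ge0.
Qed.
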